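(* Let $n\ge1$ and $k\ge2$ be integers, let $\mathcal{C}_n$ be the directed graph consisting of a single directed cycle of length $n$, and let $\mathbb{Z}/k$ act on $A=C^*(\mathcal{C}_n)$ by the restriction of the gauge action. If $k\mid n$, then $\mathrm{dim}^{\mathbb{Z}/k}_{\mathrm{WLT}}(A)=\mathrm{dim}^{\mathbb{Z}/k}_{\mathrm{LT}}(A)=\mathrm{dim}^{\mathbb{Z}/k}_{\mathrm{SLT}}(A)=0$. If $k\nmid n$, then $\mathrm{dim}^{\mathbb{Z}/k}_{\mathrm{WLT}}(A)=\mathrm{dim}^{\mathbb{Z}/k}_{\mathrm{LT}}(A)=\mathrm{dim}^{\mathbb{Z}/k}_{\mathrm{SLT}}(A)=1$.
   Context: $\mathcal{C}_n$ has vertices $v_1,\ldots,v_n$ and edges $e_1,\ldots,e_n$, where $e_i$ goes from $v_i$ to $v_{i+1}$ (indices mod $n$). For a finite directed graph $E=(E^0,E^1,r,s)$, $C^*(E)$ is the universal $C^*$-algebra generated by mutually orthogonal projections $P_v$ ($v\in E^0$) and partial isometries $S_e$ ($e\in E^1$) with mutually orthogonal ranges such that $S_e^*S_e=P_{r(e)}$, $S_eS_e^*\le P_{s(e)}$, and $P_v=\sum_{e\in s^{-1}(v)}S_eS_e^*$ whenever $s^{-1}(v)$ is nonempty. The gauge action of $\mathbb{S}^1$ is $S_e\mapsto\lambda S_e$, $P_v\mapsto P_v$ for $\lambda\in\mathbb{S}^1$; $\mathbb{Z}/k$ is identified with the $k$th roots of unity in $\mathbb{S}^1$. Local-triviality dimensions: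 let a compact group $G$ act on a unital $C^*$-algebra $A$. Equip $C(G)$ with $(\alpha_gf)(h)=f(hg)$ and $C_0((0,1])\otimes C(G)$ with the action on the second factor, and let $t$ be the identity function in $C_0((0,1])$. The plain dimension $\mathrm{dim}^G_{\mathrm{LT}}(A)$ (resp. weak dimension $\mathrm{dim}^G_{\mathrm{WLT}}(A)$) is the smallest $m\ge0$ for which there exist $G$-equivariant $*$-homomorphisms $\rho_0,\ldots,\rho_m:C_0((0,1])\otimes C(G)\to A$ such that $\sum_{i=0}^m\rho_i(t\otimes1)$ equals $1$ (resp. is invertible). The strong dimension $\mathrm{dim}^G_{\mathrm{SLT}}(A)$ is the smallest $m\ge 0$ for which there is a $G$-equivariant unital $*$-homomorphism $C(E_mG)\to A$, where $E_0G=G$, $E_{m+1}G=E_mG*G$ (topological join) with the diagonal action of $G$. If no such $m$ exists, the dimension is $\infty$. *)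

(* Defs.v *)
From HB Require Import structures.
From mathcomp Require Import all_boot all_order all_algebra.
From mathcomp Require Import complex.
From mathcomp Require Import all_classical all_reals all_analysis.

Set Implicit Arguments.
Unset Strict Implicit.
Unset Printing Implicit Defensive.

Import Order.TTheory GRing.Theory Num.Theory numFieldNormedType.Exports.

Local Open Scope classical_set_scope.
Local Open Scope ring_scope.

HB.instance Definition _ (R : realType) := NormedModule.copy R[i] R[i]^o.

(* Unital C*-algebras over C = R[i].  The norm is a field of the structure and
   not the library's `|_|: the only rings with a library norm are the
   numDomainType's, in which the norm is multiplicative.  For the same reason
   completeness and convergence are stated from the real-valued norm.  An
   algType is a nonzero ring, so the zero algebra is excluded. *)
HB.mixin Record isCStarAlgebra (R : realType) A of GRing.Algebra R[i] A := {
  star : A -> A;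
  cnorm : A -> R;
  starD : forall x y, star (x + y) = star x + star y;
  starZ : forall (c : R[i]) x, star (c *: x) = c^* *: star x;
  starM : forall x y, star (x * y) = star y * star x;
  starK : involutive star;
  cnorm_ge0 : forall x, 0 <= cnorm x;
  cnorm0_eq0 : forall x, cnorm x = 0 -> x = 0;
  cnormD : forall x y, cnorm (x + y) <= cnorm x + cnorm y;
  cnormZ : forall (c : R[i]) x,
    cnorm (c *: x) = ComplexField.Normc.normc c * cnorm x;
  cnormM : forall x y, cnorm (x * y) <= cnorm x * cnorm y;
  cnorm_cstar : forall x, cnorm (star x * x) = cnorm x ^+ 2;
  cnorm_complete : forall u : nat -> A,
    (forall e : R, 0 < e -> exists N : nat, forall m n : nat,
      (N <= m)%N -> (N <= n)%N -> cnorm (u m - u n) < e) ->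
    exists l : A, (fun n => cnorm (u n - l)) @ \oo --> (0 : R)
}.

#[short(type="cstarAlgType")]
HB.structure Definition CStarAlgebra (R : realType) :=
  { A of GRing.Algebra R[i] A & isCStarAlgebra R A }.

Arguments star {R s} x.
Arguments cnorm {R s} x.

Section CStar.
Variables (R : realType).

(* *-homomorphisms need not preserve the unit. *)
Record star_hom (A B : cstarAlgType R) (phi : A -> B) : Prop := StarHom {
  star_homD : forall x y, phi (x + y) = phi x + phi y;
  star_homZ : forall (c : R[i]) x, phi (c *: x) = c *: phi x;
  star_homM : forall x y, phi (x * y) = phi x * phi y;
  star_homS : forall x, phi (star x) = star (phi x)
}.

Variable A : cstarAlgType R.

Definition cstar_le (x y : A) : Prop := exists z : A, y - x = star z * z.

Definition is_projection (p : A) : Prop := p * p = p /\ star p = p.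

Definition partial_isometry (s : A) : Prop := s * star s * s = s.

Definition invertible (x : A) : Prop := exists y : A, x * y = 1 /\ y * x = 1.

Definition cstar_closed (D : set A) : Prop :=
  forall (u : nat -> A) (l : A), (forall n, D (u n)) ->
    (fun n => cnorm (u n - l)) @ \oo --> (0 : R) -> D l.

(* X generates A as a C*-algebra: the only closed *-subalgebra (not assumed to
   contain 1) containing X is A. *)
Definition cstar_generates (X : set A) : Prop :=
  forall D : set A,
    cstar_closed D -> D 0 ->
    (forall x y, D x -> D y -> D (x + y)) ->
    (forall (c : R[i]) x, D x -> D (c *: x)) ->
    (forall x y, D x -> D y -> D (x * y)) ->
    (forall x, D x -> D (star x)) ->
    X `<=` D -> D = setT.

End CStar.

Record digraph := Digraph {
  vertex : finType;
  edge : finType;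
  src : edge -> vertex;
  rng : edge -> vertex
}.

Arguments src {d} e.
Arguments rng {d} e.

Definition cycle_graph (n : nat) : digraph :=
  @Digraph 'I_n 'I_n (fun i => i) (fun i => ordS i).

Record graph_family (R : realType) (E : digraph) (A : cstarAlgType R)
    (P : vertex E -> A) (S : edge E -> A) : Prop := GraphFamily {
  graph_proj : forall v, is_projection (P v);
  graph_proj_ortho : forall v w, v != w -> P v * P w = 0;
  graph_piso : forall e, partial_isometry (S e);
  graph_range_ortho : forall e f, e != f ->
    (S e * star (S e)) * (S f * star (S f)) = 0;
  graph_rng : forall e, star (S e) * S e = P (rng e);
  graph_src : forall e, cstar_le (S e * star (S e)) (P (src e));
  graph_sum : forall v, (exists e, src e = v) ->
    P v = \sum_(e | src e == v) S e * star (S e)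
}.

(* (A, P, S) is the universal C*-algebra generated by a graph family.
   Uniqueness of phi is implied by the generation clause.  As phi need not
   preserve the unit, restricting to unital B loses nothing: a non-unital B may
   be replaced by its unitization. *)
Definition is_graph_cstar (R : realType) (E : digraph) (A : cstarAlgType R)
    (P : vertex E -> A) (S : edge E -> A) : Prop :=
  [/\ graph_family P S,
      cstar_generates (range P `|` range S) &
      forall (B : cstarAlgType R) (p : vertex E -> B) (s : edge E -> B),
        graph_family p s ->
        exists phi : A -> B, [/\ star_hom phi,
          forall v, phi (P v) = p v & forall e, phi (S e) = s e]].

HB.mixin Record isTopologicalGroup G of Topological G & Group G := {
  mulg_continuous : continuous (fun xy : G * G => (xy.1 * xy.2)%g);
  invg_continuous : continuous (fun x : G => (x^-1)%g)
}.

#[short(type="topologicalGroupType")]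
HB.structure Definition TopologicalGroup :=
  { G of Topological G & Group G & isTopologicalGroup G }.

Record is_action (R : realType) (G : topologicalGroupType) (A : cstarAlgType R)
    (alpha : G -> A -> A) : Prop := IsAction {
  action_hom : forall g, star_hom (alpha g);
  action_unit : forall g, alpha g 1 = 1;
  action1 : forall a, alpha 1%g a = a;
  actionM : forall g h a, alpha (g * h)%g a = alpha g (alpha h a);
  action_continuous : forall a g0,
    cnorm (alpha g a - alpha g0 a) @[g --> g0] --> (0 : R)
}.

Section Circle.
Variable R : realType.

Definition circle : Type := set_type [set z : R[i] | `|z| = 1].

HB.instance Definition _ := Topological.copy circle
  (set_type [set z : R[i] | `|z| = 1]).

Definition circle_val (z : circle) : R[i] := sval z.

Lemma circle_norm (z : circle) : `|circle_val z| = 1.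
Proof. by case: z => z /= /set_mem. Qed.

Lemma circle_val_inj : injective circle_val.
Proof. exact: val_inj. Qed.

Definition mk_circle (z : R[i]) (h : `|z| = 1) : circle :=
  exist _ z (mem_set h).

Lemma circle_mul_subproof (z w : circle) : `|circle_val z * circle_val w| = 1.
Proof. by rewrite normrM !circle_norm mulr1. Qed.

Lemma circle_inv_subproof (z : circle) : `|(circle_val z)^-1| = 1.
Proof. by rewrite normfV circle_norm invr1. Qed.

Definition circle_one : circle := mk_circle (normr1 R[i]).
Definition circle_mul (z w : circle) : circle :=
  mk_circle (circle_mul_subproof z w).
Definition circle_inv (z : circle) : circle :=
  mk_circle (circle_inv_subproof z).

Lemma circle_mulA : associative circle_mul.
Proof. by move=> x y z; apply: circle_val_inj => /=; exact: mulrA. Qed.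

Lemma circle_mul1 : left_id circle_one circle_mul.
Proof. by move=> x; apply: circle_val_inj => /=; exact: mul1r. Qed.

Lemma circle_mulr1 : right_id circle_one circle_mul.
Proof. by move=> x; apply: circle_val_inj => /=; exact: mulr1. Qed.

Lemma circle_val_neq0 (z : circle) : circle_val z != 0.
Proof. by rewrite -normr_gt0 circle_norm. Qed.

Lemma circle_mulV : left_inverse circle_one circle_inv circle_mul.
Proof.
by move=> x; apply: circle_val_inj; exact: (mulVf (circle_val_neq0 x)).
Qed.

Lemma circle_mulrV : right_inverse circle_one circle_inv circle_mul.
Proof.
by move=> x; apply: circle_val_inj; exact: (divff (circle_val_neq0 x)).
Qed.

HB.instance Definition _ := @isGroup.Build circle
  circle_one circle_inv circle_mul
  circle_mulA circle_mul1 circle_mulr1 circle_mulV circle_mulrV.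

Lemma circle_val_continuous : continuous circle_val.
Proof. exact: initial_continuous. Qed.

Lemma circle_mul_continuous :
  continuous (fun xy : circle * circle => (xy.1 * xy.2)%g).
Proof.
apply: (@continuous_comp_initial circle _ R[i] circle_val) => xy.
apply: (@continuousM R[i] _ (fun p : circle * circle => circle_val p.1)
  (fun p : circle * circle => circle_val p.2)).
- by apply: continuous_comp; [exact: cvg_fst|exact: circle_val_continuous].
- by apply: continuous_comp; [exact: cvg_snd|exact: circle_val_continuous].
Qed.

Lemma circle_inv_continuous : continuous (fun x : circle => (x^-1)%g).
Proof.
apply: (@continuous_comp_initial circle _ R[i] circle_val) => x.
apply: (@continuousV R[i] _ circle_val).
- exact: circle_val_neq0.
- exact: circle_val_continuous.
Qed.

HB.instance Definition _ := isTopologicalGroup.Build circle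
  circle_mul_continuous circle_inv_continuous.

Lemma circle_mulC (z w : circle) : (z * w = w * z)%g.
Proof. by apply: circle_val_inj => /=; exact: mulrC. Qed.

End Circle.

Section RootsOfUnity.
Variables (R : realType) (k : nat).

Definition roots_of_unity : Type :=
  set_type [set z : circle R | (z ^+ k = 1)%g].

HB.instance Definition _ := Topological.copy roots_of_unity
  (set_type [set z : circle R | (z ^+ k = 1)%g]).

Definition root_val (z : roots_of_unity) : circle R := sval z.

Lemma rootP (z : roots_of_unity) : (root_val z ^+ k = 1)%g.
Proof. by case: z => z /= /set_mem. Qed.

Lemma root_val_inj : injective root_val.
Proof. exact: val_inj. Qed.

Definition mk_root (z : circle R) (h : (z ^+ k = 1)%g) : roots_of_unity :=
  exist _ z (mem_set h).

Lemma root_mul_subproof (z w : roots_of_unity) :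
  ((root_val z * root_val w) ^+ k = 1)%g.
Proof.
by rewrite expgMn ?rootP ?mulg1//; exact: circle_mulC.
Qed.

Lemma root_inv_subproof (z : roots_of_unity) : ((root_val z)^-1 ^+ k = 1)%g.
Proof. by rewrite expVgn rootP invg1. Qed.

Definition root_one : roots_of_unity := mk_root (expg1n _ k).
Definition root_mul (z w : roots_of_unity) : roots_of_unity :=
  mk_root (root_mul_subproof z w).
Definition root_inv (z : roots_of_unity) : roots_of_unity :=
  mk_root (root_inv_subproof z).

Lemma root_mulA : associative root_mul.
Proof. by move=> x y z; apply: root_val_inj => /=; exact: mulgA. Qed.

Lemma root_mul1 : left_id root_one root_mul.
Proof. by move=> x; apply: root_val_inj => /=; exact: mul1g. Qed.

Lemma root_mulr1 : right_id root_one root_mul.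
Proof. by move=> x; apply: root_val_inj => /=; exact: mulg1. Qed.

Lemma root_mulV : left_inverse root_one root_inv root_mul.
Proof. by move=> x; apply: root_val_inj => /=; exact: mulVg. Qed.

Lemma root_mulrV : right_inverse root_one root_inv root_mul.
Proof. by move=> x; apply: root_val_inj => /=; exact: mulgV. Qed.

HB.instance Definition _ := @isGroup.Build roots_of_unity
  root_one root_inv root_mul
  root_mulA root_mul1 root_mulr1 root_mulV root_mulrV.

Lemma root_val_continuous : continuous root_val.
Proof. exact: initial_continuous. Qed.

Lemma root_mul_continuous :
  continuous (fun xy : roots_of_unity * roots_of_unity => (xy.1 * xy.2)%g).
Proof.
apply: (@continuous_comp_initial roots_of_unity _ (circle R) root_val) => xy.
apply: (@continuous_comp _ _ _
  (fun p : roots_of_unity * roots_of_unity => (root_val p.1, root_val p.2))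
  (fun p : circle R * circle R => (p.1 * p.2)%g)).
- have h1 : root_val p.1 @[p --> xy] --> root_val xy.1.
    by apply: continuous_comp; [exact: cvg_fst|exact: root_val_continuous].
  have h2 : root_val p.2 @[p --> xy] --> root_val xy.2.
    by apply: continuous_comp; [exact: cvg_snd|exact: root_val_continuous].
  exact: (cvg_pair h1 h2).
- exact: mulg_continuous.
Qed.

Lemma root_inv_continuous : continuous (fun x : roots_of_unity => (x^-1)%g).
Proof.
apply: (@continuous_comp_initial roots_of_unity _ (circle R) root_val) => x.
apply: (@continuous_comp _ _ _ root_val (fun p : circle R => (p^-1)%g)).
- exact: root_val_continuous.
- exact: invg_continuous.
Qed.

HB.instance Definition _ := isTopologicalGroup.Build roots_of_unity
  root_mul_continuous root_inv_continuous.

End RootsOfUnity.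

Definition is_gauge_action (R : realType) (E : digraph) (A : cstarAlgType R)
    (P : vertex E -> A) (S : edge E -> A) (gamma : circle R -> A -> A) : Prop :=
  [/\ is_action gamma,
      forall z v, gamma z (P v) = P v &
      forall z e, gamma z (S e) = circle_val z *: S e].

(* Z/k acts through its identification with the k-th roots of unity in S^1. *)
Definition restrict_roots (R : realType) (A : cstarAlgType R) (k : nat)
    (gamma : circle R -> A -> A) : roots_of_unity R k -> A -> A :=
  fun z => gamma (root_val z).

Arguments restrict_roots {R A} k gamma.

Record gspace (G : Type) := GSpace {
  gspace_sort :> topologicalType;
  gact : gspace_sort -> G -> gspace_sort
}.

Arguments gact {G g} x h.

Section Join.
Variables (R : realType).

Definition unit_interval : set R := [set` `[0, 1]].

Section JoinSpace.
Variables (X Y : topologicalType).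

Definition join_pre : topologicalType := (X * Y * set_type unit_interval)%type.

(* (x, y, 0) depends only on x, and (x, y, 1) only on y. *)
Definition join_rel : rel join_pre := fun p q =>
  `[< [/\ p.2 = q.2,
          sval p.2 = 1 \/ p.1.1 = q.1.1 &
          sval p.2 = 0 \/ p.1.2 = q.1.2] >].

Lemma join_rel_refl : reflexive join_rel.
Proof. by move=> p; apply/asboolP; split=> //; right. Qed.

Lemma join_rel_sym : symmetric join_rel.
Proof.
have h p q : join_rel p q -> join_rel q p.
  move=> /asboolP[e1 e2 e3]; apply/asboolP; rewrite -e1; split=> //.
  - by case: e2; [left|right].
  - by case: e3; [left|right].
by move=> p q; apply/idP/idP; exact: h.
Qed.

Lemma join_rel_trans : transitive join_rel.
Proof.
move=> q p r /asboolP[e1 e2 e3] /asboolP[f1 f2 f3].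
apply/asboolP; rewrite -e1 in f1 f2 f3; split=> //.
- by case: e2 => [|->]; [left|].
- by case: e3 => [|->]; [left|].
Qed.

Definition join_equiv :=
  EquivRel join_rel join_rel_refl join_rel_sym join_rel_trans.

Definition join : topologicalType :=
  quotient_topology {eq_quot join_equiv}%qT.

Definition join_pi (p : join_pre) : join :=
  (\pi_({eq_quot join_equiv}) p)%qT.

End JoinSpace.

Definition join_gspace (G : Type) (X Y : gspace G) : gspace G :=
  @GSpace G (join X Y) (fun q g =>
    let p := repr (q : {eq_quot (join_equiv X Y)}%qT) in
    @join_pi X Y ((gact p.1.1 g, gact p.1.2 g), p.2)).

End Join.

Definition group_gspace (G : topologicalGroupType) : gspace G :=
  @GSpace G G (fun h g => (h * g)%g).

Fixpoint EG (R : realType) (G : topologicalGroupType) (m : nat) : gspace G :=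
  if m is m'.+1 then join_gspace R (EG R G m') (group_gspace G)
  else group_gspace G.

Section Dimensions.
Variables (R : realType).

(* rho is a *-homomorphism on the *-algebra D of functions X -> C (with
   pointwise operations); its values outside D are irrelevant. *)
Record fun_star_hom (X : Type) (D : set (X -> R[i])) (A : cstarAlgType R)
    (rho : (X -> R[i]) -> A) : Prop := FunStarHom {
  fun_star_homD : forall f g, D f -> D g ->
    rho (fun x => f x + g x) = rho f + rho g;
  fun_star_homZ : forall (c : R[i]) f, D f ->
    rho (fun x => c * f x) = c *: rho f;
  fun_star_homM : forall f g, D f -> D g ->
    rho (fun x => f x * g x) = rho f * rho g;
  fun_star_homS : forall f, D f ->
    rho (fun x => (f x)^*) = star (rho f)
}.

Definition C_fun (X : topologicalType) : set (X -> R[i]) :=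
  [set f : X -> R[i] | continuous f].

Definition C0_fun (X : topologicalType) : set (X -> R[i]) :=
  [set f : X -> R[i] | continuous f /\
    forall e : R[i], 0 < e -> compact [set x | e <= `|f x|]].

Arguments C_fun X : clear implicits.
Arguments C0_fun X : clear implicits.

Definition half_open_interval : set R := [set` `]0, 1]].

Variables (G : topologicalGroupType) (A : cstarAlgType R) (alpha : G -> A -> A).

(* The action on functions is (g . f)(x) = f(x g). *)
Definition equivariant (X : gspace G) (D : set (X -> R[i]))
    (rho : (X -> R[i]) -> A) : Prop :=
  forall g f, D f -> rho (fun x => f (gact x g)) = alpha g (rho f).

(* C_0((0,1]) (x) C(G) is C0 of this space, with f (x) h the function
   (s, g) |-> f s * h g. *)
Definition cone : gspace G :=
  @GSpace G (set_type half_open_interval * G)%type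
    (fun p g => (p.1, (p.2 * g)%g)).

Definition tensor (f : set_type half_open_interval -> R[i]) (h : G -> R[i]) :
    cone -> R[i] := fun p => f p.1 * h p.2.

Definition coord (s : set_type half_open_interval) : R[i] := (sval s)%:C%C.

Definition cone_hom (rho : (cone -> R[i]) -> A) : Prop :=
  fun_star_hom (C0_fun cone) rho /\ equivariant (C0_fun cone) rho.

Definition has_LT (m : nat) : Prop :=
  exists rho : 'I_m.+1 -> (cone -> R[i]) -> A,
    (forall i, cone_hom (rho i)) /\
    \sum_i rho i (tensor coord (fun=> 1)) = 1.

Definition has_WLT (m : nat) : Prop :=
  exists rho : 'I_m.+1 -> (cone -> R[i]) -> A,
    (forall i, cone_hom (rho i)) /\
    invertible (\sum_i rho i (tensor coord (fun=> 1))).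

Definition has_SLT (m : nat) : Prop :=
  exists rho : (EG R G m -> R[i]) -> A,
    [/\ fun_star_hom (C_fun (EG R G m)) rho,
        equivariant (C_fun (EG R G m)) rho & rho (fun=> 1) = 1].

(* The smallest m such that Q m, or None (standing for infinity) if there is
   none. *)
Definition least (Q : nat -> Prop) : option nat :=
  if pselect (exists m, `[< Q m >]) is left h then Some (ex_minn h) else None.

Definition dimLT : option nat := least has_LT.
Definition dimWLT : option nat := least has_WLT.
Definition dimSLT : option nat := least has_SLT.

End Dimensions.

(* Main.v *)
Require Import Defs.
From HB Require Import structures.
From mathcomp Require Import all_boot all_order all_algebra all_solvable all_field.
From mathcomp Require Import complex.
From mathcomp Require Import all_classical all_reals all_analysis.
From mathcomp Require Import ring lra.

(* The element U = sum_i S_i is a unitary of degree 1, so a continuous functional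
   calculus C(T) -> A sending z to U is equivariant for rotation of the circle T.
   Two rotation-invariant families of disjoint bumps give local sections of
   T -> T / (Z/k) over an open cover by two sets, i.e. an equivariant map from T
   to the join G * G; composing with the calculus shows that all dimensions are
   at most 1.

   If k divides n, the degree-1 partial permutation unitary that rotates blocks
   of k consecutive indices has order k and degree 1 modulo k, and its spectral
   projections form a copy of C(Z/k) in A.

   Conversely weak dimension 0 produces a projection p whose k translates add up
   to 1.  Evaluate in the representation pi : A -> M_n(C).  The gauge action joins
   each translate of p to p by a norm-continuous path of projections, so all
   translates have the same rank r under pi, whence n = k r. *)

Set Implicit Arguments.
Unset Strict Implicit.
Unset Printing Implicit Defensive.

Import Order.TTheory GRing.Theory Num.Theory numFieldNormedType.Exports.

Local Open Scope classical_set_scope.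
Local Open Scope ring_scope.

(** The upper bounds use of [A] only a unitary [U] with [alpha g U = root_c g *: U], and the
    spectrum of [U] is never computed. This is why the calculus is based on functions on the whole
    circle, with the bound of the norm of F(U) by the supremum of |F| over the circle drawn from the
    C*-identity alone. One chart cannot suffice: for k >= 2 the k-fold covering of the circle by
    itself is connected and has no global section. A chart that picks the nearest root of unity
    degenerates where two roots tie, and a rotation moves these points off themselves. In the lower
    bound, [pi] cannot be made equivariant for the gauge action: the closed path around the cycle is
    sent to a diagonal matrix unit, whereas the gauge action multiplies it by z^n. Projections are
    therefore moved inside [A] and mapped to matrices only afterwards. The invariant compared along
    the path is the trace: it is unchanged by conjugation, additive over the translates, and equal
    to the rank on a projection. *)

Local Notation nc := ComplexField.Normc.normc.
Local Notation Re := complex.Re.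

(** * Real-valued modulus, and the circle as a compact metric space *)

Section ComplexPrelim.
Variable R : realType.
Implicit Types x y z : R[i].

Lemma normE z : `|z| = (nc z)%:C%C. Proof. by case: z. Qed.

Lemma nc_ge0 z : 0 <= nc z.
Proof. by rewrite -lecR -normE normr_ge0. Qed.

Lemma ncM x y : nc (x * y) = nc x * nc y.
Proof. exact: ComplexField.Normc.normcM. Qed.

Lemma ncD x y : nc (x + y) <= nc x + nc y.
Proof. exact: (@le_normcD R x y). Qed.

Lemma nc0 : nc (0 : R[i]) = 0.
Proof. exact: ComplexField.Normc.normc0. Qed.

Lemma nc1 : nc (1 : R[i]) = 1.
Proof. exact: ComplexField.Normc.normc1. Qed.

Lemma ncN x : nc (- x) = nc x.
Proof. exact: (@normcN R x). Qed.

Lemma ncB x y : nc (x - y) = nc (y - x).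
Proof. by rewrite -opprB ncN. Qed.

Lemma ncX x n : nc (x ^+ n) = nc x ^+ n.
Proof. by elim: n => [|n IH]; rewrite ?nc1// !exprS ncM IH. Qed.

Lemma ncR (r : R) : nc r%:C%C = `|r|.
Proof. by rewrite /= expr0n /= addr0 sqrtr_sqr. Qed.

Lemma nc_nat n : nc (n%:R : R[i]) = n%:R.
Proof.
have -> : (n%:R : R[i]) = (n%:R)%:C%C by rewrite rmorph_nat.
by rewrite ncR normr_nat.
Qed.

Lemma ncV x : nc x^-1 = (nc x)^-1.
Proof. exact: ComplexField.Normc.normcV. Qed.

Lemma nc_eq0 x : nc x = 0 -> x = 0.
Proof. exact: ComplexField.Normc.eq0_normc. Qed.

Lemma ncJ x : nc x^* = nc x.
Proof. by apply: complexI; rewrite -!normE norm_conjC. Qed.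

Lemma nc_sum (I : Type) (r : seq I) (P : pred I) (F : I -> R[i]) :
  nc (\sum_(i <- r | P i) F i) <= \sum_(i <- r | P i) nc (F i).
Proof.
elim/big_rec2: _ => [|i a b _ h]; first by rewrite nc0.
by apply: le_trans (ncD _ _) _; rewrite lerD2l.
Qed.

Lemma nc_ge_Re x : `|Re x| <= nc x.
Proof. by rewrite -lecR -normE normc_ge_Re. Qed.

Lemma nc_sqr x : (nc x ^+ 2)%:C%C = x * x^*.
Proof. by rewrite rmorphXn /= -normE normCK. Qed.

Lemma circle_nc (z : circle R) : nc (circle_val z) = 1.
Proof. by apply: complexI; rewrite -normE circle_norm. Qed.

Lemma circle_conj (z : circle R) : (circle_val z)^* = (circle_val z)^-1.
Proof.
apply: (mulfI (circle_val_neq0 z)); rewrite divff ?circle_val_neq0//.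
by rewrite -normCK circle_norm expr1n.
Qed.

Lemma circle_valM (z w : circle R) :
  circle_val (z * w)%g = circle_val z * circle_val w.
Proof. by []. Qed.

Lemma circle_valX (z : circle R) n : circle_val (z ^+ n)%g = circle_val z ^+ n.
Proof. by elim: n => [//|n IH]; rewrite expgS circle_valM IH exprS. Qed.

Lemma circle_valV (z : circle R) : circle_val (z^-1)%g = (circle_val z)^-1.
Proof. by []. Qed.

Section Cvg.
Variables (T : Type) (F : set_system T) (FF : Filter F).

Lemma cvg_ncP (f : T -> R[i]) (l : R[i]) :
  f @ F --> l <-> forall e : R, 0 < e -> \forall t \near F, nc (l - f t) < e.
Proof.
split=> [/cvgrPdist_lt h e e0|h].
  have e0' : 0 < e%:C%C :> R[i] by rewrite ltcR.
  by apply: filterS (h _ e0') => t; rewrite normE ltcR.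
apply/cvgrPdist_lt => e e0.
have er : e = (Re e)%:C%C by rewrite RRe_real// gtr0_real.
rewrite er ltcR in e0 *.
by apply: filterS (h _ e0) => t; rewrite normE ltcR.
Qed.

End Cvg.

Lemma continuous_ncP (X : topologicalType) (f : X -> R[i]) (x : X) :
  {for x, continuous f} <->
  forall e : R, 0 < e -> \forall t \near x, nc (f x - f t) < e.
Proof. exact: cvg_ncP. Qed.

Lemma continuous_absP (X : topologicalType) (f : X -> R) (x : X) :
  {for x, continuous f} <->
  forall e : R, 0 < e -> \forall t \near x, `|f x - f t| < e.
Proof.
by split=> [/cvgrPdist_lt //|h]; apply/cvgrPdist_lt.
Qed.

Lemma near_nc z (e : R) : 0 < e -> \forall t \near z, nc (z - t) < e.
Proof.
move=> e0; apply/nbhs_ballP; exists e%:C%C => /=; first by rewrite ltcR.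
by move=> t; rewrite /ball /= normE ltcR.
Qed.

Lemma continuous_realC : continuous (fun r : R => r%:C%C : R[i]).
Proof.
move=> r; apply/continuous_ncP => e e0.
have /cvgrPdist_lt /(_ _ e0) := @cvg_id _ (nbhs r).
by apply: filterS => t; rewrite -rmorphB ncR.
Qed.

Lemma continuous_Re : continuous (fun z : R[i] => Re z).
Proof.
move=> z; apply/continuous_absP => e e0.
have := near_nc z e0.
apply: filterS => t; apply: le_lt_trans.
by rewrite -raddfB /=; apply: nc_ge_Re.
Qed.

Lemma continuous_conj : continuous (fun z : R[i] => z^*).
Proof.
move=> z; apply/continuous_ncP => e e0.
have := near_nc z e0.
by apply: filterS => t; rewrite -rmorphB ncJ.
Qed.

Lemma continuous_nc : continuous (fun z : R[i] => nc z).
Proof.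
move=> z; apply/continuous_absP => e e0.
have := near_nc z e0.
apply: filterS => t; apply: le_lt_trans.
have h1 := ncD (z - t) t; have h2 := ncD (t - z) z.
rewrite !subrK [nc (t - z)]ncB in h1 h2.
by rewrite ler_norml; lra.
Qed.

Definition cis (t : R) : R[i] := (cos t +i* sin t)%C.

Lemma cis_norm t : `|cis t| = 1.
Proof. by rewrite normE /= cos2Dsin2 sqrtr1. Qed.

Definition circle_exp (t : R) : circle R := mk_circle (cis_norm t).

(** The arccosine of the real part gives the angle up to sign, and the sign of the imaginary part
    decides it. The bounded range of angles makes the circle a continuous image of a segment, which
    yields compactness and maxima. *)
Lemma circle_exp_surj (z : circle R) :
  exists t : R, t \in `[- pi, pi] /\ circle_exp t = z.
Proof.
have : nc (circle_val z) ^+ 2 = 1 by rewrite circle_nc expr1n.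
case: z => [[a b] hz]; rewrite /circle_val /= sqr_sqrtr ?addr_ge0 ?sqr_ge0// => h.
have ha : -1 <= a <= 1 by nra.
pose s := acos a.
have hs : 0 <= s <= pi by rewrite acos_ge0// acos_lepi.
have hsin : sin s = `|b|.
  rewrite sin_acos//; have -> : 1 - a ^+ 2 = b ^+ 2 by lra.
  by rewrite sqrtr_sqr.
case: (leP 0 b) => hb.
- exists s; split; first by rewrite in_itv /=; lra.
  apply: val_inj; rewrite /= /cis acosK ?in_itv//= hsin ger0_norm//.
- exists (- s); split; first by rewrite in_itv /=; lra.
  apply: val_inj; rewrite /= /cis cosN sinN acosK ?in_itv//= hsin.
  by rewrite ltr0_norm// opprK.
Qed.

Lemma continuous_cis : continuous cis.
Proof.
move=> t.
have -> : cis = fun t => (cos t)%:C%C + 'i%C * (sin t)%:C%C.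
  by apply/funext => s; rewrite [LHS]complexE.
apply: cvgD.
  by apply: continuous_comp; [exact: continuous_cos|exact: continuous_realC].
apply: cvgM; first exact: cvg_cst.
by apply: continuous_comp; [exact: continuous_sin|exact: continuous_realC].
Qed.

Lemma continuous_circle_exp : continuous circle_exp.
Proof.
by apply: (@continuous_comp_initial (circle R) _ R[i] (@circle_val R));
  exact: continuous_cis.
Qed.

Lemma circle_compact : compact [set: circle R].
Proof.
have -> : [set: circle R] = circle_exp @` `[- pi, pi].
  apply/seteqP; split=> // z _; have [t [ht <-]] := circle_exp_surj z.
  by exists t.
apply: continuous_compact; last exact: segment_compact.
exact/continuous_subspaceT/continuous_circle_exp.
Qed.

(** Trades the subspace topology for a radius; all later continuity arguments on the circle go
    through this form. *)
Lemma nbhs_circleP (z : circle R) (P : set (circle R)) :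
  nbhs z P <-> exists2 r : R, 0 < r &
    forall w, nc (circle_val z - circle_val w) < r -> P w.
Proof.
split; last first.
  move=> [r r0 h].
  have /continuous_ncP /(_ _ r0) := @circle_val_continuous R z.
  exact: filterS.
rewrite nbhsE => -[_ [[B oB <-] zB] BP].
have /nbhs_ballP [e /= e0 eB] : nbhs (circle_val z) B by exact: open_nbhs_nbhs.
have er : e = (Re e)%:C%C by rewrite RRe_real// gtr0_real.
exists (Re e); first by rewrite -ltcR -er.
move=> w hw; apply: BP; apply: eB; rewrite /ball /= er normE ltcR.
exact: hw.
Qed.

Lemma circle_unif_continuous (f : circle R -> R[i]) : continuous f ->
  forall e : R, 0 < e -> exists2 d : R, 0 < d & forall z w : circle R,
    nc (circle_val z - circle_val w) < d -> nc (f z - f w) < e.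
Proof.
move=> cf e e0.
(* Heine-Cantor in filter form: with the radius d tending to 0 from the right as parameter, a
   modulus found near each point becomes a modulus for the whole circle. *)
have /compact_near_coveringP := circle_compact.
move=> /(_ R (0^'+) (fun d (z : circle R) => forall w : circle R,
   nc (circle_val z - circle_val w) < d -> nc (f z - f w) < e)).
case=> [z _|].
  have e20 : 0 < e / 2 by rewrite divr_gt0.
  have /nbhs_circleP [r r0 hr] : \forall w \near z, nc (f z - f w) < e / 2.
    by move/continuous_ncP: (cf z); apply.
  have r20 : 0 < r / 2 by rewrite divr_gt0.
  exists ([set w | nc (circle_val z - circle_val w) < r / 2],
          [set d : R | d < r / 2]).
    split; first by apply/nbhs_circleP; exists (r / 2).
    by apply: nbhs_right_lt.
  move=> [w d] /= [hw hd] v hv.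
  have -> : f w - f v = (f z - f v) - (f z - f w) by ring.
  apply: le_lt_trans (ncD _ _) _; rewrite ncN [ltRHS](splitr e).
  apply: ltrD; apply: hr; last by apply: lt_trans hw _; lra.
  have -> : circle_val z - circle_val v =
    (circle_val z - circle_val w) + (circle_val w - circle_val v) by ring.
  by apply: le_lt_trans (ncD _ _) _; lra.
move=> d /= d0 hd; exists (d / 2); first lra.
move=> z w hzw; apply: (hd (d / 2)) hzw => //=; last lra.
by rewrite sub0r normrN gtr0_norm; lra.
Qed.

End ComplexPrelim.

(** * Continuity of pointwise operations *)

Section Continuity.
Variables (R : realType) (X : topologicalType).
Implicit Types (f g : X -> R[i]) (r s : X -> R).

Lemma ccontD f g : continuous f -> continuous g -> continuous (fun x => f x + g x).
Proof. by move=> cf cg x; exact: (cvgD (cf x) (cg x)). Qed.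

Lemma ccontM f g : continuous f -> continuous g -> continuous (fun x => f x * g x).
Proof. by move=> cf cg x; exact: (cvgM (cf x) (cg x)). Qed.

Lemma ccontZ c f : continuous f -> continuous (fun x => c * f x).
Proof. by move=> cf; exact: (ccontM (@cst_continuous _ _ c) cf). Qed.

Lemma ccontB f g : continuous f -> continuous g -> continuous (fun x => f x - g x).
Proof. by move=> cf cg x; exact: (cvgB (cf x) (cg x)). Qed.

Lemma ccontJ f : continuous f -> continuous (fun x => (f x)^*).
Proof. by move=> cf x; exact: (continuous_comp (cf x) (@continuous_conj R (f x))). Qed.

Lemma ccontR r : continuous r -> continuous (fun x => (r x)%:C%C : R[i]).
Proof. by move=> cr x; exact: (continuous_comp (cr x) (@continuous_realC R (r x))). Qed.

Lemma ccontX f n : continuous f -> continuous (fun x => f x ^+ n).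
Proof.
move=> cf; elim: n => [|n IH]; first exact: cst_continuous.
have -> : (fun x => f x ^+ n.+1) = fun x => f x * f x ^+ n.
  by apply/funext => x; rewrite exprS.
exact: ccontM.
Qed.

Lemma rcont_nc f : continuous f -> continuous (fun x => nc (f x)).
Proof. by move=> cf x; exact: (continuous_comp (cf x) (@continuous_nc R (f x))). Qed.

Lemma rcont_Re f : continuous f -> continuous (fun x => Re (f x)).
Proof. by move=> cf x; exact: (continuous_comp (cf x) (@continuous_Re R (f x))). Qed.

Lemma rcontD r s : continuous r -> continuous s -> continuous (fun x => r x + s x).
Proof. by move=> cf cg x; exact: (cvgD (cf x) (cg x)). Qed.

Lemma rcontB r s : continuous r -> continuous s -> continuous (fun x => r x - s x).
Proof. by move=> cf cg x; exact: (cvgB (cf x) (cg x)). Qed.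

Lemma rcontM r s : continuous r -> continuous s -> continuous (fun x => r x * s x).
Proof. by move=> cf cg x; exact: (cvgM (cf x) (cg x)). Qed.

Lemma rcontV r : (forall x, r x != 0) -> continuous r -> continuous (fun x => (r x)^-1).
Proof. by move=> r0 cr x; exact: (cvgV (r0 x) (cr x)). Qed.

Lemma rcont_sqrt r : continuous r -> continuous (fun x => Num.sqrt (r x)).
Proof. by move=> cr x; exact: (continuous_comp (cr x) (@sqrt_continuous R (r x))). Qed.

Lemma rcont_max r s : continuous r -> continuous s ->
  continuous (fun x => Num.max (r x) (s x)).
Proof.
by move=> cr cs x; apply: (continuous_max (cr x) (cs x)).
Qed.

Lemma rcont_sum (I : Type) (l : seq I) (F : I -> X -> R) :
  (forall i, continuous (F i)) -> continuous (fun x => \sum_(i <- l) F i x).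
Proof.
move=> cF; elim: l => [|i l IH].
  by under eq_fun do rewrite big_nil; exact: cst_continuous.
have -> : (fun x => \sum_(i <- i :: l) F i x) = fun x => F i x + \sum_(i <- l) F i x.
  by apply/funext => x; rewrite big_cons.
exact: rcontD.
Qed.

Lemma rcont_prod (I : Type) (l : seq I) (P : pred I) (F : I -> X -> R) :
  (forall i, continuous (F i)) -> continuous (fun x => \prod_(i <- l | P i) F i x).
Proof.
move=> cF; elim: l => [|i l IH].
  by under eq_fun do rewrite big_nil; exact: cst_continuous.
have -> : (fun x => \prod_(i <- i :: l | P i) F i x) =
    fun x => (if P i then F i x else 1) * \prod_(i <- l | P i) F i x.
  by apply/funext => x; rewrite big_cons; case: ifP; rewrite ?mul1r.
by apply: rcontM => //; case: (P i) => //; exact: cst_continuous.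
Qed.

End Continuity.

(** * Fourier sums over roots of unity and the sampled Fejer kernel *)

Section RootsOfUnity.
Variable R : realType.

(** [R[i]] is algebraically closed and X^L - 1 is separable, so there are L distinct L-th roots of
    unity, which forces one of them to be primitive. *)
Lemma primitive_root_exists (L : nat) : (0 < L)%N ->
  exists z : circle R, L.-primitive_root (circle_val z).
Proof.
move=> L0; pose p : {poly R[i]} := 'X^L - 1.
have [r Dp] := closed_field_poly_normal p.
rewrite (monicP _) ?monicXnsubC // scale1r in Dp.
have rn1 : all L.-unity_root r by apply/allP => z; rewrite -root_prod_XsubC -Dp.
have sz_r : (L < (size r).+1)%N.
  by rewrite -(size_prod_XsubC r id) -Dp size_XnsubC.
have [|z hz prz] := hasP (has_prim_root L0 rn1 _ sz_r).
  by rewrite -separable_prod_XsubC -Dp separable_Xn_sub_1 // pnatr_eq0 -lt0n.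
have z1 : `|z| = 1.
  apply/eqP; rewrite -(@pexpr_eq1 _ _ L)//.
  by rewrite -normrX (prim_expr_order prz) normr1.
by exists (mk_circle z1).
Qed.

Lemma sum_powers_eq0 (x : R[i]) L : x ^+ L = 1 -> x != 1 ->
  \sum_(i < L) x ^+ i = 0.
Proof.
move=> xL x1; apply: (mulfI (_ : x - 1 != 0)); first by rewrite subr_eq0.
by rewrite mulr0 -subrX1 xL subrr.
Qed.

(** Orthogonality of the characters of Z/L. *)
Lemma sum_prim_root (z : R[i]) L a b : L.-primitive_root z ->
  (a < L)%N -> (b < L)%N ->
  \sum_(i < L) (z ^+ a / z ^+ b) ^+ i = if a == b then L%:R else 0.
Proof.
move=> hz aL bL.
have L0 : (0 < L)%N := leq_ltn_trans (leq0n a) aL.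
have z0 : z != 0.
  by apply/eqP => z0; have := prim_expr_order hz; rewrite z0 expr0n gtn_eqF//= =>
    /eqP; rewrite eq_sym oner_eq0.
case: eqP => [->|/eqP ab].
  rewrite divff ?expf_neq0//.
  under eq_bigr => i _ do rewrite expr1n.
  by rewrite sumr_const card_ord.
apply: sum_powers_eq0.
  by rewrite expr_div_n -!exprM ![(_ * L)%N]mulnC !exprM (prim_expr_order hz) !expr1n divr1.
apply/eqP => h; have : z ^+ a = z ^+ b.
  by rewrite -[LHS](divfK (expf_neq0 b z0)) h mul1r.
by move/eqP; rewrite (eq_prim_root_expr hz) !modn_small// (negPf ab).
Qed.

(* The j-th coefficient is the average of p(w) / w^j over roots of unity w. *)
Lemma poly_coef_bound (p : {poly R[i]}) (M : R) :
  (forall z : circle R, nc p.[circle_val z] <= M) -> forall j, nc p`_j <= M.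
Proof.
(* [L] exceeds both the degree of [p] and [j], so sampling at L-th roots of unity confuses no two of
   the exponents involved. *)
move=> hM j; pose L := maxn (size p) j.+1.
have L0 : (0 < L)%N by rewrite leq_max orbT.
have [z hz] := primitive_root_exists L0; set w := circle_val z in hz.
have jL : (j < L)%N by rewrite leq_max leqnn orbT.
have wn i : nc (w ^+ i) = 1 by rewrite ncX circle_nc expr1n.
have key : \sum_(i < L) p.[w ^+ i] / (w ^+ j) ^+ i = L%:R * p`_j.
  transitivity (\sum_(i < L) \sum_(m < L) p`_m * (w ^+ m / w ^+ j) ^+ i).
    apply: eq_bigr => i _; rewrite (horner_coef_wide _ (leq_maxl _ j.+1)) mulr_suml.
    apply: eq_bigr => m _; rewrite -mulrA; congr (_ * _).
    by rewrite expr_div_n (exprAC w m i).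
  rewrite exchange_big /= (bigD1 (Ordinal jL)) //= [X in _ + X]big1 ?addr0.
    by rewrite -mulr_sumr sum_prim_root// eqxx mulrC.
  move=> m mj; rewrite -mulr_sumr sum_prim_root//.
  by rewrite ifN ?mulr0//; apply: contra mj => /eqP h; apply/eqP/val_inj.
have : nc (L%:R * p`_j) <= L%:R * M.
  rewrite -key; apply: le_trans (nc_sum _ _ _) _.
  have -> : L%:R * M = \sum_(i < L) M by rewrite sumr_const card_ord mulr_natl.
  apply: ler_sum => i _; rewrite ncM ncV -exprM wn invr1 mulr1.
  by rewrite -circle_valX.
by rewrite ncM nc_nat ler_pM2l// ltr0n.
Qed.

(** The one-sided Dirichlet kernel; its squared modulus divided by [L] is the Fejer kernel. *)
Definition dirichlet (L : nat) (u : R[i]) : R[i] := \sum_(a < L) u ^+ a.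

(** Telescoping gives u^L - 1, of modulus at most 2. This is the decay of the kernel away from u =
    1. *)
Lemma dirichlet_bound L (u : circle R) :
  nc (dirichlet L (circle_val u)) * nc (circle_val u - 1) <= 2.
Proof.
rewrite -ncM mulrC -subrX1; apply: le_trans (ncD _ _) _.
by rewrite ncN nc1 ncX circle_nc expr1n.
Qed.

(* Sampling the Fejer kernel at all L-th roots of unity is exact because its
   frequencies are smaller than L. *)
Lemma fejer_sum (w z : circle R) L : L.-primitive_root (circle_val w) ->
  \sum_(i < L) nc (dirichlet L (circle_val (z * w ^- i)%g)) ^+ 2 = L%:R ^+ 2.
Proof.
move=> hw; set x := circle_val z; set v := circle_val w.
have val i : circle_val (z * w ^- i)%g = x / v ^+ i.
  by rewrite circle_valM circle_valV circle_valX.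
under eq_bigr => i _ do rewrite val.
apply: complexI; rewrite rmorph_sum rmorphXn rmorph_nat.
transitivity (\sum_(i < L) \sum_(a < L) \sum_(b < L)
    x ^+ a * (x^* ) ^+ b * (v ^+ b / v ^+ a) ^+ i).
  apply: eq_bigr => i _; rewrite [LHS]nc_sqr /dirichlet rmorph_sum /= mulr_suml.
  apply: eq_bigr => a _; rewrite mulr_sumr; apply: eq_bigr => b _.
  rewrite rmorphXn rmorphM fmorphV rmorphXn /= (circle_conj w : v^* = v^-1).
  rewrite -[(_ ^-1 ^+ i)^-1]exprVn invrK.
  by rewrite !exprMn !exprVn -!exprM ![(i * _)%N]mulnC; ring.
rewrite exchange_big /=.
transitivity (\sum_(a < L) (L%:R : R[i])); last first.
  by rewrite sumr_const card_ord -[LHS]mulr_natr expr2.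
apply: eq_bigr => a _; rewrite exchange_big /= (bigD1 a)//= [X in _ + X]big1 ?addr0.
  rewrite -mulr_sumr sum_prim_root// eqxx -exprMn circle_conj divff ?expr1n ?mul1r//.
  exact: circle_val_neq0.
move=> b ba; rewrite -mulr_sumr sum_prim_root//.
by rewrite ifN ?mulr0//; apply: contra ba => /eqP h; apply/eqP/val_inj.
Qed.

End RootsOfUnity.

(** * Elementary norm identities in a C*-algebra *)

Section CStarBasics.
Variables (R : realType) (A : cstarAlgType R).
Implicit Types x y : A.

Lemma star0 : star (0 : A) = 0.
Proof. by rewrite -[X in star X](scale0r 0) starZ rmorph0 scale0r. Qed.

Lemma star1 : star (1 : A) = 1.
Proof. by rewrite -[LHS]mulr1 -{2}(starK 1) -starM mulr1 starK. Qed.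

Lemma starN x : star (- x) = - star x.
Proof. by rewrite -scaleN1r starZ rmorphN1 scaleN1r. Qed.

Lemma starB x y : star (x - y) = star x - star y.
Proof. by rewrite starD starN. Qed.

Lemma star_sum (I : Type) (r : seq I) (P : pred I) (F : I -> A) :
  star (\sum_(i <- r | P i) F i) = \sum_(i <- r | P i) star (F i).
Proof. by apply: (big_morph _ starD star0). Qed.

Lemma starX x n : star (x ^+ n) = star x ^+ n.
Proof. by elim: n => [|n IH]; rewrite ?star1// exprSr starM IH exprS. Qed.

Lemma cnorm0 : cnorm (0 : A) = 0.
Proof. by rewrite -(scale0r 0) cnormZ nc0 mul0r. Qed.

Lemma cnormN x : cnorm (- x) = cnorm x.
Proof. by rewrite -scaleN1r cnormZ ncN nc1 mul1r. Qed.

Lemma cnormB x y : cnorm (x - y) = cnorm (y - x).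
Proof. by rewrite -opprB cnormN. Qed.

Lemma cnorm_sum (I : Type) (r : seq I) (P : pred I) (F : I -> A) :
  cnorm (\sum_(i <- r | P i) F i) <= \sum_(i <- r | P i) cnorm (F i).
Proof.
elim/big_rec2: _ => [|i a b _ h]; first by rewrite cnorm0.
by apply: le_trans (cnormD _ _) _; rewrite lerD2l.
Qed.

Lemma cnorm_small_eq x y : (forall e : R, 0 < e -> cnorm (x - y) <= e) -> x = y.
Proof.
move=> h; apply/eqP; rewrite -subr_eq0; apply/eqP/cnorm0_eq0/eqP.
rewrite eq_le cnorm_ge0 andbT; apply/ler_addgt0Pr => e e0.
by rewrite add0r; exact: h.
Qed.

Lemma cnorm_star x : cnorm (star x) = cnorm x.
Proof.
have h y : cnorm y <= cnorm (star y).
  have := cnorm_ge0 y; rewrite le_eqVlt => /predU1P[<-|y0]; first exact: cnorm_ge0.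
  by rewrite -(ler_pM2r y0) -expr2 -cnorm_cstar cnormM.
by apply/eqP; rewrite eq_le h -{2}[x]starK h.
Qed.

(** The C*-identity leaves only the values 0 and 1, and the algebra is nonzero. *)
Lemma cnorm1 : cnorm (1 : A) = 1.
Proof.
have := cnorm_cstar (1 : A); rewrite star1 mulr1 => /esym/eqP.
rewrite expr2 -{3}[cnorm _]mul1r -subr_eq0 -mulrBl mulf_eq0 subr_eq0.
by case/orP => /eqP // /cnorm0_eq0 /eqP; rewrite oner_eq0.
Qed.

Lemma cnorm_isometry x : star x * x = 1 -> cnorm x = 1.
Proof.
move=> h; apply/eqP; rewrite -(@pexpr_eq1 _ _ 2)// ?cnorm_ge0//.
by rewrite -cnorm_cstar h cnorm1.
Qed.

Lemma cnorm_isometryX x n : star x * x = 1 -> cnorm (x ^+ n) <= 1.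
Proof.
move=> h; elim: n => [|n IH]; first by rewrite cnorm1.
rewrite exprS; apply: le_trans (cnormM _ _) _.
by rewrite (cnorm_isometry h) mul1r.
Qed.

Lemma cnorm_projection x : is_projection x -> cnorm x <= 1.
Proof.
move=> [xx sx]; have := cnorm_cstar x; rewrite sx xx => h.
have := cnorm_ge0 x; nra.
Qed.

(** Repeated squaring with the C*-identity; this takes the place of the spectral radius formula. *)
Lemma cnormX2 x m : star x = x -> cnorm (x ^+ (2 ^ m)) = cnorm x ^+ (2 ^ m).
Proof.
move=> sx; elim: m => [|m IH]; first by rewrite !expr1.
by rewrite expnSr !exprM -IH -cnorm_cstar starX sx expr2.
Qed.

Lemma cstar_cauchy_cvg (u : nat -> A) :
  (forall e : R, 0 < e -> exists N : nat, forall m n : nat,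
     (N <= m)%N -> (N <= n)%N -> cnorm (u m - u n) < e) ->
  exists l, forall e : R, 0 < e -> exists N : nat, forall n, (N <= n)%N ->
    cnorm (u n - l) < e.
Proof.
move=> /cnorm_complete [l hl]; exists l => e e0.
move/cvgrPdist_lt: hl => /(_ e e0) [N _ hN]; exists N => n Nn.
by have := hN n Nn; rewrite sub0r normrN ger0_norm// cnorm_ge0.
Qed.

End CStarBasics.

(** * Laurent polynomials in a unitary and the sharp bound on their norm *)

Lemma bernoulli_ineq (R : realDomainType) (s : R) n : 0 <= s ->
  1 + n%:R * s <= (1 + s) ^+ n.
Proof.
move=> s0; elim: n => [|n IH]; first by rewrite mul0r addr0 expr0.
rewrite exprSr; apply: le_trans (ler_wpM2r _ IH); last lra.
rewrite -natr1.
have : 0 <= n%:R * s * s by rewrite !mulr_ge0.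
nra.
Qed.

(** A factor linear in the exponent cannot make up for the exponential growth of (x/y)^N, so
    estimating all powers 2^m removes the constant from a coarse inequality. *)
Lemma ler_of_power_growth (R : realType) (x y : R) (c : nat) : 0 <= x -> 0 <= y ->
  (forall m, x ^+ (2 ^ m) <= (c * 2 ^ m).+1%:R * y ^+ (2 ^ m)) -> x <= y.
Proof.
move=> x0 y0 h; rewrite leNgt; apply/negP => yx.
move: y0; rewrite le_eqVlt => /predU1P[y0|y0].
  by have := h 0%N; rewrite !expr1 -y0 mulr0 leNgt y0 yx.
pose s := x / y - 1.
have s0 : 0 < s by rewrite /s subr_gt0 ltr_pdivlMr// mul1r.
have ht m : (1 + s) ^+ (2 ^ m) <= (c * 2 ^ m).+1%:R.
  by rewrite /s addrC subrK expr_div_n ler_pdivrMr ?exprn_gt0.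
(* Bernoulli at exponent N = 2^m, then squared, gives growth at least N^2 s^2 at exponent 2N,
   against the bound 2cN + 1; dividing by N leaves a quantity that is bounded in m. *)
have hk m : (2 ^ m)%:R * s ^+ 2 <= (2 * c + 1)%:R.
  have := ht m.+1; rewrite expnSr exprM.
  have hb := bernoulli_ineq (2 ^ m) (ltW s0).
  set N := (2 ^ m)%N in hb *.
  have N1 : 1 <= N%:R :> R by rewrite ler1n expn_gt0.
  have N0 : 0 < N%:R :> R by lra.
  have hb2 : (N%:R * s) ^+ 2 <= ((1 + s) ^+ N) ^+ 2.
    rewrite ler_pXn2r ?nnegrE ?exprn_ge0//; try lra.
    by rewrite mulr_ge0 // ltW.
  move=> h1; have h2 := le_trans hb2 h1.
  rewrite -(ler_pM2l N0) mulrA -expr2 -exprMn; apply: le_trans h2 _.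
  rewrite -natrM ler_nat mulnDr muln1 -addn1 mulnCA [(c * 2)%N]mulnC leq_add2l.
  by rewrite expn_gt0.
have [m hm] : exists m : nat, (2 * c + 1)%:R / s ^+ 2 < m%:R.
  by exists (Num.truncn ((2 * c + 1)%:R / s ^+ 2)).+1; apply: truncnS_gt.
have := hk m; rewrite -ler_pdivlMr ?exprn_gt0// => hk'.
have m2 : (m <= 2 ^ m)%N := ltnW (ltn_expl m (isT : (1 < 2)%N)).
have hm2 : m%:R <= (2 ^ m)%:R :> R by rewrite ler_nat.
by have := lt_le_trans (lt_le_trans hm hm2) hk'; rewrite ltxx.
Qed.

Section Laurent.
Variables (R : realType) (A : cstarAlgType R) (U : A).
Hypotheses (UU : star U * U = 1) (UV : U * star U = 1).
Local Notation C := R[i].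
Local Notation ev := (horner_alg U).

Lemma star_unitary_comm : GRing.comm (star U) U.
Proof. by rewrite /GRing.comm UU UV. Qed.

Lemma comm_horner_alg (x : A) (p : {poly C}) : GRing.comm x U ->
  GRing.comm x (ev p).
Proof.
move=> xU; elim/poly_ind: p => [|p c IH]; first by rewrite rmorph0; apply: commr0.
rewrite rmorphD rmorphM /= horner_algX horner_algC.
apply: commrD; first exact: commrM.
by rewrite /GRing.comm -scalerAr -scalerAl mulr1 mul1r.
Qed.

(** A relation between the function z^-d p(z) and the element obtained at [U]. Neither [d] nor [p]
    is determined by [F]; that [F] nevertheless determines [a] comes out of the norm bound. *)
Definition laurent (F : circle R -> C) (a : A) : Prop :=
  exists (d : nat) (p : {poly C}),
    (forall z, F z = p.[circle_val z] / circle_val z ^+ d) /\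
    a = star U ^+ d * ev p.

Lemma laurent_cst c : laurent (fun=> c) c%:A.
Proof.
exists 0%N, c%:P; split=> [z|]; first by rewrite hornerC divr1.
by rewrite horner_algC mul1r.
Qed.

Lemma laurent0 : laurent (fun=> 0) 0.
Proof. by have := laurent_cst 0; rewrite scale0r. Qed.

Lemma laurent1 : laurent (fun=> 1) 1.
Proof. by have := laurent_cst 1; rewrite scale1r. Qed.

Lemma laurent_id : laurent (@circle_val R) U.
Proof.
exists 0%N, 'X; split=> [z|]; first by rewrite hornerX divr1.
by rewrite horner_algX mul1r.
Qed.

Lemma laurent_inv : laurent (fun z => (circle_val z)^-1) (star U).
Proof.
exists 1%N, 1; split=> [z|]; first by rewrite hornerE mul1r.
by rewrite rmorph1 mulr1.
Qed.

Lemma laurentM F G a b : laurent F a -> laurent G b ->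
  laurent (fun z => F z * G z) (a * b).
Proof.
move=> [d [p [hp ->]]] [e [q [hq ->]]]; exists (d + e)%N, (p * q); split=> [z|].
  by rewrite hp hq hornerM exprD invfM; ring.
rewrite exprD rmorphM -!mulrA; congr (_ * _); rewrite !mulrA; congr (_ * _).
apply: commrX; apply: commr_sym; apply: comm_horner_alg.
exact: star_unitary_comm.
Qed.

Lemma unitary_shift d e : star U ^+ (d + e) * U ^+ e = star U ^+ d.
Proof.
rewrite exprD -mulrA -exprMn_comm; last exact: star_unitary_comm.
by rewrite UU expr1n mulr1.
Qed.

Lemma laurentD F G a b : laurent F a -> laurent G b ->
  laurent (fun z => F z + G z) (a + b).
Proof.
move=> [d [p [hp ->]]] [e [q [hq ->]]].
exists (d + e)%N, ('X^e * p + 'X^d * q); split=> [z|].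
  rewrite hp hq hornerD !hornerM !hornerXn exprD.
  have z0 := circle_val_neq0 z.
  by field; rewrite !expf_neq0.
rewrite rmorphD !rmorphM !rmorphXn /= !horner_algX mulrDr !mulrA unitary_shift.
by rewrite addnC unitary_shift.
Qed.

Lemma laurentZ c F a : laurent F a -> laurent (fun z => c * F z) (c *: a).
Proof.
by move=> h; rewrite -mulr_algl; apply: laurentM h; exact: laurent_cst.
Qed.

Lemma laurentB F G a b : laurent F a -> laurent G b ->
  laurent (fun z => F z - G z) (a - b).
Proof.
move=> hF hG; rewrite -scaleN1r.
under eq_fun => z do rewrite -mulN1r.
by apply: laurentD hF _; apply: laurentZ.
Qed.

Lemma laurent_sum (I : Type) (r : seq I) (F : I -> circle R -> C) (a : I -> A) :
  (forall i, laurent (F i) (a i)) ->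
  laurent (fun z => \sum_(i <- r) F i z) (\sum_(i <- r) a i).
Proof.
move=> h; elim: r => [|i r IH].
  under eq_fun do rewrite big_nil.
  by rewrite big_nil; apply: laurent0.
under eq_fun do rewrite big_cons.
by rewrite big_cons; apply: laurentD.
Qed.

Lemma laurentX F a n : laurent F a -> laurent (fun z => F z ^+ n) (a ^+ n).
Proof.
move=> h; elim: n => [|n IH].
  exact: laurent1.
under eq_fun do rewrite exprS.
by rewrite exprS; apply: laurentM.
Qed.

Lemma laurentS F a : laurent F a -> laurent (fun z => (F z)^*) (star a).
Proof.
move=> [d [p [hp ->]]]; rewrite starM starX starK.
under eq_fun => z do rewrite hp rmorphM fmorphV rmorphXn /= circle_conj -exprVn invrK.
apply: laurentM; last by apply: laurentX; apply: laurent_id.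
elim/poly_ind: p {hp} => [|p c IH].
  under eq_fun do rewrite horner0 rmorph0.
  by rewrite rmorph0 star0; apply: laurent0.
under eq_fun do rewrite hornerMXaddC rmorphD rmorphM /= circle_conj.
rewrite rmorphD rmorphM /= horner_algX horner_algC starD starZ star1 starM.
apply: laurentD; last exact: laurent_cst.
under eq_fun do rewrite mulrC.
by apply: laurentM IH; apply: laurent_inv.
Qed.

Lemma horner_alg_sum (p : {poly C}) : ev p = \sum_(i < size p) p`_i *: U ^+ i.
Proof.
rewrite -{1}[p]coefK poly_def linear_sum; apply: eq_bigr => i _.
by rewrite linearZ /= rmorphXn /= horner_algX mulr_algl.
Qed.

Lemma cnorm_laurent_coarse d (p : {poly C}) (M : R) :
  (forall z : circle R, nc p.[circle_val z] <= M) ->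
  cnorm (star U ^+ d * ev p) <= (size p)%:R * M.
Proof.
move=> hM; apply: le_trans (cnormM _ _) _.
have sU : cnorm (star U ^+ d) <= 1 by apply: cnorm_isometryX; rewrite starK.
apply: le_trans (ler_piMl (cnorm_ge0 _) sU) _.
rewrite horner_alg_sum; apply: le_trans (cnorm_sum _ _ _) _.
have -> : (size p)%:R * M = \sum_(i < size p) M by rewrite sumr_const card_ord mulr_natl.
apply: ler_sum => i _; rewrite cnormZ.
apply: le_trans (poly_coef_bound hM i).
by apply: ler_piMr (nc_ge0 _) (cnorm_isometryX _ UU).
Qed.

(* For the self-adjoint h = a^* a the C*-identity gives |h|^N = |h^N|, and h^N
   is a Laurent polynomial in U with O(N) terms and coefficients at most
   M^(2N). *)
Lemma cnorm_laurent F a (M : R) : laurent F a ->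
  (forall z, nc (F z) <= M) -> cnorm a <= M.
Proof.
move=> hF hM.
have M0 : 0 <= M by apply: le_trans (nc_ge0 _) (hM 1%g).
rewrite -(@ler_pXn2r _ 2)// ?nnegrE ?cnorm_ge0// -cnorm_cstar.
have [d [p [hp ep]]] := laurentM (laurentS hF) hF.
have pM (z : circle R) : nc p.[circle_val z] <= M ^+ 2.
  have z0 := expf_neq0 d (circle_val_neq0 z).
  rewrite -[p.[_]](divfK z0) -hp !ncM ncJ ncX circle_nc expr1n mulr1.
  by rewrite -expr2 ler_pXn2r ?nnegrE ?nc_ge0.
(* The size of [p ^+ N] is at most [((size p).-1 * N).+1], whence the constant. *)
apply: (@ler_of_power_growth _ _ _ (size p).-1); rewrite ?cnorm_ge0 ?sqr_ge0// => m.
rewrite -cnormX2; last by rewrite starM starK.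
set N := (2 ^ m)%N.
rewrite ep exprMn_comm; last first.
  apply: commr_sym; apply: commrX; apply: commr_sym; apply: comm_horner_alg.
  exact: star_unitary_comm.
rewrite -exprM -rmorphXn; apply: le_trans (cnorm_laurent_coarse _ (M := (M ^+ 2) ^+ N) _) _.
  move=> z; rewrite horner_exp ncX.
  by rewrite lerXn2r ?nnegrE ?nc_ge0 ?sqr_ge0.
by apply: ler_wpM2r; rewrite ?exprn_ge0 ?sqr_ge0// ler_nat size_poly_exp_leq.
Qed.

Lemma laurent_bounded F a : laurent F a -> exists M : R, forall z, nc (F z) <= M.
Proof.
move=> [d [p [hp _]]]; exists (\sum_(i < size p) nc p`_i) => z.
rewrite hp ncM ncV ncX circle_nc expr1n invr1 mulr1 horner_coef.
apply: le_trans (nc_sum _ _ _) _; apply: ler_sum => i _.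
by rewrite ncM ncX circle_nc expr1n mulr1.
Qed.

End Laurent.

(** * Continuous functional calculus of a unitary *)

Lemma circle_bounded (R : realType) (f : circle R -> R[i]) : continuous f ->
  exists2 M : R, 0 < M & forall z, nc (f z) <= M.
Proof.
move=> cf.
have pipi : - pi <= pi :> R by have := pi_ge0 R; lra.
have [|c _ hc] := EVT_max (f := fun t : R => nc (f (circle_exp t))) pipi.
  apply: continuous_subspaceT => t.
  apply: (continuous_comp (f := fun t => f (circle_exp t))); last exact: continuous_nc.
  by apply: continuous_comp; [exact: continuous_circle_exp|exact: cf].
exists (nc (f (circle_exp c)) + 1); first by have := nc_ge0 (f (circle_exp c)); lra.
move=> z; have [t [ht <-]] := circle_exp_surj z.
by have := hc t ht; lra.
Qed.

Section FunctionalCalculus.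
Variables (R : realType) (A : cstarAlgType R) (U : A).
Hypotheses (UU : star U * U = 1) (UV : U * star U = 1).
Local Notation C := R[i].
Local Notation laurent := (laurent U).

(** A discrete form of Fejer's theorem: f is replaced by an average of its values at the L-th roots
    of unity. The weights are nonnegative Laurent polynomials in z, add up to 1 by [fejer_sum], and
    concentrate at the nodes near z, so no integral is involved. *)
Lemma laurent_dense (f : circle R -> C) : continuous f -> forall e : R, 0 < e ->
  exists F b, laurent F b /\ forall z, nc (f z - F z) <= e.
Proof.
move=> cf e e0.
have [M M0 hM] := circle_bounded cf.
have e20 : 0 < e / 2 by lra.
have [d d0 hd] := circle_unif_continuous cf e20.
(* Each node at distance at least d contributes at most 2M * (4 / d^2) / L^2. Over L nodes this is
   8M / (d^2 L), which the choice of [L] makes at most e/2. *)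
pose L := (Num.truncn (16 * M / (d ^+ 2 * e))).+1.
have hL : 16 * M / (d ^+ 2 * e) < L%:R by exact: truncnS_gt.
have L0 : (0 < L)%N by [].
have [w hw] := primitive_root_exists R L0.
pose K (i : 'I_L) (z : circle R) := nc (dirichlet L (circle_val (z * w ^- i)%g)) ^+ 2.
have K0 i z : 0 <= K i z by apply: sqr_ge0.
have LR : 0 < L%:R :> R by rewrite ltr0n.
have sumK z : \sum_(i < L) K i z / L%:R ^+ 2 = 1.
  by rewrite -mulr_suml fejer_sum// divff// expf_neq0// gt_eqF.
have lK i : exists b, laurent (fun z => (K i z / L%:R ^+ 2)%:C%C) b.
  have [b hb] : exists b, laurent (fun z => dirichlet L (circle_val (z * w ^- i)%g)) b.
    eexists; apply: (laurent_sum UU UV) => a; apply: (laurentX UU UV).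
    under eq_fun => z do rewrite circle_valM mulrC.
    by apply: (laurentZ UU UV); exact: laurent_id.
  eexists; under eq_fun => z do rewrite mulrC rmorphM /= nc_sqr.
  apply: (laurentZ UU UV).
  by apply: (laurentM UU UV hb); apply: (laurentS UU UV hb).
have [b hb] := choice lK.
exists (fun z => \sum_(i < L) f (w ^+ i)%g * (K i z / L%:R ^+ 2)%:C%C).
exists (\sum_(i < L) f (w ^+ i)%g *: b i); split.
  by apply: (laurent_sum UU UV) => i; apply: (laurentZ UU UV).
move=> z.
have -> : f z - \sum_(i < L) f (w ^+ i)%g * (K i z / L%:R ^+ 2)%:C%C =
    \sum_(i < L) (f z - f (w ^+ i)%g) * (K i z / L%:R ^+ 2)%:C%C.
  have s1 : \sum_(i < L) (K i z / L%:R ^+ 2)%:C%C = 1 :> C.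
    by rewrite -[LHS]rmorph_sum sumK.
  rewrite -[f z in LHS]mulr1 -s1 mulr_sumr -sumrB; apply: eq_bigr => i _.
  by rewrite mulrBl.
apply: le_trans (nc_sum _ _ _) _.
(* The first summand bounds the near nodes by uniform continuity, the second the far ones by kernel
   decay; their sum serves for both. *)
apply: (@le_trans _ _ (\sum_(i < L) (e / 2 * (K i z / L%:R ^+ 2) +
    2 * M * (4 / d ^+ 2) / L%:R ^+ 2))).
  apply: ler_sum => i _; rewrite ncM ncR.
  have KL0 : 0 <= K i z / L%:R ^+ 2 by rewrite divr_ge0 ?sqr_ge0.
  rewrite (ger0_norm KL0).
  have [zw|zw] := ltP (nc (circle_val z - circle_val (w ^+ i)%g)) d.
    have hdw := ltW (hd _ _ zw).
    apply: le_trans (ler_wpM2r KL0 hdw) _; rewrite lerDl.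
    by rewrite divr_ge0 ?sqr_ge0// mulr_ge0 ?divr_ge0 ?sqr_ge0//; lra.
  have h2M : nc (f z - f (w ^+ i)%g) <= 2 * M.
    apply: le_trans (ncD _ _) _; rewrite ncN.
    by have := hM z; have := hM (w ^+ i)%g; lra.
  have hK : K i z <= 4 / d ^+ 2.
    have := dirichlet_bound L (z * w ^- i)%g.
    have -> : nc (circle_val (z * w ^- i)%g - 1) =
        nc (circle_val z - circle_val (w ^+ i)%g).
      rewrite -[RHS]divr1 -[in RHS](circle_nc (w ^+ i)%g) -ncV -ncM.
      congr nc; rewrite circle_valM circle_valV mulrBl divff//.
      exact: circle_val_neq0.
    rewrite /K; set D := nc _; move=> hD.
    have D0 : 0 <= D by apply: nc_ge0.
    have Dd : D * d <= 2 by apply: le_trans hD; apply: ler_wpM2l.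
    rewrite ler_pdivlMr ?exprn_gt0// -exprMn.
    have -> : 4 = 2 ^+ 2 :> R by ring.
    by rewrite ler_pXn2r ?nnegrE// mulr_ge0// ltW.
  apply: (@le_trans _ _ (2 * M * (K i z / L%:R ^+ 2))); first exact: ler_wpM2r.
  apply: (@le_trans _ _ (2 * M * (4 / d ^+ 2 / L%:R ^+ 2))); last first.
    by rewrite mulrA lerDr mulr_ge0// ltW.
  apply: ler_wpM2l; first by lra.
  by apply: ler_wpM2r => //; rewrite invr_ge0 sqr_ge0.
rewrite big_split /= -mulr_sumr sumK mulr1 sumr_const card_ord -[_ *+ L]mulr_natl.
have -> : L%:R * (2 * M * (4 / d ^+ 2) / L%:R ^+ 2) = 8 * M / d ^+ 2 / L%:R.
  by field; rewrite !gt_eqF.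
have : 8 * M / d ^+ 2 / L%:R <= e / 2.
  rewrite ler_pdivrMr//.
  have := ltW hL; rewrite invfM mulrA ler_pdivrMr//.
  have -> : 16 * M / d ^+ 2 = 2 * (8 * M / d ^+ 2) by ring.
  by set q := 8 * M / d ^+ 2; nra.
by lra.
Qed.

Lemma laurent_continuous F a : laurent F a -> continuous F.
Proof.
move=> [d [p [hp _]]].
have -> : F = fun z => p.[circle_val z] * ((circle_val z)^* ) ^+ d.
  by apply/funext => z; rewrite hp circle_conj exprVn.
apply: ccontM; last by apply/ccontX/ccontJ; exact: circle_val_continuous.
elim/poly_ind: p {hp} => [|p x IH].
  by under eq_fun do rewrite horner0; exact: cst_continuous.
under eq_fun do rewrite hornerMXaddC.
exact: (ccontD (ccontM IH (@circle_val_continuous R)) (@cst_continuous _ _ x)).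
Qed.

(** The closure of [laurent] for simultaneous uniform and norm approximation, i.e. the graph of the
    calculus. The supremum runs over the whole circle rather than the spectrum of [U], so that
    rotations act on the functions. *)
Definition cfc (f : circle R -> C) (a : A) : Prop := forall e : R, 0 < e ->
  exists F b, [/\ laurent F b, forall z, nc (f z - F z) <= e & cnorm (a - b) <= e].

Lemma cfc_laurent F a : laurent F a -> cfc F a.
Proof.
move=> h e e0; exists F, a; split=> // [z|]; first by rewrite subrr nc0 ltW.
by rewrite subrr cnorm0 ltW.
Qed.

Lemma cfc_bound f a (M : R) : cfc f a -> (forall z, nc (f z) <= M) ->
  cnorm a <= M.
Proof.
move=> h hM; apply/ler_addgt0Pr => e e0.
have e20 : 0 < e / 2 by lra.
have [F [b [hF hf hab]]] := h _ e20.
have hb : cnorm b <= M + e / 2.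
  apply: (cnorm_laurent UU UV hF) => z.
  have -> : F z = f z - (f z - F z) by ring.
  by apply: le_trans (ncD _ _) _; rewrite ncN; apply: lerD.
rewrite -[a](subrK b); apply: le_trans (cnormD _ _) _.
by lra.
Qed.

Lemma cfcD f g a b : cfc f a -> cfc g b -> cfc (fun z => f z + g z) (a + b).
Proof.
move=> hf hg e e0; have e20 : 0 < e / 2 by lra.
have [F [a' [hF hf' ha]]] := hf _ e20.
have [G [b' [hG hg' hb]]] := hg _ e20.
exists (fun z => F z + G z), (a' + b'); split; first exact: (laurentD UU UV).
  move=> z; rewrite opprD addrACA; apply: le_trans (ncD _ _) _.
  by have := hf' z; have := hg' z; lra.
by rewrite opprD addrACA; apply: le_trans (cnormD _ _) _; lra.
Qed.

Lemma cfc_bounded f a : cfc f a -> exists2 M : R, 0 < M & forall z, nc (f z) <= M.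
Proof.
move=> /(_ 1 ltr01) [F [b [hF hf _]]].
have [M hM] := laurent_bounded hF.
have M0 : 0 <= M by apply: le_trans (nc_ge0 _) (hM 1%g).
exists (M + 1) => [|z]; first lra.
rewrite -[f z](subrK (F z)); apply: le_trans (ncD _ _) _.
by have := hM z; have := hf z; lra.
Qed.

Lemma cfcM f g a b : cfc f a -> cfc g b -> cfc (fun z => f z * g z) (a * b).
Proof.
move=> hf hg e e0.
have [M M0 hM] := cfc_bounded hf; have [N N0 hN] := cfc_bounded hg.
(* With [e1 <= 1] the approximants of the second factor stay below N + 1, and the product error is
   then at most e1 (M + N + 1). *)
pose e1 := Num.min 1 (e / (M + N + 1)).
have MN : 0 < M + N + 1 by lra.
have e10 : 0 < e1 by rewrite lt_min ltr01 divr_gt0.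
have e11 : e1 <= 1 by rewrite ge_min lexx.
have e1e : e1 * (M + N + 1) <= e by rewrite -ler_pdivlMr// ge_min lexx orbT.
have [F [a' [hF hf' ha]]] := hf _ e10.
have [G [b' [hG hg' hb]]] := hg _ e10.
have hb' : cnorm b' <= N + 1.
  apply: (cnorm_laurent UU UV hG) => z.
  have -> : G z = g z - (g z - G z) by ring.
  by apply: le_trans (ncD _ _) _; rewrite ncN; apply: lerD => //; apply: le_trans e11.
have ha' : cnorm a <= M by apply: cfc_bound hM.
exists (fun z => F z * G z), (a' * b'); split; first exact: (laurentM UU UV).
  move=> z.
  have -> : f z * g z - F z * G z = f z * (g z - G z) + (f z - F z) * G z by ring.
  have hG' : nc (G z) <= N + 1.
    have -> : G z = g z - (g z - G z) by ring.
    by apply: le_trans (ncD _ _) _; rewrite ncN; apply: lerD => //; apply: le_trans e11.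
  apply: le_trans (ncD _ _) _; rewrite !ncM.
  have h1 := ler_pM (nc_ge0 _) (nc_ge0 _) (hM z) (hg' z).
  have h2 := ler_pM (nc_ge0 _) (nc_ge0 _) (hf' z) hG'.
  by lra.
have -> : a * b - a' * b' = a * (b - b') + (a - a') * b'.
  by rewrite mulrBr mulrBl addrA subrK.
apply: le_trans (cnormD _ _) _.
have h1 := ler_pM (cnorm_ge0 _) (cnorm_ge0 _) ha' hb.
have h2 := ler_pM (cnorm_ge0 _) (cnorm_ge0 _) ha hb'.
have := cnormM a (b - b'); have := cnormM (a - a') b'.
by lra.
Qed.

Lemma cfc_cst c : cfc (fun=> c) c%:A.
Proof. by apply: cfc_laurent; exact: laurent_cst. Qed.

Lemma cfc1 : cfc (fun=> 1) 1.
Proof. by apply: cfc_laurent; exact: laurent1. Qed.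

Lemma cfcZ c f a : cfc f a -> cfc (fun z => c * f z) (c *: a).
Proof. by move=> h; rewrite -mulr_algl; apply: cfcM h; exact: cfc_cst. Qed.

Lemma cfcB f g a b : cfc f a -> cfc g b -> cfc (fun z => f z - g z) (a - b).
Proof.
move=> hf hg; rewrite -scaleN1r.
under eq_fun => z do rewrite -mulN1r.
by apply: cfcD hf _; apply: cfcZ.
Qed.

Lemma cfcS f a : cfc f a -> cfc (fun z => (f z)^*) (star a).
Proof.
move=> hf e e0; have [F [b [hF h1 h2]]] := hf _ e0.
exists (fun z => (F z)^*), (star b); split; first exact: (laurentS UU UV).
  by move=> z; rewrite -rmorphB ncJ.
by rewrite -starB cnorm_star.
Qed.

Lemma cfc_uniq f a b : cfc f a -> cfc f b -> a = b.
Proof.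
move=> ha hb; apply/eqP; rewrite -subr_eq0; apply/eqP/cnorm0_eq0.
apply/eqP; rewrite eq_le cnorm_ge0 andbT.
apply: (cfc_bound (cfcB ha hb)) => z.
by rewrite subrr nc0.
Qed.

(** By [cnorm_laurent], uniformly convergent Laurent approximants yield a Cauchy sequence in [A],
    and [A] is complete. *)
Lemma cfc_exists f : continuous f -> exists a, cfc f a.
Proof.
move=> cf.
have ex (m : nat) : exists Fb : (circle R -> C) * A,
    laurent Fb.1 Fb.2 /\ forall z, nc (f z - Fb.1 z) <= m.+1%:R^-1.
  have m0 : 0 < m.+1%:R^-1 :> R by rewrite invr_gt0.
  by have [F [b [h1 h2]]] := laurent_dense cf m0; exists (F, b).
have [Fb hFb] := choice ex.
have dist m n : cnorm ((Fb m).2 - (Fb n).2) <= m.+1%:R^-1 + n.+1%:R^-1.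
  have [hm hm'] := hFb m; have [hn hn'] := hFb n.
  apply: (cnorm_laurent UU UV (laurentB UU UV hm hn)) => z.
  have -> : (Fb m).1 z - (Fb n).1 z = (f z - (Fb n).1 z) - (f z - (Fb m).1 z) by ring.
  by apply: le_trans (ncD _ _) _; rewrite ncN addrC lerD.
have small (e : R) : 0 < e -> exists N : nat, forall n, (N <= n)%N -> n.+1%:R^-1 < e.
  move=> e0; exists (Num.truncn e^-1) => n hn.
  rewrite -[e]invrK ltf_pV2 ?posrE ?invr_gt0//.
  by apply: lt_le_trans (truncnS_gt _) _; rewrite ler_nat.
have [|l hl] := @cstar_cauchy_cvg _ _ (fun n => (Fb n).2).
  move=> e e0; have e20 : 0 < e / 2 by lra.
  have [N hN] := small _ e20; exists N => m n hm hn.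
  by apply: le_lt_trans (dist m n) _; rewrite [ltRHS]splitr ltrD ?hN.
exists l => e e0.
have [N1 h1] := small e e0; have [N2 h2] := hl e e0.
pose n := maxn N1 N2.
have [hn hn'] := hFb n.
exists (Fb n).1, (Fb n).2; split=> // [z|].
  by apply: le_trans (hn' z) _; apply/ltW/h1; rewrite leq_maxl.
by rewrite cnormB; apply/ltW/h2; rewrite leq_maxr.
Qed.

(* A *-homomorphism is contractive on the range of the calculus because a real
   r with |r| <= 1 is the real part of the unitary r + i sqrt(1 - r^2). *)
Lemma star_hom_cfc_bound (alpha : A -> A) f a (M : R) :
  star_hom alpha -> alpha 1 = 1 -> continuous f -> cfc f a ->
  (forall z, nc (f z) <= M) -> 0 < M -> cnorm (alpha a) <= M.
Proof.
move=> [aD aZ aM aS] a1 cf hf hM M0.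
(* For this choice of real function, the element [star a * a], divided by M^2, becomes the mean of a
   unitary [x] and its adjoint, and [alpha] sends [x] to an element of norm 1. *)
pose r z := nc (f z) ^+ 2 / M ^+ 2.
have M20 : 0 < M ^+ 2 by rewrite exprn_gt0.
have r0 z : 0 <= r z by rewrite divr_ge0 ?sqr_ge0.
have r1 z : r z <= 1.
  by rewrite ler_pdivrMr// mul1r ler_pXn2r ?nnegrE ?nc_ge0 ?(ltW M0).
have cr : continuous r.
  have cn := rcont_nc cf.
  exact: (rcontM (rcontM cn cn) (@cst_continuous _ _ (M ^- 2))).
pose u z : C := (r z)%:C%C + 'i%C * (Num.sqrt (1 - r z * r z))%:C%C.
have cu : continuous u.
  apply: (ccontD (ccontR cr)); apply: ccontZ; apply: ccontR; apply: rcont_sqrt.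
  by apply: rcontB; [exact: cst_continuous|exact: rcontM].
have ujE z : (u z)^* = (r z)%:C%C - 'i%C * (Num.sqrt (1 - r z * r z))%:C%C.
  have cR (x : R) : (x%:C%C : C)^* = x%:C%C by rewrite conj_Creal// complex_real.
  rewrite /u; move: (r z) (Num.sqrt _) => x y.
  by rewrite rmorphD rmorphM /= !cR complexiE conjCi mulNr.
have uu z : (u z)^* * u z = 1.
  rewrite ujE /u; set x : C := _%:C%C; set y : C := _%:C%C.
  have -> : (x - 'i%C * y) * (x + 'i%C * y) = x ^+ 2 - 'i%C ^+ 2 * y ^+ 2 by ring.
  rewrite sqr_i mulN1r opprK -!rmorphXn -rmorphD sqr_sqrtr ?rmorph1//=.
    by rewrite addrC subrK.
  by rewrite subr_ge0; apply: mulr_ile1.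
have ru z : (r z)%:C%C = 2^-1 * (u z + (u z)^*).
  by rewrite ujE /u; field.
have [x hx] := cfc_exists cu.
have xx : star x * x = 1.
  apply: (cfc_uniq (cfcM (cfcS hx) hx)).
  by under eq_fun do rewrite uu; exact: cfc1.
have hr : cfc (fun z => (r z)%:C%C) (2^-1 *: (x + star x)).
  under eq_fun do rewrite ru.
  exact: (cfcZ _ (cfcD hx (cfcS hx))).
have hr' : cfc (fun z => (r z)%:C%C) ((M ^- 2)%:C%C *: (star a * a)).
  have -> : (fun z => (r z)%:C%C) = fun z => (M ^- 2)%:C%C * ((f z)^* * f z).
    by apply/funext => z; rewrite [_^* * _]mulrC -nc_sqr -rmorphM mulrC.
  exact: (cfcZ _ (cfcM (cfcS hf) hf)).
have ax : cnorm (alpha x) = 1.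
  by apply: cnorm_isometry; rewrite -aS -aM xx.
have := congr1 alpha (cfc_uniq hr' hr); rewrite !aZ aM !aS aD aS => /(congr1 cnorm).
rewrite !cnormZ cnorm_cstar ncR ncV => h.
have h2 : nc (2 : C) = 2 by exact: nc_nat.
have h1 : `|M ^- 2| * cnorm (alpha a) ^+ 2 <= 1.
  rewrite h h2.
  by have := cnormD (alpha x) (star (alpha x)); rewrite cnorm_star ax; lra.
rewrite ger0_norm ?invr_ge0 ?sqr_ge0// mulrC ler_pdivrMr// mul1r in h1.
by rewrite ler_pXn2r ?nnegrE ?cnorm_ge0 ?(ltW M0)// in h1.
Qed.

Lemma laurent_star_hom (alpha : A -> A) (c : circle R) F a :
  star_hom alpha -> alpha 1 = 1 -> alpha U = circle_val c *: U ->
  laurent F a -> laurent (fun z => F (z * c)%g) (alpha a).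
Proof.
move=> [aD aZ aM aS] a1 aU [d [p [hp ->]]].
rewrite aM.
under eq_fun => z do rewrite hp circle_valM mulrC.
apply: (laurentM UU UV).
  elim: d {hp} => [|d IH].
    by rewrite expr0 a1; under eq_fun do rewrite invr1; exact: laurent1.
  rewrite exprS aM; under eq_fun do rewrite exprS invfM.
  apply: (laurentM UU UV) IH; rewrite aS aU starZ circle_conj.
  under eq_fun do rewrite invfM mulrC.
  by apply: (laurentZ UU UV); exact: laurent_inv.
elim/poly_ind: p {hp} => [|p x IH].
  under eq_fun do rewrite horner0.
  by rewrite rmorph0 -(scale0r (1 : A)) aZ scale0r; exact: laurent0.
under eq_fun do rewrite hornerMXaddC.
rewrite rmorphD rmorphM /= horner_algX horner_algC aD aM aZ a1 aU.
apply: (laurentD UU UV); last exact: laurent_cst.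
apply: (laurentM UU UV IH); under eq_fun do rewrite mulrC.
by apply: (laurentZ UU UV); exact: laurent_id.
Qed.

(** On Laurent polynomials this is the computation from [alpha U]; contractivity of [alpha] on the
    range of the calculus carries it to uniform limits. *)
Lemma cfc_star_hom (alpha : A -> A) (c : circle R) f a :
  star_hom alpha -> alpha 1 = 1 -> alpha U = circle_val c *: U ->
  continuous f -> cfc f a -> cfc (fun z => f (z * c)%g) (alpha a).
Proof.
move=> ha a1 aU cf hf e e0.
have [F [b [hF h1]]] := laurent_dense cf e0.
exists (fun z => F (z * c)%g), (alpha b); split.
- exact: laurent_star_hom.
- by move=> z; exact: h1.
- have aB : alpha a - alpha b = alpha (a - b).
    by rewrite -[- b]scaleN1r (star_homD ha) (star_homZ ha) scaleN1r.
  rewrite aB; apply: (star_hom_cfc_bound ha a1 _ (cfcB hf (cfc_laurent hF)) h1 e0).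
  exact: (ccontB cf (laurent_continuous hF)).
Qed.

End FunctionalCalculus.

(** * Enumeration of the k-th roots of unity *)

Section RootGroup.
Variables (R : realType) (k : nat).
Hypothesis k0 : (0 < k)%N.
Local Notation G := (roots_of_unity R k).
Implicit Types g h : G.

Definition root_c g : R[i] := circle_val (root_val g).

Lemma root_cX g : root_c g ^+ k = 1.
Proof. by rewrite /root_c -circle_valX Defs.rootP. Qed.

Lemma root_cM g h : root_c (g * h)%g = root_c g * root_c h.
Proof. by []. Qed.

Lemma root_cV g : root_c (g^-1)%g = (root_c g)^-1.
Proof. by []. Qed.

Lemma root_c_inj : injective root_c.
Proof. by move=> g h /circle_val_inj /root_val_inj. Qed.

Lemma root_c_neq0 g : root_c g != 0.
Proof. exact: circle_val_neq0. Qed.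

Lemma root_cJ g : (root_c g)^* = (root_c g)^-1.
Proof. exact: circle_conj. Qed.

Lemma roots_enum_exists : exists s : seq G,
  [/\ uniq s, forall g, g \in s & size s = k].
Proof.
have [z hz] := primitive_root_exists R k0.
have zk i : ((z ^+ i) ^+ k = 1)%g.
  apply: circle_val_inj; rewrite !circle_valX -exprM mulnC exprM.
  by rewrite (prim_expr_order hz) expr1n.
pose w i : G := mk_root (zk i).
have wE i : root_c (w i) = circle_val z ^+ i by rewrite /root_c /= -circle_valX.
exists [seq w i | i <- iota 0 k]; split; last by rewrite size_map size_iota.
  rewrite map_inj_in_uniq ?iota_uniq// => i j; rewrite !mem_iota !add0n /= => ik jk.
  move=> /(congr1 root_c); rewrite !wE => /eqP.
  by rewrite (eq_prim_root_expr hz) !modn_small// => /eqP.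
move=> g; have [i hi] := prim_rootP hz (root_cX g).
apply/mapP; exists (i : nat); first by rewrite mem_iota add0n /=.
by apply: root_c_inj; rewrite wE.
Qed.

(** A duplicate-free list of the whole group, over which all later sums and products run; [G] itself
    is only a subtype of the circle. *)
Definition unity_roots : seq G := sval (cid roots_enum_exists).

Lemma unity_roots_uniq : uniq unity_roots.
Proof. by rewrite /unity_roots; case: cid => s []. Qed.

Lemma unity_roots_mem g : g \in unity_roots.
Proof. by rewrite /unity_roots; case: cid => s []. Qed.

Lemma unity_roots_size : size unity_roots = k.
Proof. by rewrite /unity_roots; case: cid => s []. Qed.

Lemma perm_roots_mul h : perm_eq [seq (g * h)%g | g <- unity_roots] unity_roots.
Proof.
apply: uniq_perm; rewrite ?unity_roots_uniq//.
  by rewrite map_inj_uniq ?unity_roots_uniq// => a b; apply: mulIg.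
move=> g; rewrite unity_roots_mem; apply/mapP.
exists (g * h^-1)%g; first exact: unity_roots_mem.
by rewrite mulgVK.
Qed.

Lemma roots_mul_big (T : Type) (idx : T) (op : Monoid.com_law idx) (P : pred G)
    (F : G -> T) h :
  \big[op/idx]_(g <- unity_roots | P g) F g =
  \big[op/idx]_(g <- unity_roots | P (g * h)%g) F (g * h)%g.
Proof.
by rewrite -(perm_big _ (perm_roots_mul h)) big_map.
Qed.

(** Translating by a primitive root w multiplies the sum by w^m, which differs from 1 when 0 < m <
    k. *)
Lemma sum_root_c_pow m : (m < k)%N ->
  \sum_(g <- unity_roots) root_c g ^+ m = if m == 0%N then k%:R else 0.
Proof.
case: eqP => [-> _|/eqP m0 mk].
  under eq_bigr do rewrite expr0.
  by rewrite big_const_seq count_predT unity_roots_size iter_addr_0.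
have [z hz] := primitive_root_exists R k0.
have zk : (z ^+ k = 1)%g by apply: circle_val_inj; rewrite circle_valX (prim_expr_order hz).
pose w : G := mk_root zk.
set S := \sum_(g <- _) _.
have h : S = S * root_c w ^+ m.
  rewrite /S {1}(roots_mul_big _ _ _ w) mulr_suml; apply: eq_bigr => g _.
  by rewrite root_cM exprMn.
apply/eqP; have : S * (root_c w ^+ m - 1) = 0 by rewrite mulrBr mulr1 -h subrr.
move/eqP; rewrite mulf_eq0 subr_eq0 => /orP[//|].
by rewrite -(expr0 (root_c w)) (eq_prim_root_expr hz) mod0n modn_small// (negPf m0).
Qed.

End RootGroup.

(** * Two charts trivialising the rotation action on the circle *)

Section LocalSections.
Variables (R : realType) (k : nat).
Hypothesis k0 : (0 < k)%N.
Local Notation G := (roots_of_unity R k).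
Local Notation rts := (unity_roots R k0).
Implicit Types (z w : circle R) (g h : G).

(* A chart trivialising the translation action of the k-th roots of unity on
   the circle over the open set where t > 0. *)
Record local_section (t : circle R -> R) (s : circle R -> G) : Prop := LocalSection {
  lsec_cont : continuous t;
  lsec_ge0 : forall z, 0 <= t z;
  lsec_inv : forall z h, t (z * root_val h)%g = t z;
  lsec_const : forall z, 0 < t z -> exists2 r : R, 0 < r &
    forall w, nc (circle_val z - circle_val w) < r -> s w = s z;
  lsec_equiv : forall z h, 0 < t z -> s (z * root_val h)%g = (s z * h)%g
}.

(** The cosine of the angle between z and g, hence largest at the roots nearest to z. *)
Definition height z g : R := Re (circle_val z / root_c g).

Lemma height_mul z g h : height (z * root_val h)%g g = height z (g * h^-1)%g.
Proof.
rewrite /height circle_valM root_cM root_cV invfM invrK /root_c.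
by congr Re; ring.
Qed.

(** Two points of the circle with equal real parts are equal or conjugate. Equality would give g =
    h; conjugacy gives z^2 = g h, a k-th root of unity. *)
Lemma height_tie z g h : g != h -> height z g = height z h ->
  circle_val z ^+ (2 * k) = 1.
Proof.
move=> gh e.
have z0 := circle_val_neq0 z.
have nE (x : G) : nc (circle_val z / root_c x) = 1 by rewrite ncM ncV !circle_nc invr1 mulr1.
have [E|E] : circle_val z / root_c g = circle_val z / root_c h \/
    circle_val z / root_c g = (circle_val z / root_c h)^*.
  move: e (nE g) (nE h); rewrite /height.
  case: (_ / _) => a b; case: (_ / _) => c d /= ->.
  move=> h1 h2; have h3 : b ^+ 2 = d ^+ 2.
    have e1 : Num.sqrt (c ^+ 2 + b ^+ 2) ^+ 2 = 1 by rewrite h1 expr1n.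
    have e2 : Num.sqrt (c ^+ 2 + d ^+ 2) ^+ 2 = 1 by rewrite h2 expr1n.
    by rewrite !sqr_sqrtr ?addr_ge0 ?sqr_ge0// in e1 e2; lra.
  by move/eqP: h3; rewrite eqf_sqr => /orP[] /eqP ->; [left|right].
- move: E => /(mulfI z0) /invr_inj /root_c_inj E.
  by rewrite E eqxx in gh.
- have h2 : circle_val z ^+ 2 = root_c g * root_c h.
    rewrite rmorphM fmorphV /= circle_conj root_cJ invrK in E.
    have g0 := root_c_neq0 g.
    have -> : circle_val z ^+ 2 = circle_val z / root_c g * (root_c g * circle_val z).
      by field.
    by rewrite E; field.
  by rewrite exprM h2 exprMn !root_cX mulr1.
Qed.

(** Positive exactly on the open sector of points strictly nearer to g than to every other root. The
    sectors of different roots are disjoint, so a positive bump identifies its root. *)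
Definition sector_bump g z : R :=
  \prod_(h <- rts | h != g) Num.max 0 (height z g - height z h).

Lemma sector_bump_ge0 g z : 0 <= sector_bump g z.
Proof. by apply: prodr_ge0 => h _; rewrite le_max lexx. Qed.

Lemma sector_bump_cont g : continuous (sector_bump g).
Proof.
have ch h : continuous (fun z => height z h).
  apply: rcont_Re; apply: (ccontM (@circle_val_continuous R)).
  exact: cst_continuous.
apply: rcont_prod => h; apply: rcont_max; first exact: cst_continuous.
exact: rcontB.
Qed.

Lemma sector_bump_gt0 g z : 0 < sector_bump g z -> forall h, h != g -> height z h < height z g.
Proof.
move=> b0 h hg; rewrite ltNge; apply/negP => le.
move: b0; rewrite lt_def => /andP[/eqP b0 _]; apply/b0/eqP.
rewrite prodf_seq_eq0; apply/hasP; exists h; first exact: unity_roots_mem.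
by rewrite hg; apply/eqP/max_idPl; rewrite subr_le0.
Qed.

Lemma sector_bump_disjoint g h z : 0 < sector_bump g z -> 0 < sector_bump h z -> g = h.
Proof.
move=> bg bh; apply/eqP/negPn/negP => gh.
have h1 := sector_bump_gt0 bh gh; rewrite eq_sym in gh.
by have := lt_trans h1 (sector_bump_gt0 bg gh); rewrite ltxx.
Qed.

Lemma sector_bump_mul g h z : sector_bump g (z * root_val h)%g = sector_bump (g * h^-1)%g z.
Proof.
rewrite /sector_bump (roots_mul_big k0 _ _ _ h); apply: eq_big => x.
  by rewrite -{1}(mulgVK h g) (inj_eq (@mulIg _ h)).
by move=> _; rewrite !height_mul mulgK.
Qed.

(** For a root of maximal height, a vanishing factor of its bump means a second root of the same
    height, and [height_tie] applies. *)
Lemma sector_bump_all0 z : (forall g, sector_bump g z = 0) -> circle_val z ^+ (2 * k) = 1.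
Proof.
move=> b0.
have [g hg] : exists g, forall h, height z h <= height z g.
  have : exists g, forall h, h \in rts -> height z h <= height z g.
    elim: (rts) => [|x s [g hg]]; first by exists 1%g.
    have [le|le] := leP (height z x) (height z g).
      by exists g => h; rewrite inE => /predU1P[->//|/hg].
    exists x => h; rewrite inE => /predU1P[->//|/hg h1].
    exact: le_trans h1 (ltW le).
  by move=> [g hg]; exists g => h; apply: hg; exact: unity_roots_mem.
have /eqP := b0 g; rewrite prodf_seq_eq0 => /hasP [h _ /andP[hg' /eqP m0]].
apply: (height_tie hg'); apply/eqP; rewrite eq_le hg /=.
by rewrite -subr_le0 -m0 le_max lexx orbT.
Qed.

Definition sector_bump_sum z : R := \sum_(g <- rts) sector_bump g z.
(** The default [1%g] is taken only where all bumps vanish; there [local_section] asks nothing of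
    the root. *)
Definition sector_bump_root z : G := xget 1%g [set g | 0 < sector_bump g z].

Lemma sector_bump_rootP g z : 0 < sector_bump g z -> sector_bump_root z = g.
Proof.
move=> hg; rewrite /sector_bump_root; case: xgetP => [x _ hx|/(_ g) //].
exact: sector_bump_disjoint hx hg.
Qed.

Lemma sector_bump_sum_gt0 z : 0 < sector_bump_sum z -> exists g, 0 < sector_bump g z.
Proof.
move=> s0; apply: contrapT => h.
have : sector_bump_sum z = 0.
  rewrite /sector_bump_sum big1// => g _; apply/eqP; rewrite eq_le sector_bump_ge0 andbT leNgt.
  by apply/negP => ?; apply: h; exists g.
by move=> e; rewrite e ltxx in s0.
Qed.

Lemma sector_bump_sum_eq0 z : sector_bump_sum z = 0 -> forall g, sector_bump g z = 0.
Proof.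
move=> /eqP; rewrite /sector_bump_sum psumr_eq0; last by move=> g _; exact: sector_bump_ge0.
by move=> /allP h g; apply/eqP; exact: (h g (unity_roots_mem k0 g)).
Qed.

Lemma sector_bump_section : local_section sector_bump_sum sector_bump_root.
Proof.
split.
- by apply: rcont_sum => g; exact: sector_bump_cont.
- by move=> z; apply: sumr_ge0 => g _; exact: sector_bump_ge0.
- move=> z h; rewrite /sector_bump_sum [LHS](roots_mul_big k0 _ _ _ h).
  by apply: eq_bigr => g _; rewrite sector_bump_mul mulgK.
- move=> z /sector_bump_sum_gt0 [g hg].
  have /nbhs_circleP [r r0 hr] : \forall w \near z,
      `|sector_bump g z - sector_bump g w| < sector_bump g z.
    by move/continuous_absP: (@sector_bump_cont g z); apply.
  exists r => // w /hr h; rewrite (sector_bump_rootP hg); apply: sector_bump_rootP.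
  by move: h; rewrite ltr_norml => /andP[_]; lra.
- move=> z h /sector_bump_sum_gt0 [g hg]; rewrite (sector_bump_rootP hg).
  apply: sector_bump_rootP; rewrite sector_bump_mul mulgK //.
Qed.

Lemma local_section_rotate (e : circle R) t s : local_section t s ->
  local_section (fun z => t (z * e)%g) (fun z => s (z * e)%g).
Proof.
have mE z h : (z * root_val h * e = z * e * root_val h)%g.
  by rewrite -!mulgA (circle_mulC _ e).
move=> [ct t0 ti sc se]; split=> //.
- move=> z; apply/continuous_absP => d d0.
  have /nbhs_circleP [r r0 hr] : \forall w \near (z * e)%g, `|t (z * e)%g - t w| < d.
    by move/continuous_absP: (ct (z * e)%g); apply.
  apply/nbhs_circleP; exists r => // w hw; apply: hr.
  by rewrite !circle_valM -mulrBl ncM circle_nc mulr1.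
- by move=> z h; rewrite mE ti.
- move=> z /sc [r r0 hr]; exists r => // w hw; apply: hr.
  by rewrite !circle_valM -mulrBl ncM circle_nc mulr1.
- by move=> z h hz; rewrite mE se.
Qed.

Lemma local_section_scale (c : circle R -> R) t s : continuous c ->
  (forall z, 0 < c z) -> (forall z h, c (z * root_val h)%g = c z) ->
  local_section t s -> local_section (fun z => c z * t z) s.
Proof.
move=> cc c0 ci [ct t0 ti sc se]; split.
- exact: rcontM.
- by move=> z; rewrite mulr_ge0// ltW.
- by move=> z h; rewrite ci ti.
- by move=> z; rewrite pmulr_rgt0// => /sc.
- by move=> z h; rewrite pmulr_rgt0//; exact: se.
Qed.

(* Both charts degenerate at z only if z^(2k) = 1 and (e z)^(2k) = 1. *)
Lemma two_local_sections : exists t0 s0 t1 s1,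
  [/\ local_section t0 s0, local_section t1 s1 & forall z, t0 z + t1 z = 1].
Proof.
have k4 : (0 < 4 * k)%N by rewrite muln_gt0.
(* A primitive 4k-th root satisfies e^(2k) = -1, so rotation by [e] moves every 2k-th root of unity,
   i.e. every possible degenerate point, off the set of such points. *)
have [e he] := primitive_root_exists R k4.
have e1 : circle_val e ^+ (2 * k) != 1.
  rewrite -(expr0 (circle_val e)) (eq_prim_root_expr he) mod0n modn_small.
    by rewrite muln_eq0 /= -lt0n.
  by rewrite ltn_pmul2r.
have h0 := sector_bump_section.
have h1 := local_section_rotate e h0.
pose S z := sector_bump_sum z + sector_bump_sum (z * e)%g.
have S0 z : 0 < S z.
  rewrite lt_def addr_ge0 ?(lsec_ge0 h0)// andbT; apply/eqP => hS.
  have a0 := lsec_ge0 h0 z; have b0 := lsec_ge0 h0 (z * e)%g.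
  have /sector_bump_sum_eq0/sector_bump_all0 hz : sector_bump_sum z = 0.
    by move: hS; rewrite /S; lra.
  have /sector_bump_sum_eq0/sector_bump_all0 hze : sector_bump_sum (z * e)%g = 0.
    by move: hS; rewrite /S; lra.
  by move: hze; rewrite circle_valM exprMn hz mul1r => hze; rewrite hze eqxx in e1.
have cS : continuous (fun z => (S z)^-1).
  apply: rcontV => [z|]; first by rewrite gt_eqF.
  exact: (rcontD (lsec_cont h0) (lsec_cont h1)).
have Si z h : (S (z * root_val h)%g)^-1 = (S z)^-1.
  by rewrite /S (lsec_inv h0) (lsec_inv h1).
have SV z : 0 < (S z)^-1 by rewrite invr_gt0.
exists (fun z => (S z)^-1 * sector_bump_sum z), sector_bump_root.
exists (fun z => (S z)^-1 * sector_bump_sum (z * e)%g), (fun z => sector_bump_root (z * e)%g).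
split; [exact: local_section_scale|exact: local_section_scale|].
by move=> z; rewrite -mulrDr mulVf// gt_eqF.
Qed.

End LocalSections.

(** * Pulling functions on the cone back to the circle along a chart *)

Section Cone.
Variables (R : realType) (k : nat).
Local Notation G := (roots_of_unity R k).
Local Notation I := (set_type (@half_open_interval R)).
Local Notation coneG := (cone R G).

Lemma clamp_in (a r : R) : 0 < a <= 1 ->
  half_open_interval (Num.max a (Num.min r 1)).
Proof.
move=> /andP[a0 a1]; rewrite /half_open_interval /= in_itv /=.
by rewrite lt_max a0 /= ge_max a1 ge_min lexx orbT.
Qed.

(** The retraction of the line onto [a, 1], typed into the half-open interval; a > 0 keeps it away
    from the missing endpoint. *)
Definition clamp (a : R) (ha : 0 < a <= 1) (r : R) : I :=
  @exist R (fun x => x \in @half_open_interval R) _ (mem_set (clamp_in r ha)).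

Lemma clamp_val a (ha : 0 < a <= 1) r : a <= r <= 1 -> sval (clamp ha r) = r.
Proof.
move=> /andP[ar r1]; rewrite /= (min_idPl r1).
exact/max_idPr.
Qed.

Lemma clamp_sval a (ha : 0 < a <= 1) (x : I) : a <= sval x -> clamp ha (sval x) = x.
Proof.
move=> ax; apply: val_inj; rewrite [LHS]clamp_val//.
by case: x ax => x /= /set_mem; rewrite /half_open_interval /= in_itv /= => /andP[_ ->] ->.
Qed.

Lemma clamp_cont a (ha : 0 < a <= 1) : continuous (clamp ha).
Proof.
apply: (@continuous_comp_initial I _ R (fun x => sval x)).
apply: (@rcont_max R R (fun=> a) (fun r => Num.min r 1)); first exact: cst_continuous.
move=> r; apply: continuous_min; first exact: cvg_id.
exact: cst_continuous.
Qed.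

Lemma half_open_gt0 (x : I) : 0 < sval x.
Proof. by case: x => x /= /set_mem; rewrite /half_open_interval /= in_itv /= => /andP[]. Qed.

Lemma half_open_le1 (x : I) : sval x <= 1.
Proof. by case: x => x /= /set_mem; rewrite /half_open_interval /= in_itv /= => /andP[]. Qed.

(** The value 0 outside (0, 1] matches vanishing at infinity: a function in [C0_fun] stays
    continuous across r = 0. *)
Definition cone_ext (f : coneG -> R[i]) (r : R) (g : G) : R[i] :=
  if pselect (half_open_interval r) is left h then f (exist _ r (mem_set h), g) else 0.

Lemma cone_extE f a (ha : 0 < a <= 1) r g : a <= r <= 1 ->
  cone_ext f r g = f (clamp ha r, g).
Proof.
move=> har; rewrite /cone_ext; case: pselect => [h|[]].
  by congr (f (_, _)); apply: val_inj; rewrite [RHS]clamp_val.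
rewrite /half_open_interval /= in_itv /=; lra.
Qed.

Lemma cone_ext_le0 f r g : r <= 0 -> cone_ext f r g = 0.
Proof.
move=> r0; rewrite /cone_ext; case: pselect => // h.
have : half_open_interval r := h.
by rewrite /half_open_interval /= in_itv /= ltNge r0.
Qed.

(** The compact set where |f| >= e projects to a compact, hence closed, set of reals that misses 0,
    so a neighbourhood of 0 avoids it for all g at once. *)
Lemma cone_ext_small f : C0_fun (f : coneG -> R[i]) -> forall e : R, 0 < e ->
  exists2 d : R, 0 < d & forall r g, r < d -> nc (cone_ext f r g) < e.
Proof.
move=> [_ cf] e e0.
have e0' : 0 < e%:C%C :> R[i] by rewrite ltcR.
have cK := cf _ e0'; set K := [set x | _] in cK.
have cK' : compact ((fun x : coneG => sval x.1) @` K).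
  apply: continuous_compact cK; apply: continuous_subspaceT => x.
  apply: continuous_comp; first exact: cvg_fst.
  exact: initial_continuous.
have K'c := compact_closed (@Rhausdorff R) cK'.
have n0 : (~` ((fun x : coneG => sval x.1) @` K)) 0.
  by move=> [x _ /eqP]; rewrite gt_eqF// half_open_gt0.
have /nbhs_ballP [d /= d0 hd] : nbhs (0 : R) (~` ((fun x : coneG => sval x.1) @` K)).
  by apply: open_nbhs_nbhs; split=> //; exact: closed_openC.
exists d => // r g rd; rewrite /cone_ext; case: pselect => [h|_]; last by rewrite nc0.
rewrite ltNge; apply/negP => le.
have r0 : 0 < r by exact: half_open_gt0 (exist _ r (mem_set h)).
apply: (hd r); first by rewrite /ball /= sub0r normrN gtr0_norm.
exists (exist _ r (mem_set h), g) => //.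
by rewrite /K /= normE lecR.
Qed.

(** Where t > 0 the root s is locally constant. At a zero of t, where s may jump, [cone_ext_small]
    makes the values small whatever s is. *)
Lemma cone_pullback_continuous (t : circle R -> R) (s : circle R -> G) f :
  local_section t s -> (forall z, t z <= 1) -> C0_fun (f : coneG -> R[i]) ->
  continuous (fun z => cone_ext f (t z) (s z)).
Proof.
move=> ts t1 hf z; have ct := lsec_cont ts; apply/continuous_ncP => e e0; apply/nbhs_circleP.
have near_t d : 0 < d -> exists2 r : R, 0 < r & forall w,
    nc (circle_val z - circle_val w) < r -> `|t z - t w| < d.
  move=> d0; apply/nbhs_circleP.
  by move/continuous_absP: (ct z); apply.
have := lsec_ge0 ts z; rewrite le_eqVlt => /predU1P[tz|tz].
  have [d d0 hd] := cone_ext_small hf e0.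
  have [r r0 hr] := near_t d d0; exists r => // w /hr; rewrite -tz sub0r normrN => tw.
  rewrite cone_ext_le0// sub0r ncN; apply: hd.
  exact: le_lt_trans (ler_norm _) tw.
have ha : 0 < t z / 2 <= 1 by have := t1 z; lra.
have [r1 r10 hr1] := lsec_const ts tz.
have tz2 : 0 < t z / 2 by lra.
have [r2 r20 hr2] := near_t _ tz2.
have cf : continuous (fun w => f (clamp ha (t w), s z)).
  have c1 : continuous (fun w => clamp ha (t w)).
    by move=> w; exact: (continuous_comp (ct w) (@clamp_cont _ ha (t w))).
  have c2 : continuous (fun w => (clamp ha (t w), s z) : coneG).
    by move=> w; exact: (cvg_pair (c1 w) (@cst_continuous _ _ (s z) w)).
  by move=> w; exact: (continuous_comp (c2 w) (hf.1 _)).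
have /nbhs_circleP [r3 r30 hr3] : \forall w \near z,
    nc (f (clamp ha (t z), s z) - f (clamp ha (t w), s z)) < e.
  by move/continuous_ncP: (cf z); apply.
exists (Num.min r1 (Num.min r2 r3)); first by rewrite !lt_min r10 r20 r30.
move=> w; rewrite !lt_min => /and3P[h1 h2 h3].
rewrite (hr1 _ h1) !(cone_extE _ ha); first exact: hr3.
  have := hr2 _ h2; rewrite ltr_norml => /andP[_ h4]; have := t1 w; lra.
by have := t1 z; lra.
Qed.

End Cone.

(** * The equivariant map from the circle to the join of two copies of the group *)

Section JoinMap.
Variables (R : realType) (k : nat).
Hypothesis k0 : (0 < k)%N.
Local Notation G := (roots_of_unity R k).
Local Notation GG := (group_gspace G).
Local Notation I := (set_type (@unit_interval R)).

Lemma clamp01_in (r : R) : unit_interval (Num.max 0 (Num.min r 1)).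
Proof.
rewrite /unit_interval /= in_itv /=.
by rewrite le_max lexx /= ge_max ler01 ge_min lexx orbT.
Qed.

Definition clamp01 (r : R) : I :=
  @exist R (fun x => x \in @unit_interval R) _ (mem_set (clamp01_in r)).

Lemma clamp01_val r : 0 <= r <= 1 -> sval (clamp01 r) = r.
Proof. by move=> /andP[r0 r1]; rewrite /= (min_idPl r1); exact/max_idPr. Qed.

Lemma clamp01_cont : continuous clamp01.
Proof.
apply: (@continuous_comp_initial I _ R (fun x => sval x)).
apply: (@rcont_max R R (fun=> 0) (fun r => Num.min r 1)); first exact: cst_continuous.
move=> r; apply: continuous_min; first exact: cvg_id.
exact: cst_continuous.
Qed.

Lemma join_pi_eq (X Y : topologicalType) (p q : join_pre R X Y) :
  p.2 = q.2 -> sval p.2 = 1 \/ p.1.1 = q.1.1 -> sval p.2 = 0 \/ p.1.2 = q.1.2 ->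
  join_pi p = join_pi q.
Proof. by move=> e1 e2 e3; apply/eqmodP/asboolP. Qed.

(** The action on the join is defined through the chosen representative [repr]; as translation keeps
    related points related, any representative computes it. *)
Lemma gact_join_pi (X Y : gspace G) (p : join_pre R X Y) g :
  @gact G (join_gspace R X Y) (join_pi p) g =
  @join_pi R X Y ((gact p.1.1 g, gact p.1.2 g), p.2).
Proof.
have : join_rel (repr (join_pi p : {eq_quot (join_equiv R X Y)}%qT)) p.
  have := reprK (join_pi p : {eq_quot (join_equiv R X Y)}%qT).
  by move/eqmodP.
move=> /asboolP[e1 e2 e3]; apply: join_pi_eq => //=.
  by case: e2 => [?|->]; [left|right].
by case: e3 => [?|->]; [left|right].
Qed.

(** With [t1] as join parameter, the coordinate s1 is collapsed where t1 = 0, and s0 where t1 = 1,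
    i.e. t0 = 0: each root is forgotten exactly where its chart is void. *)
Definition join_curve (s0 s1 : circle R -> G) (t1 : circle R -> R) (z : circle R) :
    EG R G 1 :=
  @join_pi R GG GG ((s0 z, s1 z), clamp01 (t1 z)).

Variables (t0 t1 : circle R -> R) (s0 s1 : circle R -> G).
Hypotheses (ts0 : local_section t0 s0) (ts1 : local_section t1 s1).
Hypothesis t01 : forall z, t0 z + t1 z = 1.

Lemma chart_cases z : [\/ t0 z = 0 /\ t1 z = 1, t0 z = 1 /\ t1 z = 0 |
  0 < t0 z /\ 0 < t1 z].
Proof.
have h := t01 z; have := lsec_ge0 ts0 z; have := lsec_ge0 ts1 z.
rewrite !le_eqVlt => /predU1P[h1|h1] /predU1P[h0|h0].
- by exfalso; lra.
- by apply: Or32; split; lra.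
- by apply: Or31; split; lra.
- exact: Or33.
Qed.

Lemma chart1_in z : 0 <= t1 z <= 1.
Proof. by have := t01 z; have := lsec_ge0 ts0 z; have := lsec_ge0 ts1 z; lra. Qed.

Lemma join_curve_equiv z g :
  join_curve s0 s1 t1 (z * root_val g)%g =
  gact (join_curve s0 s1 t1 z) g.
Proof.
rewrite /join_curve [RHS](@gact_join_pi GG GG) (lsec_inv ts1).
have sv : sval (clamp01 (t1 z)) = t1 z by rewrite clamp01_val ?chart1_in.
apply: join_pi_eq => //.
- rewrite [sval _]sv; have [[_ h]|[h _]|[h _]] := chart_cases z; first by left.
  + by right; rewrite /= (lsec_equiv ts0)// h.
  + by right; rewrite /= (lsec_equiv ts0).
- rewrite [sval _]sv; have [[_ h]|[_ h]|[_ h]] := chart_cases z; last 2 first.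
  + by left.
  + by right; rewrite /= (lsec_equiv ts1).
  + by right; rewrite /= (lsec_equiv ts1)// h.
Qed.

(** The difficulty lies at the ends, where one root may jump. There are finitely many pairs of
    roots, so one radius controls the variation in t1 for all of them. At an end the collapsed
    coordinate of z can be replaced by that of w, after which only t1 varies. *)
Lemma join_pullback_continuous (F : EG R G 1 -> R[i]) : continuous F ->
  continuous (fun z => F (join_curve s0 s1 t1 z)).
Proof.
move=> cF z; have ct := lsec_cont ts1.
apply/continuous_ncP => e e0; apply/nbhs_circleP.
pose Fh x y (r : R) : R[i] := F (@join_pi R GG GG ((x, y), clamp01 r)).
have near_F x y : exists2 r : R, 0 < r & forall w,
    nc (circle_val z - circle_val w) < r -> nc (Fh x y (t1 z) - Fh x y (t1 w)) < e.
  apply/nbhs_circleP.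
  have c1 : continuous (fun w => clamp01 (t1 w)).
    by move=> w; exact: (continuous_comp (ct w) (@clamp01_cont (t1 w))).
  have c2 : continuous (fun w => ((x, y), clamp01 (t1 w)) : join_pre R GG GG).
    by move=> w; exact: (cvg_pair (@cst_continuous _ _ (x, y) w) (c1 w)).
  have c3 : continuous (@join_pi R GG GG) by exact: pi_continuous.
  have cf : continuous (fun w => Fh x y (t1 w)).
    by move=> w; exact: (continuous_comp (c2 w) (continuous_comp (c3 _) (cF _))).
  by move/continuous_ncP: (cf z); apply.
have unif : exists2 r : R, 0 < r & forall w,
    nc (circle_val z - circle_val w) < r ->
    forall x y, nc (Fh x y (t1 z) - Fh x y (t1 w)) < e.
  have step (l : seq (G * G)) : exists2 r : R, 0 < r & forall w,
      nc (circle_val z - circle_val w) < r ->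
      forall p, p \in l -> nc (Fh p.1 p.2 (t1 z) - Fh p.1 p.2 (t1 w)) < e.
    elim: l => [|p l [r r0 hr]]; first by exists 1.
    have [r' r'0 hr'] := near_F p.1 p.2.
    exists (Num.min r r'); first by rewrite lt_min r0 r'0.
    move=> w; rewrite lt_min => /andP[h1 h2] q; rewrite inE => /predU1P[->|].
      exact: hr'.
    exact: hr.
  have [r r0 hr] := step [seq (x, y) | x <- unity_roots R k0, y <- unity_roots R k0].
  exists r => // w hw x y; apply: (hr w hw (x, y)).
  by apply/allpairsP; exists (x, y); rewrite !unity_roots_mem.
have [r r0 hr] := unif.
have indep0 x y y' : Fh x y 0 = Fh x y' 0.
  congr F; apply: join_pi_eq => //=; first by right.
  by left; rewrite (min_idPl ler01); exact/max_idPl.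
have indep1 x x' y : Fh x y 1 = Fh x' y 1.
  congr F; apply: join_pi_eq => //=; last by right.
  by left; rewrite minxx; exact/max_idPr.
rewrite -/(Fh _ _ _).
have [[_ h1]|[h0 h1]|[h0 h1]] := chart_cases z.
- have [r' r'0 hr'] : exists2 r : R, 0 < r & forall w,
    nc (circle_val z - circle_val w) < r -> s1 w = s1 z.
    by apply: (lsec_const ts1); rewrite h1.
  exists (Num.min r r'); first by rewrite lt_min r0 r'0.
  move=> w; rewrite lt_min => /andP[/hr hw /hr' hw'].
  rewrite [X in X - _](_ : _ = Fh (s0 w) (s1 z) (t1 z)); last first.
    by rewrite /join_curve h1; apply: indep1.
  by rewrite /join_curve hw'; exact: hw.
- have [r' r'0 hr'] : exists2 r : R, 0 < r & forall w,
    nc (circle_val z - circle_val w) < r -> s0 w = s0 z.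
    by apply: (lsec_const ts0); rewrite h0.
  exists (Num.min r r'); first by rewrite lt_min r0 r'0.
  move=> w; rewrite lt_min => /andP[/hr hw /hr' hw'].
  rewrite [X in X - _](_ : _ = Fh (s0 z) (s1 w) (t1 z)); last first.
    by rewrite /join_curve h1; apply: indep0.
  by rewrite /join_curve hw'; exact: hw.
- have [r' r'0 hr'] := lsec_const ts0 h0.
  have [r2 r20 hr2] := lsec_const ts1 h1.
  exists (Num.min r (Num.min r' r2)); first by rewrite !lt_min r0 r'0 r20.
  move=> w; rewrite !lt_min => /and3P[/hr hw /hr' hw' /hr2 hw2].
  by rewrite /join_curve hw' hw2; exact: hw.
Qed.

End JoinMap.

(** * Upper bounds on the dimensions from a unitary of degree one *)

Lemma least0 (Q : nat -> Prop) : Q 0%N -> least Q = Some 0%N.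
Proof.
move=> q0; rewrite /least; case: pselect => [h|[]]; last by exists 0%N; apply/asboolP.
case: ex_minnP => m _ /(_ 0%N (asboolT q0)).
by rewrite leqn0 => /eqP ->.
Qed.

Lemma least1 (Q : nat -> Prop) : ~ Q 0%N -> Q 1%N -> least Q = Some 1%N.
Proof.
move=> q0 q1; rewrite /least; case: pselect => [h|[]]; last by exists 1%N; apply/asboolP.
case: ex_minnP => -[|m] /asboolP qm hm; first by case: q0.
by have := hm 1%N (asboolT q1); rewrite ltnS leqn0 => /eqP ->.
Qed.

Lemma tensor_clamp (R : realType) (k : nat) (a r : R) (ha : 0 < a <= 1)
    (g : roots_of_unity R k) : a <= r <= 1 ->
  tensor (@Defs.coord R) (fun=> 1) (clamp ha r, g) = r%:C%C.
Proof. by move=> h; rewrite -[in RHS](clamp_val ha h) -[RHS]mulr1. Qed.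

Section Dimensions.
Variables (R : realType) (k : nat).
Hypothesis k0 : (0 < k)%N.
Local Notation G := (roots_of_unity R k).
Variables (A : cstarAlgType R) (alpha : G -> A -> A).

Lemma has_LT_WLT m : has_LT alpha m -> has_WLT alpha m.
Proof.
move=> [rho [hrho e]]; exists rho; split=> //; rewrite e.
by exists 1; rewrite mulr1.
Qed.

(** Since E_0 G = G, restricting cone functions to the slice at 1 turns a map on C(G) into one on
    the cone, and the coordinate t has value 1 there. *)
Lemma has_SLT0_LT0 : has_SLT alpha 0 -> has_LT alpha 0.
Proof.
move=> [rho [[rD rZ rM rS] re r1]].
have h01 : 0 < (1 : R) <= 1 by rewrite ltr01 lexx.
have h111 : 1 <= (1 : R) <= 1 by rewrite lexx.
pose T (f : cone R G -> R[i]) : EG R G 0 -> R[i] := fun g => f (clamp h01 1, g).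
have cT f : C0_fun f -> C_fun (T f).
  move=> [cf _] g.
  have ci : continuous (fun g : G => g) by move=> x; exact: cvg_id.
  have c2 : continuous (fun g : G => (clamp h01 1, g) : cone R G).
    by move=> x; exact: (cvg_pair (@cst_continuous _ _ (clamp h01 1) x) (ci x)).
  exact: (continuous_comp (c2 g) (cf _)).
exists (fun _ f => rho (T f)); split=> [_|].
  split; first split.
  - by move=> f g hf hg; rewrite -rD//; exact: cT.
  - by move=> c f hf; rewrite -rZ//; exact: cT.
  - by move=> f g hf hg; rewrite -rM//; exact: cT.
  - by move=> f hf; rewrite -rS//; exact: cT.
  by move=> g f hf; rewrite -re//; exact: cT.
rewrite big_ord1 -r1; congr rho; apply/funext => g.
by rewrite /T tensor_clamp.
Qed.

Variables (U : A).
Hypotheses (UU : star U * U = 1) (UV : U * star U = 1).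
Hypotheses (alpha_hom : forall g, star_hom (alpha g))
  (alpha1 : forall g, alpha g 1 = 1)
  (alphaU : forall g, alpha g U = root_c g *: U).

(** The default [0] is never reached for a continuous function. *)
Definition calc (f : circle R -> R[i]) : A := xget 0 [set a | cfc U f a].

Lemma calcP f : continuous f -> cfc U f (calc f).
Proof.
move=> cf; rewrite /calc; case: xgetP => [a _ //|h].
by have [a ha] := cfc_exists UU UV cf; case: (h a).
Qed.

Lemma calc_eq f a : continuous f -> cfc U f a -> calc f = a.
Proof. by move=> cf; apply: (cfc_uniq UU UV); exact: calcP. Qed.

(** The mechanism shared by the cone and the join: a pullback to the circle that respects pointwise
    operations and turns translation into rotation, followed by the calculus. *)
Lemma calc_pullback (X : gspace G) (D : set (X -> R[i]))
    (T : (X -> R[i]) -> circle R -> R[i]) :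
  (forall f, D f -> continuous (T f)) ->
  (forall f g, T (fun x => f x + g x) = fun z => T f z + T g z) ->
  (forall c f, T (fun x => c * f x) = fun z => c * T f z) ->
  (forall f g, T (fun x => f x * g x) = fun z => T f z * T g z) ->
  (forall f, T (fun x => (f x)^*) = fun z => (T f z)^*) ->
  (forall f g, T (fun x => f (gact x g)) = fun z => T f (z * root_val g)%g) ->
  fun_star_hom D (fun f => calc (T f)) /\
  equivariant alpha D (fun f => calc (T f)).
Proof.
move=> cT TD TZ TM TS Te; split.
  split=> [f g hf hg|c f hf|f g hf hg|f hf].
  - rewrite TD; apply: calc_eq; first by apply: ccontD; exact: cT.
    by apply: (cfcD UU UV); apply: calcP; exact: cT.
  - rewrite TZ; apply: calc_eq; first by apply: ccontZ; exact: cT.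
    by apply: (cfcZ UU UV); apply: calcP; exact: cT.
  - rewrite TM; apply: calc_eq; first by apply: ccontM; exact: cT.
    by apply: (cfcM UU UV); apply: calcP; exact: cT.
  - rewrite TS; apply: calc_eq; first by apply: ccontJ; exact: cT.
    by apply: (cfcS UU UV); apply: calcP; exact: cT.
move=> g f hf; rewrite Te; apply: calc_eq.
  move=> z; apply/continuous_ncP => e e0; apply/nbhs_circleP.
  have /nbhs_circleP [r r0 hr] : \forall w \near (z * root_val g)%g,
      nc (T f (z * root_val g)%g - T f w) < e.
    by move/continuous_ncP: (cT f hf (z * root_val g)%g); apply.
  exists r => // w hw; apply: hr.
  by rewrite !circle_valM -mulrBl ncM circle_nc mulr1.
by apply: (cfc_star_hom UU UV) => //; [exact: cT|apply: calcP; exact: cT].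
Qed.

Lemma has_SLT1 : has_SLT alpha 1.
Proof.
have [t0 [s0 [t1 [s1 [h0 h1 h01]]]]] := two_local_sections R k0.
pose T (F : EG R G 1 -> R[i]) z := F (join_curve s0 s1 t1 z).
have [] := @calc_pullback (EG R G 1) (@C_fun R (EG R G 1)) T.
- by move=> F hF; exact: (join_pullback_continuous k0 h0 h1 h01 hF).
- by [].
- by [].
- by [].
- by [].
- by move=> F g; apply/funext => z; rewrite /T -(join_curve_equiv h0 h1 h01).
move=> hh he; exists (fun F => calc (T F)); split=> //.
by apply: calc_eq; [exact: cst_continuous|exact: cfc1].
Qed.

Lemma local_section_cone_hom t s : local_section t s -> (forall z, t z <= 1) ->
  cone_hom alpha (fun f => calc (fun z => cone_ext f (t z) (s z))).
Proof.
move=> ts t1; apply: (@calc_pullback (cone R G) (@C0_fun R (cone R G))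
  (fun f z => cone_ext f (t z) (s z))).
- by move=> f hf; exact: (cone_pullback_continuous ts t1 hf).
- by move=> f g; apply/funext => z; rewrite /cone_ext; case: pselect; rewrite ?addr0.
- by move=> c f; apply/funext => z; rewrite /cone_ext; case: pselect; rewrite ?mulr0.
- by move=> f g; apply/funext => z; rewrite /cone_ext; case: pselect; rewrite ?mulr0.
- by move=> f; apply/funext => z; rewrite /cone_ext; case: pselect; rewrite ?rmorph0.
move=> f g; apply/funext => z; rewrite (lsec_inv ts).
have := lsec_ge0 ts z; rewrite le_eqVlt => /predU1P[tz|tz].
  by rewrite !cone_ext_le0 -?tz.
by rewrite (lsec_equiv ts)// /cone_ext; case: pselect.
Qed.

(** Each chart gives one homomorphism, under which t (x) 1 goes to t_i(U); the two images add up to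
    1 because the charts form a partition of unity. *)
Lemma has_LT1 : has_LT alpha 1.
Proof.
have [t0 [s0 [t1 [s1 [h0 h1 h01]]]]] := two_local_sections R k0.
have le0 z : t0 z <= 1 by have := h01 z; have := lsec_ge0 h1 z; lra.
have le1 z : t1 z <= 1 by have := h01 z; have := lsec_ge0 h0 z; lra.
pose rho t (s : circle R -> G) f := calc (fun z => cone_ext f (t z) (s z)).
exists (fun i : 'I_2 => if i == ord0 then rho t0 s0 else rho t1 s1); split.
  by move=> i; case: ifP => _; exact: local_section_cone_hom.
rewrite big_ord_recl big_ord1 /=.
have ext t s : local_section t s -> (forall z, t z <= 1) ->
    (fun z => cone_ext (tensor (@Defs.coord R) (fun _ : G => 1)) (t z) (s z)) =
    fun z => (t z)%:C%C.
  move=> ts t1'; apply/funext => z.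
  have := lsec_ge0 ts z; rewrite le_eqVlt => /predU1P[tz|tz].
    by rewrite cone_ext_le0 -?tz.
  have ha : 0 < t z <= 1 by rewrite tz t1'.
  by rewrite (cone_extE _ ha) ?lexx ?t1'// tensor_clamp ?lexx ?t1'.
rewrite /rho !ext//.
have c0 := ccontR (lsec_cont h0); have c1 := ccontR (lsec_cont h1).
have := cfcD UU UV (calcP c0) (calcP c1).
have -> : (fun z => (t0 z)%:C%C + (t1 z)%:C%C) = fun=> 1 :> R[i].
  by apply/funext => z; rewrite -rmorphD h01 rmorph1.
by move=> h; apply: (cfc_uniq UU UV h); exact: cfc1.
Qed.

End Dimensions.

(** * A copy of C(Z/k) spanned by the spectral projections of a unitary of order k *)

Section CyclicUnitary.
Variables (R : realType) (k : nat).
Hypothesis k0 : (0 < k)%N.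
Local Notation G := (roots_of_unity R k).
Variables (A : cstarAlgType R) (alpha : G -> A -> A) (u : A).
Hypotheses (uu : star u * u = 1) (uk : u ^+ k = 1).
Hypotheses (alpha_hom : forall g, star_hom (alpha g))
  (alpha_u : forall g, alpha g u = root_c g *: u)
  (alpha1 : forall g, alpha g 1 = 1).
Local Notation rts := (unity_roots R k0).

(** The projection onto the eigenspace of [u] for the eigenvalue [root_c g], by Fourier inversion on
    Z/k. *)
Definition spectral_proj (g : G) : A :=
  k%:R^-1 *: \sum_(m < k) (root_c g) ^- m *: u ^+ m.

Lemma kC_neq0 : (k%:R : R[i]) != 0.
Proof. by rewrite pnatr_eq0 -lt0n. Qed.

Lemma mul_spectral_proj g : u * spectral_proj g = root_c g *: spectral_proj g.
Proof.
rewrite /spectral_proj -scalerAr scalerA mulrC -scalerA; congr (_ *: _).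
rewrite mulr_sumr scaler_sumr.
under eq_bigr => m _ do rewrite -scalerAr -exprS.
under [RHS]eq_bigr => m _ do rewrite scalerA.
case: k k0 uk g => // k' _ uk' g.
rewrite big_ord_recr [RHS]big_ord_recl /= addrC; congr (_ + _).
  rewrite uk' expr0 invr1 mulr1; congr (_ *: _).
  have := root_cX g; rewrite exprSr => h.
  by rewrite -[LHS]mul1r -h -mulrA mulrCA divff ?mulr1// expf_neq0// root_c_neq0.
apply: eq_bigr => i _; congr (_ *: _); rewrite /bump /= add1n exprS invfM mulrA.
by rewrite divff ?mul1r// root_c_neq0.
Qed.

Lemma expr_spectral_proj g m : u ^+ m * spectral_proj g = root_c g ^+ m *: spectral_proj g.
Proof.
elim: m => [|m IH]; first by rewrite mul1r scale1r.
by rewrite exprSr -mulrA mul_spectral_proj -scalerAr IH scalerA -exprS.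
Qed.

Lemma spectral_proj_mul g h :
  spectral_proj g * spectral_proj h = if g == h then spectral_proj h else 0.
Proof.
rewrite {1}/spectral_proj -scalerAl mulr_suml.
under eq_bigr => m _ do rewrite -scalerAl expr_spectral_proj scalerA.
rewrite -scaler_suml scalerA.
under eq_bigr => m _ do rewrite mulrC -exprVn -exprMn.
case: eqP => [->|gh].
  under eq_bigr => m _ do rewrite divff ?root_c_neq0// expr1n.
  by rewrite sumr_const card_ord mulVf ?scale1r// kC_neq0.
rewrite sum_powers_eq0 ?mulr0 ?scale0r//.
  by rewrite exprMn exprVn !root_cX divr1.
apply/eqP => h1; apply: gh; apply: root_c_inj.
by rewrite -[RHS](divfK (root_c_neq0 g)) h1 mul1r.
Qed.

Lemma sum_spectral_proj : \sum_(g <- rts) spectral_proj g = 1.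
Proof.
rewrite /spectral_proj -scaler_sumr exchange_big /=.
under eq_bigr => m _ do rewrite -scaler_suml.
have S (m : 'I_k) : \sum_(g <- rts) root_c g ^- m = if (m : nat) == 0%N then k%:R else 0.
  have -> : \sum_(g <- rts) root_c g ^- m = (\sum_(g <- rts) root_c g ^+ m)^*.
    rewrite rmorph_sum /=; apply: eq_bigr => g _.
    by rewrite rmorphXn /= root_cJ exprVn.
  by rewrite sum_root_c_pow//; case: ifP; rewrite ?conjC_nat ?conjC0.
under eq_bigr => m _ do rewrite S.
rewrite (bigD1 (Ordinal k0))//= big1 ?addr0.
  by rewrite scalerA mulVf ?scale1r// kC_neq0.
by move=> m m0; rewrite ifN ?scale0r//; apply: contra m0 => /eqP h; apply/eqP/val_inj.
Qed.

(** As [star u * u = 1], the adjoint of p_g is an eigenvector of right multiplication by u with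
    eigenvalue [root_c g]. Hence the adjoint equals [star p_g * p_g], which is self-adjoint. *)
Lemma star_spectral_proj g : star (spectral_proj g) = spectral_proj g.
Proof.
have h : star (spectral_proj g) * u = root_c g *: star (spectral_proj g).
  have := congr1 (fun x => star x * u) (mul_spectral_proj g).
  rewrite starM -mulrA uu mulr1 (starZ (root_c g)) root_cJ -scalerAl => e.
  by rewrite [in RHS]e scalerA divff ?scale1r// root_c_neq0.
have hX m : star (spectral_proj g) * u ^+ m = root_c g ^+ m *: star (spectral_proj g).
  elim: m => [|m IH]; first by rewrite mulr1 scale1r.
  by rewrite exprSr mulrA IH -scalerAl h scalerA -exprSr.
have hP g' : star (spectral_proj g) * spectral_proj g' =
    if g' == g then star (spectral_proj g) else 0.
  rewrite /spectral_proj -/(spectral_proj g) -scalerAr mulr_sumr.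
  under eq_bigr => m _ do rewrite -scalerAr hX scalerA.
  rewrite -scaler_suml scalerA.
  under eq_bigr => m _ do rewrite mulrC -exprVn -exprMn.
  case: eqP => [->|gg].
    under eq_bigr => m _ do rewrite divff ?root_c_neq0// expr1n.
    by rewrite sumr_const card_ord mulVf ?scale1r// kC_neq0.
  rewrite sum_powers_eq0 ?mulr0 ?scale0r//.
    by rewrite exprMn exprVn !root_cX divr1.
  apply/eqP => h1; apply: gg; apply: root_c_inj.
  by rewrite -[RHS](divfK (root_c_neq0 g')) h1 mul1r.
have e : star (spectral_proj g) = star (spectral_proj g) * spectral_proj g.
  by rewrite hP eqxx.
by rewrite -[RHS]starK e starM starK.
Qed.

Lemma alpha_spectral_proj g h : alpha h (spectral_proj g) = spectral_proj (g * h^-1)%g.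
Proof.
have [aD aZ aM aS] := alpha_hom h.
have a0 : alpha h 0 = 0 by rewrite -(scale0r (1 : A)) aZ !scale0r.
rewrite /spectral_proj aZ; congr (_ *: _); rewrite (big_morph _ aD a0).
apply: eq_bigr => m _; rewrite aZ root_cM root_cV exprMn exprVn invfM invrK.
have -> : alpha h (u ^+ m) = root_c h ^+ m *: u ^+ m.
  elim: (m : nat) => [|i IH]; first by rewrite alpha1 scale1r.
  by rewrite !exprS aM alpha_u IH -scalerAl -scalerAr scalerA.
by rewrite scalerA.
Qed.

Lemma has_SLT0_unitary : has_SLT alpha 0.
Proof.
exists (fun f => \sum_(g <- rts) f g *: spectral_proj g); split; last first.
- by under eq_bigr do rewrite scale1r; exact: sum_spectral_proj.
- move=> h f _; rewrite /=.
  have [aD aZ aM aS] := alpha_hom h.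
  have a0 : alpha h 0 = 0 by rewrite -(scale0r (1 : A)) aZ !scale0r.
  rewrite (big_morph _ aD a0) [RHS](roots_mul_big k0 _ _ _ h).
  by apply: eq_bigr => g _; rewrite aZ alpha_spectral_proj mulgK.
split.
- move=> f g _ _; rewrite -big_split /=; apply: eq_bigr => x _.
  by rewrite scalerDl.
- by move=> c f _; rewrite [RHS]scaler_sumr; apply: eq_bigr => x _; rewrite [RHS]scalerA.
- move=> f g _ _; rewrite mulr_suml; apply: eq_big_seq => x xr /=.
  rewrite mulr_sumr (bigD1_seq x)//= ?unity_roots_uniq// big1 ?addr0.
    by rewrite -scalerAl -scalerAr spectral_proj_mul eqxx [RHS]scalerA.
  move=> y yx; rewrite -scalerAl -scalerAr spectral_proj_mul.
  by rewrite eq_sym (negPf yx) !scaler0.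
- move=> f _; rewrite star_sum; apply: eq_bigr => x _.
  by rewrite starZ star_spectral_proj.
Qed.

End CyclicUnitary.

(** * Unitaries in the algebra of the cycle *)

Section CycleAlgebra.
Variables (R : realType) (n : nat) (A : cstarAlgType R).
Variables (P S : 'I_n.+1 -> A).
Hypothesis hF : @graph_family R (cycle_graph n.+1) A P S.

Lemma cycle_PP i : P i * P i = P i.
Proof. by have [] := graph_proj hF i. Qed.

Lemma cycle_starP i : star (P i) = P i.
Proof. by have [] := graph_proj hF i. Qed.

Lemma cycle_PPo i j : i != j -> P i * P j = 0.
Proof. exact: (graph_proj_ortho hF). Qed.

Lemma cycle_starSS i : star (S i) * S i = P (ordS i).
Proof. exact: (graph_rng hF). Qed.

Lemma cycle_SstarS i : S i * star (S i) = P i.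
Proof.
rewrite (graph_sum hF (v := i)); last by exists i.
by rewrite (big_pred1 i).
Qed.

Lemma cycle_PS i : P i * S i = S i.
Proof. by rewrite -cycle_SstarS; exact: (graph_piso hF i). Qed.

Lemma cycle_SP i : S i * P (ordS i) = S i.
Proof. by rewrite -cycle_starSS mulrA; exact: (graph_piso hF i). Qed.

Lemma cycle_sumP : cstar_generates (range P `|` range S) -> \sum_i P i = 1.
Proof.
move=> hG; set E := \sum_i P i.
have starE : star E = E.
  by rewrite /E star_sum; apply: eq_bigr => i _; exact: cycle_starP.
have EP j : E * P j = P j.
  rewrite /E mulr_suml (bigD1 j)//= cycle_PP big1 ?addr0// => i ij.
  exact: cycle_PPo.
have PE j : P j * E = P j by rewrite -[LHS]starK starM starE cycle_starP EP cycle_starP.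
(* The elements for which E acts as a two-sided unit form a closed *-subalgebra containing the
   generators. The generation clause does not presuppose 1 in a subalgebra, so it yields 1 in [D],
   i.e. E = 1. *)
pose D : set A := [set x | E * x = x /\ x * E = x].
suff : D 1 by case; rewrite mulr1.
suff -> : D = setT by [].
apply: hG.
- move=> u l hu hl.
  have small (e : R) : 0 < e -> exists m, cnorm (u m - l) < e.
    move/cvgrPdist_lt : hl => hl /hl [N _ hN]; exists N.
    by have := hN N (leqnn N); rewrite sub0r normrN ger0_norm// cnorm_ge0.
  have c0 : 0 < cnorm E + 1 by have := cnorm_ge0 E; lra.
  have bound (e : R) (x : A) (y : R) : 0 < e -> 0 <= y -> y < e / (cnorm E + 1) ->
      cnorm x <= cnorm E * y + y -> cnorm x <= e.
    move=> e0 y0; rewrite ltr_pdivlMr// => h1 h2; apply: le_trans h2 _.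
    have -> : cnorm E * y + y = y * (cnorm E + 1) by ring.
    exact: ltW.
  split; apply: cnorm_small_eq => e e0.
  + have [m hm] := small _ (divr_gt0 e0 c0); apply: (bound e _ _ e0 (cnorm_ge0 _) hm).
    have -> : E * l - l = (u m - l) - E * (u m - l).
      by rewrite mulrBr (hu m).1 opprB [RHS]addrC addrA subrK.
    apply: le_trans (cnormD _ _) _; rewrite cnormN addrC lerD2r.
    exact: cnormM.
  + have [m hm] := small _ (divr_gt0 e0 c0); apply: (bound e _ _ e0 (cnorm_ge0 _) hm).
    have -> : l * E - l = (u m - l) - (u m - l) * E.
      by rewrite mulrBl (hu m).2 opprB [RHS]addrC addrA subrK.
    apply: le_trans (cnormD _ _) _; rewrite cnormN addrC lerD2r mulrC.
    exact: cnormM.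
- by split; rewrite ?mulr0 ?mul0r.
- by move=> x y [x1 x2] [y1 y2]; split; rewrite ?mulrDr ?mulrDl ?x1 ?x2 ?y1 ?y2.
- by move=> c x [x1 x2]; split; rewrite -?scalerAr -?scalerAl ?x1 ?x2.
- by move=> x y [x1 x2] [y1 y2]; split; [rewrite mulrA x1|rewrite -mulrA y2].
- move=> x [x1 x2]; split.
    by rewrite -{1}starE -starM x2.
  by rewrite -{1}starE -starM x1.
- move=> _ [[i _ <-]|[i _ <-]]; first by split.
  split; first by rewrite -{1}cycle_PS mulrA EP cycle_PS.
  by rewrite -{1}cycle_SP -mulrA PE cycle_SP.
Qed.

Hypothesis sumP : \sum_i P i = 1.

Definition cycle_unitary : A := \sum_i S i.

Lemma cycle_unitary_starM : star cycle_unitary * cycle_unitary = 1.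
Proof.
rewrite /cycle_unitary star_sum mulr_suml -sumP [RHS](reindex_inj (@ordS_inj n.+1)).
apply: eq_bigr => i _; rewrite mulr_sumr (bigD1 i)//= cycle_starSS big1 ?addr0// => j ji.
rewrite -{1}cycle_PS starM cycle_starP -mulrA -(cycle_PS j) (mulrA (P i)).
by rewrite cycle_PPo ?mul0r ?mulr0// eq_sym.
Qed.

Lemma cycle_unitary_Mstar : cycle_unitary * star cycle_unitary = 1.
Proof.
rewrite /cycle_unitary star_sum mulr_suml -sumP.
apply: eq_bigr => i _; rewrite mulr_sumr (bigD1 i)//= cycle_SstarS big1 ?addr0// => j ji.
rewrite -(cycle_SP i) -(cycle_SP j) starM cycle_starP -mulrA (mulrA (P _)).
rewrite cycle_PPo ?mul0r ?mulr0// (inj_eq (@ordS_inj n.+1)) eq_sym//.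
Qed.

(** The path S_0 ... S_(j-1) from vertex 0. For j <= n it never runs through the closing edge n, so
    it is a partial isometry from vertex j to vertex 0. *)
Definition cycle_path (j : nat) : A :=
  iteri j (fun i x => x * S (inord i)) (P ord0).

Lemma cycle_pathS j : cycle_path j.+1 = cycle_path j * S (inord j).
Proof. by []. Qed.

Lemma ordS_inord j : (j < n)%N -> ordS (inord j : 'I_n.+1) = inord j.+1.
Proof.
move=> jn; apply: val_inj; rewrite /= !inordK//; last exact: ltnW.
by rewrite modn_small.
Qed.

Lemma inord0 : inord 0 = ord0 :> 'I_n.+1.
Proof. by apply: val_inj; rewrite /= inordK. Qed.

Lemma cycle_path_spec j : (j <= n)%N ->
  [/\ P ord0 * cycle_path j = cycle_path j,
      cycle_path j * P (inord j) = cycle_path j,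
      cycle_path j * star (cycle_path j) = P ord0 &
      star (cycle_path j) * cycle_path j = P (inord j)].
Proof.
elim: j => [_|j IH jn].
  by rewrite inord0 /cycle_path /= cycle_starP cycle_PP; split.
have [h1 h2 h3 h4] := IH (ltnW jn).
rewrite cycle_pathS -ordS_inord//; split.
- by rewrite mulrA h1.
- by rewrite -mulrA cycle_SP.
- by rewrite starM mulrA -(mulrA _ (S _)) cycle_SstarS h2.
- by rewrite starM mulrA -(mulrA (star (S _))) h4 -mulrA cycle_PS cycle_starSS.
Qed.

(** Matrix units of a full matrix algebra inside [A], with gauge degree j - i. *)
Definition cycle_unit (i j : nat) : A := star (cycle_path i) * cycle_path j.

Lemma cycle_unitM i j l : (j <= n)%N -> (l <= n)%N ->
  cycle_unit i j * cycle_unit j l = cycle_unit i l.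
Proof.
move=> jn ln; have [_ _ h3 _] := cycle_path_spec jn; have [h1 _ _ _] := cycle_path_spec ln.
by rewrite /cycle_unit mulrA -(mulrA (star _)) h3 -mulrA h1.
Qed.

Lemma cycle_unitM0 i j j' l : (j <= n)%N -> (j' <= n)%N -> j != j' ->
  cycle_unit i j * cycle_unit j' l = 0.
Proof.
move=> jn jn' jj; rewrite /cycle_unit.
have [_ h2 _ _] := cycle_path_spec jn; have [_ h2' _ _] := cycle_path_spec jn'.
rewrite -h2 -[cycle_path j']h2' starM cycle_starP !mulrA -(mulrA _ (P _) (P _)).
rewrite cycle_PPo ?mulr0 ?mul0r//; apply: contra jj => /eqP /(congr1 val) /=.
by rewrite !inordK// => ->.
Qed.

Lemma star_cycle_unit i j : star (cycle_unit i j) = cycle_unit j i.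
Proof. by rewrite /cycle_unit starM starK. Qed.

Lemma sum_cycle_unit : \sum_(i < n.+1) cycle_unit i i = 1.
Proof.
rewrite -sumP; apply: eq_bigr => i _.
have in_ : (i <= n)%N by rewrite -ltnS.
by rewrite /cycle_unit; have [_ _ _ ->] := cycle_path_spec in_; rewrite inord_val.
Qed.

Lemma cycle_unit_gauge (alpha : A -> A) (c : circle R) : star_hom alpha ->
  (forall i, alpha (P i) = P i) ->
  (forall i, alpha (S i) = circle_val c *: S i) ->
  forall i j, alpha (cycle_unit i j) =
    (circle_val c ^- i * circle_val c ^+ j) *: cycle_unit i j.
Proof.
move=> [aD aZ aM aS] aP aSe.
have path j : alpha (cycle_path j) = circle_val c ^+ j *: cycle_path j.
  elim: j => [|j IH]; first by rewrite /cycle_path /= aP scale1r.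
  by rewrite cycle_pathS aM IH aSe -scalerAl -scalerAr scalerA exprSr.
move=> i j; rewrite /cycle_unit aM aS !path starZ -scalerAl -scalerAr scalerA.
by rewrite rmorphXn /= circle_conj exprVn.
Qed.

(* The shift by m inside each block of k consecutive indices. *)
Definition block_shift (k m i : nat) : nat := (i %/ k * k + (i %% k + m) %% k)%N.

Section BlockShift.
Variable k : nat.
Hypotheses (k0 : (0 < k)%N) (kn : (k %| n.+1)%N).

Lemma block_shift_lt m i : (i < n.+1)%N -> (block_shift k m i < n.+1)%N.
Proof.
move=> hi; rewrite -(divnK kn); apply: (@leq_trans ((i %/ k).+1 * k)).
  by rewrite /block_shift mulSn addnC ltn_add2r ltn_mod.
by rewrite leq_mul2r ltn_divLR// divnK// hi orbT.
Qed.

Lemma block_shiftD m l i : block_shift k l (block_shift k m i) = block_shift k (m + l) i.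
Proof.
rewrite /block_shift divnMDl// [(((i %% k + m) %% k) %/ k)%N]divn_small ?ltn_mod//.
by rewrite addn0 modnMDl modn_mod modnDml addnA.
Qed.

Lemma block_shift0 i : block_shift k 0 i = i.
Proof. by rewrite /block_shift addn0 modn_mod -divn_eq. Qed.

Lemma block_shiftk i : block_shift k k i = i.
Proof. by rewrite /block_shift modnDr modn_mod -divn_eq. Qed.

Lemma block_shift_mod m i : (block_shift k m i = i + m %[mod k])%N.
Proof. by rewrite /block_shift modnMDl modn_mod modnDml. Qed.

Definition block_unitary : A := \sum_(i < n.+1) cycle_unit i (block_shift k 1 i).

Lemma block_unitaryX m : block_unitary ^+ m =
  \sum_(i < n.+1) cycle_unit i (block_shift k m i).
Proof.
elim: m => [|m IH].
  by rewrite expr0 -sum_cycle_unit; apply: eq_bigr => i _; rewrite block_shift0.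
rewrite exprSr IH mulr_suml; apply: eq_bigr => i _.
have hm := block_shift_lt m (ltn_ord i).
rewrite /block_unitary mulr_sumr (bigD1 (Ordinal hm))//= big1 ?addr0; last first.
  move=> j ji; apply: cycle_unitM0; rewrite -1?ltnS//.
  by apply: contra ji => /eqP h; apply/eqP/val_inj.
rewrite cycle_unitM -1?ltnS//; last exact: block_shift_lt.
by rewrite block_shiftD addn1.
Qed.

Lemma block_unitary_expk : block_unitary ^+ k = 1.
Proof.
rewrite block_unitaryX -sum_cycle_unit; apply: eq_bigr => i _.
by rewrite block_shiftk.
Qed.

Lemma block_unitary_starM : star block_unitary * block_unitary = 1.
Proof.
pose s (i : 'I_n.+1) : 'I_n.+1 := Ordinal (block_shift_lt 1 (ltn_ord i)).
have s_inj : injective s.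
  (* The shift by k - 1 inverts the shift by 1. *)
  move=> i j /(congr1 (fun x : 'I__ => block_shift k k.-1 x)) /=.
  by rewrite !block_shiftD add1n prednK// !block_shiftk => /val_inj.
rewrite /block_unitary star_sum mulr_suml -sum_cycle_unit [RHS](reindex_inj s_inj) /=.
apply: eq_bigr => i _; rewrite star_cycle_unit mulr_sumr (bigD1 i)//= big1 ?addr0.
  by rewrite cycle_unitM -1?ltnS// block_shift_lt.
move=> j ji; apply: cycle_unitM0; rewrite -1?ltnS//.
by apply: contra ji => /eqP h; apply/eqP/val_inj.
Qed.

(** The entry that returns to the start of a block has degree 1 - k instead of 1; the scalars agree
    because [root_c g ^+ k = 1]. *)
Lemma block_unitary_gauge (alpha : A -> A) (g : roots_of_unity R k) :
  star_hom alpha -> (forall i, alpha (P i) = P i) ->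
  (forall i, alpha (S i) = root_c g *: S i) ->
  alpha block_unitary = root_c g *: block_unitary.
Proof.
move=> ha aP aS.
have a0 : alpha 0 = 0 by rewrite -(scale0r (1 : A)) (star_homZ ha) !scale0r.
rewrite /block_unitary (big_morph _ (star_homD ha) a0) scaler_sumr.
apply: eq_bigr => i _; rewrite (cycle_unit_gauge ha aP aS); congr (_ *: _).
rewrite -[circle_val _]/(root_c g).
rewrite -(expr_mod (block_shift k 1 i) (root_cX g)) block_shift_mod.
rewrite (expr_mod _ (root_cX g)) addn1 exprS mulrCA mulVf ?mulr1//.
by rewrite expf_neq0// root_c_neq0.
Qed.

End BlockShift.

End CycleAlgebra.

(** * Complex matrices with the operator norm form a C*-algebra *)

Lemma real_cauchy_cvg (R : realType) (u : nat -> R) :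
  (forall e : R, 0 < e -> exists N : nat, forall m n : nat,
     (N <= m)%N -> (N <= n)%N -> `|u m - u n| < e) ->
  exists l, forall e : R, 0 < e -> exists N : nat, forall n, (N <= n)%N ->
    `|u n - l| < e.
Proof.
move=> h.
have /cauchy_cvgP cu : cauchy (u @ \oo).
  apply: cauchy_exP => e e0; have [N hN] := h e e0; exists (u N).
  by exists N => // n /= Nn; rewrite /ball /=; exact: hN.
exists (lim (u @ \oo)) => e e0.
have /cvgrPdist_lt /(_ e e0) [N _ hN] := cu.
by exists N => n Nn; rewrite distrC; exact: hN.
Qed.

Lemma cauchy_schwarz_sum (R : rcfType) (I : finType) (a b : I -> R) :
  \sum_i a i * b i <= Num.sqrt (\sum_i a i ^+ 2) * Num.sqrt (\sum_i b i ^+ 2).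
Proof.
set X := \sum_i a i ^+ 2; set Y := \sum_i b i ^+ 2; set Z := \sum_i _.
have X0 : 0 <= X by apply: sumr_ge0 => i _; apply: sqr_ge0.
have Y0 : 0 <= Y by apply: sumr_ge0 => i _; apply: sqr_ge0.
(* This is the sum of the squares of Y a_i - Z b_i, scaled by Y to avoid division; Y = 0 is treated
   apart. *)
have key : 0 <= Y * (X * Y - Z ^+ 2).
  have -> : Y * (X * Y - Z ^+ 2) = \sum_i (Y * a i - Z * b i) ^+ 2.
    transitivity (\sum_i (Y ^+ 2 * a i ^+ 2 + (Z ^+ 2 * b i ^+ 2 - 2 * Y * Z * (a i * b i)))).
      by rewrite big_split sumrB /= -!mulr_sumr -/X -/Y -/Z; ring.
    by apply: eq_bigr => i _; ring.
  by apply: sumr_ge0 => i _; apply: sqr_ge0.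
have ZXY : Z ^+ 2 <= X * Y.
  move: Y0 key; rewrite le_eqVlt => /predU1P[Y0 _|Y0].
    have b0 i : b i = 0.
      apply/eqP; rewrite -sqrf_eq0; apply/eqP.
      move/esym/eqP: Y0; rewrite psumr_eq0; last by move=> j _; apply: sqr_ge0.
      by move=> /allP /(_ i (mem_index_enum i)) /eqP.
    by rewrite -Y0 mulr0 /Z big1 ?expr0n// => i _; rewrite b0 mulr0.
  by rewrite pmulr_rge0// subr_ge0.
rewrite -sqrtrM//; apply: le_trans (ler_norm _) _.
by rewrite -sqrtr_sqr ler_wsqrtr.
Qed.

Section OperatorNorm.
Variables (R : realType) (n : nat).
Local Notation C := R[i].
Implicit Types (u v : 'cV[C]_n.+1) (M N : 'M[C]_n.+1).

Definition vnorm v : R := Num.sqrt (\sum_i nc (v i 0) ^+ 2).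

Lemma vnorm_ge0 v : 0 <= vnorm v.
Proof. exact: sqrtr_ge0. Qed.

Lemma vnorm_sqr v : vnorm v ^+ 2 = \sum_i nc (v i 0) ^+ 2.
Proof. by rewrite sqr_sqrtr//; apply: sumr_ge0 => i _; apply: sqr_ge0. Qed.

Lemma vnorm0 : vnorm 0 = 0.
Proof.
by rewrite /vnorm big1 ?sqrtr0// => i _; rewrite mxE nc0 expr0n.
Qed.

Lemma vnorm_entry v i : nc (v i 0) <= vnorm v.
Proof.
rewrite -(@ler_pXn2r _ 2)// ?nnegrE ?vnorm_ge0 ?nc_ge0// vnorm_sqr (bigD1 i)//=.
by rewrite lerDl; apply: sumr_ge0 => j _; apply: sqr_ge0.
Qed.

Lemma vnorm0_eq0 v : vnorm v = 0 -> v = 0.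
Proof.
move=> h; apply/matrixP => i j; rewrite ord1 mxE; apply: nc_eq0.
by apply/eqP; rewrite eq_le nc_ge0 andbT -h vnorm_entry.
Qed.

Lemma vnormZ c v : vnorm (c *: v) = nc c * vnorm v.
Proof.
rewrite /vnorm -[in RHS](ger0_norm (nc_ge0 c)) -sqrtr_sqr -sqrtrM ?sqr_ge0//.
by rewrite mulr_sumr; congr Num.sqrt; apply: eq_bigr => i _; rewrite mxE ncM exprMn.
Qed.

Lemma vnormD u v : vnorm (u + v) <= vnorm u + vnorm v.
Proof.
rewrite -(@ler_pXn2r _ 2)// ?nnegrE ?addr_ge0 ?vnorm_ge0//.
rewrite sqrrD !vnorm_sqr.
apply: (@le_trans _ _ (\sum_i (nc (u i 0) + nc (v i 0)) ^+ 2)).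
  apply: ler_sum => i _; rewrite mxE lerXn2r ?nnegrE ?addr_ge0 ?nc_ge0//.
  exact: ncD.
under eq_bigr do rewrite sqrrD; rewrite !big_split /= lerD2r lerD2l mulr2n.
by apply: lerD; exact: cauchy_schwarz_sum.
Qed.

Lemma vnorm_sum (I : Type) (r : seq I) (F : I -> 'cV[C]_n.+1) :
  vnorm (\sum_(i <- r) F i) <= \sum_(i <- r) vnorm (F i).
Proof.
elim/big_rec2: _ => [|i a b _ h]; first by rewrite vnorm0.
by apply: le_trans (vnormD _ _) _; rewrite lerD2l.
Qed.

Definition adj m p (M : 'M[C]_(m, p)) : 'M[C]_(p, m) := map_mx Num.conj M^T.

Lemma adjM m p q (M : 'M[C]_(m, p)) (N : 'M[C]_(p, q)) :
  adj (M *m N) = adj N *m adj M.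
Proof. by rewrite /adj trmx_mul map_mxM. Qed.

Lemma adjK m p (M : 'M[C]_(m, p)) : adj (adj M) = M.
Proof. by apply/matrixP => i j; rewrite !mxE conjCK. Qed.

Definition dot u v : C := (adj u *m v) 0 0.

Lemma dotE u v : dot u v = \sum_i (u i 0)^* * v i 0.
Proof. by rewrite /dot mxE; apply: eq_bigr => i _; rewrite !mxE. Qed.

Lemma dot_vnorm v : dot v v = (vnorm v ^+ 2)%:C%C.
Proof.
rewrite dotE vnorm_sqr rmorph_sum; apply: eq_bigr => i _ /=.
by rewrite nc_sqr mulrC.
Qed.

Lemma dot_bound u v : nc (dot u v) <= vnorm u * vnorm v.
Proof.
rewrite dotE; apply: le_trans (nc_sum _ _ _) _.
under eq_bigr do rewrite ncM ncJ.
exact: cauchy_schwarz_sum.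
Qed.

Lemma dot_mulmx M u v : dot u (M *m v) = dot (adj M *m u) v.
Proof. by rewrite /dot adjM adjK mulmxA. Qed.

Definition opnorm_set M : set R := [set vnorm (M *m v) | v in [set v | vnorm v <= 1]].
Definition opnorm M : R := sup (opnorm_set M).

Lemma opnorm_has_sup M : has_sup (opnorm_set M).
Proof.
split; first by exists (vnorm (M *m 0)); exists 0; rewrite //= vnorm0 ler01.
exists (\sum_j vnorm (col j M)) => _ [v /= v1 <-].
have -> : M *m v = \sum_j v j 0 *: col j M.
  apply/matrixP => i j; rewrite ord1 !mxE summxE.
  by apply: eq_bigr => l _; rewrite !mxE mulrC.
apply: le_trans (vnorm_sum _ _) _; apply: ler_sum => j _; rewrite vnormZ.
by apply: ler_piMl (vnorm_ge0 _) _; apply: le_trans (vnorm_entry v j) v1.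
Qed.

Lemma opnorm_ge0 M : 0 <= opnorm M.
Proof.
apply: (ub_le_sup (opnorm_has_sup M).2); exists 0; rewrite /= ?vnorm0 ?ler01//.
by rewrite mulmx0 vnorm0.
Qed.

Lemma opnorm_ub M v : vnorm (M *m v) <= opnorm M * vnorm v.
Proof.
have := vnorm_ge0 v; rewrite le_eqVlt => /predU1P[v0|v0].
  by rewrite (vnorm0_eq0 (esym v0)) mulmx0 vnorm0 mulr0.
have v0' : nc ((vnorm v)^-1)%:C%C = (vnorm v)^-1 by rewrite ncR ger0_norm// invr_ge0 ltW.
rewrite -ler_pdivrMr// mulrC -{1}v0' -vnormZ scalemxAr.
apply: (ub_le_sup (opnorm_has_sup M).2); exists ((vnorm v)^-1%:C%C *: v) => //=.
by rewrite vnormZ v0' mulVf// gt_eqF.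
Qed.

Lemma opnorm_le M (c : R) : 0 <= c -> (forall v, vnorm (M *m v) <= c * vnorm v) ->
  opnorm M <= c.
Proof.
move=> c0 h; apply: (sup_le_ub (opnorm_has_sup M).1) => _ [v /= v1 <-].
by apply: le_trans (h v) _; exact: ler_piMr.
Qed.

Lemma opnorm_entry M i j : nc (M i j) <= opnorm M.
Proof.
have -> : M i j = (M *m delta_mx j (0 : 'I_1)) i 0.
  by rewrite -colE mxE.
apply: le_trans (vnorm_entry _ _) _; apply: le_trans (opnorm_ub _ _) _.
apply: ler_piMr; first exact: opnorm_ge0.
rewrite /vnorm (bigD1 j)//= big1 ?addr0.
  by rewrite mxE !eqxx nc1 expr1n sqrtr1.
by move=> l lj; rewrite mxE (negPf lj) nc0 expr0n.
Qed.

Lemma opnorm_le_entries M : opnorm M <= \sum_i \sum_j nc (M i j).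
Proof.
have S0 : 0 <= \sum_i \sum_j nc (M i j).
  by apply: sumr_ge0 => i _; apply: sumr_ge0 => j _; exact: nc_ge0.
apply: opnorm_le => // v.
have -> : M *m v = \sum_i \sum_j (M i j * v j 0) *: delta_mx i 0.
  apply/matrixP => i j; rewrite ord1 mxE summxE [RHS](bigD1 i)//= [X in _ + X]big1 ?addr0.
    by rewrite summxE; apply: eq_bigr => l _; rewrite !mxE !eqxx mulr1.
  move=> l li; rewrite summxE big1// => m _.
  by rewrite !mxE eq_sym (negPf li) mulr0.
apply: le_trans (vnorm_sum _ _) _; rewrite mulr_suml; apply: ler_sum => i _.
apply: le_trans (vnorm_sum _ _) _; rewrite mulr_suml; apply: ler_sum => j _.
rewrite vnormZ ncM -mulrA; apply: ler_wpM2l; first exact: nc_ge0.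
have d1 : vnorm (delta_mx i 0) = 1.
  rewrite /vnorm (bigD1 i)//= big1 ?addr0; first by rewrite mxE !eqxx nc1 expr1n sqrtr1.
  by move=> l li; rewrite mxE (negPf li) nc0 expr0n.
by rewrite d1 mulr1 vnorm_entry.
Qed.

Lemma opnorm0_eq0 M : opnorm M = 0 -> M = 0.
Proof.
move=> h; apply/matrixP => i j; rewrite mxE; apply: nc_eq0.
by apply/eqP; rewrite eq_le nc_ge0 andbT -h opnorm_entry.
Qed.

Lemma opnormD M N : opnorm (M + N) <= opnorm M + opnorm N.
Proof.
apply: opnorm_le => [|v]; first by rewrite addr_ge0 ?opnorm_ge0.
rewrite mulmxDl mulrDl; apply: le_trans (vnormD _ _) _.
by apply: lerD; exact: opnorm_ub.
Qed.

Lemma opnormZ c M : opnorm (c *: M) = nc c * opnorm M.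
Proof.
have h (d : C) N : opnorm (d *: N) <= nc d * opnorm N.
  apply: opnorm_le => [|v]; first by rewrite mulr_ge0 ?nc_ge0 ?opnorm_ge0.
  rewrite -scalemxAl vnormZ -mulrA; apply: ler_wpM2l; first exact: nc_ge0.
  exact: opnorm_ub.
apply/eqP; rewrite eq_le h /=.
have [->|c0] := eqVneq c 0; first by rewrite nc0 mul0r opnorm_ge0.
have nc0' : 0 < nc c.
  by rewrite lt_def nc_ge0 andbT; apply: contra c0 => /eqP /nc_eq0 ->.
rewrite mulrC -ler_pdivlMr// mulrC -ncV.
by rewrite -{1}[M]scale1r -(mulVf c0) -scalerA; exact: h.
Qed.

Lemma opnormM M N : opnorm (M *m N) <= opnorm M * opnorm N.
Proof.
apply: opnorm_le => [|v]; first by rewrite mulr_ge0 ?opnorm_ge0.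
rewrite -mulmxA -mulrA; apply: le_trans (opnorm_ub _ _) _.
by apply: ler_wpM2l; [exact: opnorm_ge0|exact: opnorm_ub].
Qed.

(** For w = [adj M *m v], the square of |w| is the scalar product of v with [M *m w], at most |v|
    |M| |w|; then cancel |w|. *)
Lemma opnorm_adj M : opnorm (adj M) <= opnorm M.
Proof.
apply: opnorm_le => [|v]; first exact: opnorm_ge0.
set w := adj M *m v.
have := vnorm_ge0 w; rewrite le_eqVlt => /predU1P[<-|w0].
  by rewrite mulr_ge0 ?opnorm_ge0 ?vnorm_ge0.
rewrite -(ler_pM2r w0) -expr2.
have -> : vnorm w ^+ 2 = nc (dot v (M *m w)).
  by rewrite dot_mulmx dot_vnorm ncR ger0_norm// sqr_ge0.
apply: le_trans (dot_bound _ _) _.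
rewrite [leRHS]mulrAC mulrC; apply: ler_wpM2r; first exact: vnorm_ge0.
exact: opnorm_ub.
Qed.

Lemma opnorm_cstar M : opnorm (adj M *m M) = opnorm M ^+ 2.
Proof.
apply/eqP; rewrite eq_le; apply/andP; split.
  apply: le_trans (opnormM _ _) _; rewrite expr2.
  by apply: ler_wpM2r; [exact: opnorm_ge0|exact: opnorm_adj].
have s0 := opnorm_ge0 (adj M *m M).
rewrite -[leRHS]sqr_sqrtr// ler_pXn2r ?nnegrE ?opnorm_ge0 ?sqrtr_ge0//.
apply: opnorm_le => [|v]; first exact: sqrtr_ge0.
rewrite -(@ler_pXn2r _ 2)// ?nnegrE ?mulr_ge0 ?vnorm_ge0 ?sqrtr_ge0//.
have -> : vnorm (M *m v) ^+ 2 = nc (dot v (adj M *m M *m v)).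
  by rewrite -mulmxA dot_mulmx adjK dot_vnorm ncR ger0_norm// sqr_ge0.
apply: le_trans (dot_bound _ _) _.
rewrite exprMn sqr_sqrtr// expr2 mulrA mulrC; apply: ler_wpM2r; first exact: vnorm_ge0.
exact: opnorm_ub.
Qed.

(** The operator norm dominates each entry and is dominated by the sum of all, so completeness
    reduces to that of the reals. *)
Lemma opnorm_complete (u : nat -> 'M[C]_n.+1) :
  (forall e : R, 0 < e -> exists N : nat, forall m p : nat,
      (N <= m)%N -> (N <= p)%N -> opnorm (u m - u p) < e) ->
    exists l, (fun m => opnorm (u m - l)) @ \oo --> (0 : R).
Proof.
move=> h.
have entry (f : C -> R) (fB : forall x y, f (x - y) = f x - f y)
    (fn : forall x, `|f x| <= nc x) i j : exists l : R, forall e : R, 0 < e ->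
    exists N : nat, forall m, (N <= m)%N -> `|f (u m i j) - l| < e.
  apply: real_cauchy_cvg => e e0; have [N hN] := h e e0; exists N => m p hm hp.
  rewrite -fB; apply: le_lt_trans (fn _) _; apply: le_lt_trans (hN m p hm hp).
  by have := opnorm_entry (u m - u p) i j; rewrite !mxE.
have ReB (x y : C) : Re (x - y) = Re x - Re y by rewrite raddfB.
have ImB (x y : C) : complex.Im (x - y) = complex.Im x - complex.Im y by rewrite raddfB.
have Imn (x : C) : `|complex.Im x| <= nc x.
  case: x => a b /=; rewrite -sqrtr_sqr ler_wsqrtr// lerDr sqr_ge0//.
have [a ha] := choice (fun ij : 'I_n.+1 * 'I_n.+1 =>
  entry (@complex.Re R) ReB (@nc_ge_Re R) ij.1 ij.2).
have [b hb] := choice (fun ij : 'I_n.+1 * 'I_n.+1 =>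
  entry (@complex.Im R) ImB Imn ij.1 ij.2).
pose l : 'M[C]_n.+1 := \matrix_(i, j) (a (i, j) +i* b (i, j))%C.
exists l; apply/cvgrPdist_lt => e e0.
(* One unit for the real and one for the imaginary part of each entry; dividing by K + 1 makes the
   final inequality strict. *)
pose K : R := (n.+1 * n.+1)%:R * 2.
have K0 : 0 < K by rewrite mulr_gt0 ?ltr0n.
have eK : 0 < e / (K + 1) by rewrite divr_gt0//; lra.
have [Na hNa] := choice (fun ij => ha ij _ eK).
have [Nb hNb] := choice (fun ij => hb ij _ eK).
exists (\max_ij maxn (Na ij) (Nb ij)) => // m /= hm.
rewrite sub0r normrN ger0_norm ?opnorm_ge0//.
apply: le_lt_trans (opnorm_le_entries _) _.
apply: (@le_lt_trans _ _ (\sum_(i < n.+1) \sum_(j < n.+1) (2 * (e / (K + 1))))).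
  apply: ler_sum => i _; apply: ler_sum => j _.
  have hij : (maxn (Na (i, j)) (Nb (i, j)) <= m)%N.
    by apply: leq_trans hm; exact: (leq_bigmax (i, j)).
  have h1 := hNa (i, j) m (leq_trans (leq_maxl _ _) hij).
  have h2 := hNb (i, j) m (leq_trans (leq_maxr _ _) hij).
  have -> : (u m - l) i j = (Re (u m i j) - a (i, j))%:C%C +
      'i%C * (complex.Im (u m i j) - b (i, j))%:C%C.
    rewrite !mxE; case: (u m i j) => x y /=; apply/eqP.
    by rewrite eq_complex /=; apply/andP; split; apply/eqP; ring.
  apply: le_trans (ncD _ _) _; rewrite ncM !ncR.
  have -> : nc ('i%C : C) = 1 by rewrite /= expr0n add0r expr1n sqrtr1.
  move: h1 h2 => /= h1 h2; lra.
rewrite !sumr_const !card_ord -mulrnA -[X in X < _]mulr_natl mulrA -/K.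
by rewrite mulrA ltr_pdivrMr; [rewrite mulrC ltr_pM2l//; lra|lra].
Qed.

Lemma matrix_starD M N : adj (M + N) = adj M + adj N.
Proof. by rewrite /adj linearD /= map_mxD. Qed.

Lemma matrix_starZ c M : adj (c *: M) = c^* *: adj M.
Proof. by apply/matrixP => i j; rewrite !mxE rmorphM. Qed.

End OperatorNorm.

HB.instance Definition _ (R : realType) (n : nat) :=
  @isCStarAlgebra.Build R 'M[R[i]]_n.+1 (@adj R n.+1 n.+1) (@opnorm R n)
    (@matrix_starD R n) (@matrix_starZ R n)
    (fun M N => adjM M N) (fun M => adjK M)
    (@opnorm_ge0 R n) (@opnorm0_eq0 R n) (@opnormD R n) (@opnormZ R n)
    (@opnormM R n) (@opnorm_cstar R n) (@opnorm_complete R n).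

(** * The matrix representation of the cycle algebra *)

Section CycleRepresentation.
Variables (R : realType) (n : nat).
Local Notation M := 'M[R[i]]_n.+1.

Definition rep_P (i : 'I_n.+1) : M := delta_mx i i.
(** Under the identification of the cycle algebra with matrices over C(T), this is evaluation at the
    point 1. *)
Definition rep_S (i : 'I_n.+1) : M := delta_mx i (ordS i).

Lemma adj_delta (i j : 'I_n.+1) : star (delta_mx i j : M) = delta_mx j i.
Proof.
by apply/matrixP => a b; rewrite !mxE andbC conjC_nat.
Qed.

Lemma rep_family : @graph_family R (cycle_graph n.+1) M rep_P rep_S.
Proof.
have mM (i j l m : 'I_n.+1) : (delta_mx i j : M) * delta_mx l m =
  if j == l then delta_mx i m else 0.
  by rewrite -[LHS]/(_ *m _); case: eqP => [->|/eqP h]; rewrite ?mul_delta_mx// mul_delta_mx_0.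
have SsS e : rep_S e * star (rep_S e) = rep_P e by rewrite adj_delta mM eqxx.
split.
- by move=> i; split; rewrite ?adj_delta// mM eqxx.
- by move=> i j ij; rewrite mM (negPf ij).
- by move=> e; rewrite /partial_isometry SsS mM eqxx.
- by move=> e f ef; rewrite !SsS mM (negPf ef).
- by move=> e; rewrite adj_delta mM eqxx.
- by move=> e; exists 0; rewrite SsS subrr mulr0.
- move=> v _; rewrite (big_pred1 v) ?SsS//.
Qed.

Lemma rep_sum : \sum_i rep_P i = 1.
Proof.
apply/matrixP => i j; rewrite summxE mxE (bigD1 i)//= big1 ?addr0.
  by rewrite mxE eqxx /= eq_sym.
by move=> l li; rewrite mxE eq_sym (negPf li).
Qed.

(** In the rank factorisation p = C B, idempotency forces B C to be the identity of size [\rank p],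
    and the trace is cyclic. *)
Lemma mxtrace_idempotent (m : nat) (p : 'M[R[i]]_m) : p *m p = p ->
  \tr p = (\rank p)%:R.
Proof.
move=> pp.
have h : row_base p *m col_base p = 1%:M.
  have rf := row_base_free p; have cf := col_base_full p.
  apply: (row_free_inj rf); rewrite mul1mx; apply: (row_full_inj cf).
  by rewrite -(mulmxA (row_base p)) (mulmxA (col_base p)) mulmx_base pp.
by rewrite -{1}[p]mulmx_base mxtrace_mulC h mxtrace1.
Qed.

End CycleRepresentation.

(** * Nearby projections and paths of projections *)

Section Perturbation.
Variables (R : realType) (A : cstarAlgType R).
Implicit Types (v x p q : A).

Lemma cnormX_le x m : cnorm (x ^+ m) <= cnorm x ^+ m.
Proof.
elim: m => [|m IH]; first by rewrite cnorm1.
rewrite !exprS; apply: le_trans (cnormM _ _) _.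
by apply: ler_wpM2l; first exact: cnorm_ge0.
Qed.

(** The geometric series in 1 - v converges by completeness, and its limit inverts v on both
    sides. *)
Lemma neumann_invertible v : cnorm (1 - v) < 1 -> exists w, v * w = 1 /\ w * v = 1.
Proof.
set x := 1 - v => x1; pose q := cnorm x.
have q0 : 0 <= q by exact: cnorm_ge0.
have vE : v = 1 - x by rewrite /x opprB addrC subrK.
pose s m := \sum_(i < m) x ^+ i.
have vs m : v * s m = 1 - x ^+ m.
  by rewrite vE -opprB mulNr -subrX1 opprB.
have sv m : s m * v = 1 - x ^+ m.
  rewrite -vs; apply: commr_sym; apply: commr_sum => i _; rewrite vE.
  by apply: commrX; apply: commr_sym; apply: commrB; [exact: commr1|].
have sD m d : s (m + d)%N - s m = x ^+ m * s d.
  elim: d => [|d IH]; first by rewrite addn0 subrr /s big_ord0 mulr0.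
  rewrite addnS /s !big_ord_recr /= -/(s _) -/(s d) mulrDr -IH exprD.
  by rewrite addrAC.
have bnd m : cnorm (s m) <= (1 - q)^-1.
  apply: (@le_trans _ _ (\sum_(i < m) q ^+ i)).
    apply: le_trans (cnorm_sum _ _ _) _; apply: ler_sum => i _.
    exact: cnormX_le.
  rewrite -[leRHS]mul1r ler_pdivlMr ?subr_gt0// mulrC -opprB mulNr -subrX1 opprB.
  by rewrite gerBl exprn_ge0.
have powsmall (e : R) : 0 < e -> exists N : nat, forall m, (N <= m)%N -> q ^+ m < e.
  move=> e0; have /cvgrPdist_lt /(_ e e0) [N _ hN] : q ^+ m @[m --> \oo] --> 0.
    by apply: cvg_expr; rewrite ger0_norm.
  exists N => m hm; have := hN m hm.
  by rewrite sub0r normrN ger0_norm ?exprn_ge0.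
have q1 : 0 < 1 - q by rewrite subr_gt0.
have [|w hw] := @cstar_cauchy_cvg _ _ s.
  move=> e e0.
  have [N hN] := powsmall _ (mulr_gt0 e0 q1).
  have half m d : (N <= m)%N -> cnorm (s (m + d)%N - s m) < e.
    move=> hm; rewrite sD; apply: le_lt_trans (cnormM _ _) _.
    have h1 := ler_pM (cnorm_ge0 _) (cnorm_ge0 _) (cnormX_le x m) (bnd d).
    by apply: le_lt_trans h1 _; rewrite ltr_pdivrMr// hN.
  exists N => m p hm hp; have [le|le] := leqP m p.
    by rewrite cnormB -(subnKC le) half.
  by rewrite -(subnKC (ltnW le)) half.
have lim (f : A -> A) (c : R) : 0 < c -> (forall y, cnorm (f w - f y) <= c * cnorm (w - y)) ->
    (forall m, f (s m) = 1 - x ^+ m) -> f w = 1.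
  move=> c0 fc fs; apply: cnorm_small_eq => e e0.
  have e2 : 0 < e / 2 by lra.
  have ec : 0 < e / 2 / c by rewrite divr_gt0.
  have [N1 h1] := hw _ ec; have [N2 h2] := powsmall _ e2.
  pose m := maxn N1 N2.
  have hm1 := h1 m (leq_maxl _ _); have hm2 := h2 m (leq_maxr _ _).
  have -> : f w - 1 = (f w - f (s m)) + (f (s m) - 1) by rewrite addrA subrK.
  have -> : f (s m) - 1 = - x ^+ m by rewrite fs addrAC subrr add0r.
  apply: le_trans (cnormD _ _) _; rewrite cnormN.
  have h3 := fc (s m); rewrite [cnorm (w - _)]cnormB in h3.
  have h4 := cnormX_le x m; rewrite -/q in h4.
  rewrite ltr_pdivlMr// mulrC in hm1.
  by lra.
have c0 : 0 < cnorm v + 1 by have := cnorm_ge0 v; lra.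
exists w; split.
  apply: (lim (fun y => v * y) _ c0) => // y.
  rewrite -mulrBr; apply: le_trans (cnormM _ _) _.
  by apply: ler_wpM2r; [exact: cnorm_ge0|lra].
apply: (lim (fun y => y * v) _ c0) => // y.
rewrite -mulrBl; apply: le_trans (cnormM _ _) _; rewrite mulrC.
by apply: ler_wpM2r; [exact: cnorm_ge0|lra].
Qed.

(* v = q p + (1 - q)(1 - p) intertwines p and q and is close to 1. *)
Lemma trace_close_projections (T : Type) (tau : A -> T) p q :
  (forall x y, tau (x * y) = tau (y * x)) ->
  is_projection p -> is_projection q -> cnorm (p - q) < 1 / 2 -> tau p = tau q.
Proof.
move=> tr hp hq pq.
have [pp _] := hp; have [qq _] := hq.
pose v := q * p + (1 - q) * (1 - p).
(* This bounds |1 - v| by 2 |p - q|, which is why the hypothesis asks for 1/2. *)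
have v1 : 1 - v = (p - q) * p + q * (q - p).
  rewrite /v mulrBl mul1r !mulrBr mulr1 mulrBl pp qq.
  apply/eqP; rewrite subr_eq; apply/eqP; set a := q * p.
  by rewrite addrACA subrK [(q - a) + _]addrC subrK addrC subrK.
have [w [vw wv]] : exists w, v * w = 1 /\ w * v = 1.
  apply: neumann_invertible; rewrite v1; apply: le_lt_trans (cnormD _ _) _.
  have h1 := ler_pM (cnorm_ge0 _) (cnorm_ge0 _) (lexx (cnorm (p - q))) (cnorm_projection hp).
  have h2 := ler_pM (cnorm_ge0 _) (cnorm_ge0 _) (cnorm_projection hq) (lexx (cnorm (q - p))).
  have h3 := cnormM (p - q) p; have h4 := cnormM q (q - p).
  rewrite [cnorm (q - p)]cnormB in h2 h4 *.
  by lra.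
have vp : v * p = q * v.
  have pp' : (1 - p) * p = 0 by rewrite mulrBl mul1r pp subrr.
  have qq' : q * (1 - q) = 0 by rewrite mulrBr mulr1 qq subrr.
  by rewrite /v mulrDl -!mulrA pp pp' mulr0 addr0 mulrDr !mulrA qq qq' mul0r addr0.
by rewrite -[p]mul1r -wv -mulrA vp tr -mulrA vw mulr1.
Qed.

End Perturbation.

(** Connectedness of the line by calculus: the indicator of [f t = f a] is locally constant, hence
    has derivative 0 and is constant. *)
Lemma locally_constant_eq (R : realType) (T : Type) (f : R -> T) :
  (forall t, exists2 d : R, 0 < d & forall s, `|t - s| < d -> f s = f t) ->
  forall a b, f a = f b.
Proof.
move=> h a b; pose g t : R := (`[< f t = f a >])%:R.
have e : g a = g b.
  apply: is_derive_0_is_cst => x.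
  have [d d0 hd] := h x.
  apply: near_eq_is_derive (is_derive_cst (g x) x 1).
  by apply/nbhs_ballP; exists d => // s hs; rewrite /g (hd s hs).
move: e; rewrite /g; have -> : `[< f a = f a >] by apply/asboolP.
case: asboolP => [-> //|_ /eqP]; by rewrite oner_eq0.
Qed.

(** * Projections extracted from weak dimension zero *)

Section ConeFunctions.
Variables (R : realType) (k : nat).
Hypothesis k0 : (0 < k)%N.
Local Notation G := (roots_of_unity R k).

Lemma root_c_continuous : continuous (@root_c R k).
Proof.
move=> g; apply: (@continuous_comp _ _ _ (@root_val R k) (@circle_val R)).
- exact: root_val_continuous.
- exact: circle_val_continuous.
Qed.

Lemma roots_discrete (g : G) : \forall h \near g, h = g.
Proof.
have [r r0 hr] : exists2 r : R, 0 < r &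
    forall h : G, nc (root_c g - root_c h) < r -> h = g.
  have [r r0 hr] : exists2 r : R, 0 < r & forall h : G, h \in unity_roots R k0 ->
      nc (root_c g - root_c h) < r -> h = g.
    elim: (unity_roots R k0) => [|x l [r r0 hr]]; first by exists 1.
    have [->|xg] := eqVneq x g.
      by exists r => // h; rewrite inE => /predU1P[->|] //; exact: hr.
    have d0 : 0 < nc (root_c g - root_c x).
      rewrite lt_def nc_ge0 andbT; apply: contra xg => /eqP /nc_eq0 /eqP.
      by rewrite subr_eq0 => /eqP /root_c_inj ->.
    exists (Num.min r (nc (root_c g - root_c x))); first by rewrite lt_min r0 d0.
    move=> h; rewrite inE lt_min => /predU1P[->|hl] /andP[h1 h2]; last exact: hr.
    by rewrite ltxx in h2.
  by exists r => // h; apply: hr; exact: unity_roots_mem.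
have := @root_c_continuous g; move/continuous_ncP => /(_ r r0).
by apply: filterS => h; exact: hr.
Qed.

Lemma root_fun_continuous (f : G -> R[i]) : continuous f.
Proof.
move=> g; apply/continuous_ncP => e e0.
have := roots_discrete g; apply: filterS => h ->.
by rewrite subrr nc0.
Qed.

Lemma tensor_C0 (f : G -> R[i]) : C0_fun (tensor (@Defs.coord R) f).
Proof.
have ct : continuous (tensor (@Defs.coord R) f : cone R G -> R[i]).
  apply: ccontM.
    apply: ccontR => x; apply: continuous_comp; first exact: cvg_fst.
    exact: initial_continuous.
  move=> x; apply: continuous_comp; first exact: cvg_snd.
  exact: root_fun_continuous.
split=> // e e0.
have er : e = (Re e)%:C%C by rewrite RRe_real// gtr0_real.
move: e0; rewrite er ltcR; set d := Re e => d0.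
pose M : R := 1 + \sum_(g <- unity_roots R k0) nc (f g).
have fM g : nc (f g) <= M.
  rewrite /M (bigD1_seq g) ?unity_roots_mem ?unity_roots_uniq//= addrCA lerDl.
  by rewrite addr_ge0//; apply: sumr_ge0 => h _; exact: nc_ge0.
have M0 : 0 < M.
  by rewrite ltr_pwDl//; apply: sumr_ge0 => h _; exact: nc_ge0.
(* As |f| <= M, a modulus |s f(g)| >= d forces s >= d / M, so the superlevel set lies over [a, 1].
   The minimum with 1 keeps this a valid interval. *)
pose a := Num.min 1 (d / M).
have ha : 0 < a <= 1 by rewrite lt_min ltr01 divr_gt0//= ge_min lexx.
pose K : set (cone R G) := (clamp ha @` `[a, 1]) `*` [set: G].
have cK : compact K.
  apply: compact_setX.
    apply: continuous_compact; last exact: segment_compact.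
    by apply: continuous_subspaceT; exact: clamp_cont.
  apply: finite_compact.
  apply: (sub_finite_set (B := [set` unity_roots R k0])); last exact: finite_seq.
  by move=> g _ /=; exact: unity_roots_mem.
apply: (subclosed_compact _ cK).
  have -> : [set x | (d%:C)%C <= `|tensor (@Defs.coord R) f x|] =
      (fun x => nc (tensor (@Defs.coord R) f x)) @^-1` [set x | d <= x].
    by apply/seteqP; split=> x /=; rewrite normE lecR.
  apply: closed_comp; last exact: closed_ge.
  by move=> x _; exact: (rcont_nc ct).
move=> [x g] /=; rewrite normE lecR /tensor /= ncM ncR.
have x0 := half_open_gt0 x; have x1 := half_open_le1 x.
rewrite gtr0_norm// => dx; split=> //=.
have ax : a <= sval x.
  rewrite ge_min; apply/orP; right; rewrite ler_pdivrMr//.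
  by apply: le_trans dx _; apply: ler_wpM2l; [exact: ltW|exact: fM].
exists (sval x); last exact: clamp_sval.
by rewrite /= in_itv /= ax x1.
Qed.

Variables (A : cstarAlgType R) (alpha : G -> A -> A).
Hypotheses (alpha_hom : forall g, star_hom (alpha g))
  (alpha1 : forall g, alpha g 1 = 1).

(* On functions t (x) f the elements b = rho (t (x) 1) and
   b_g = rho (t (x) delta_g) satisfy b_g b_g = b b_g, so that b^-1 b_g is a
   projection. *)
Lemma WLT0_projections : has_WLT alpha 0 -> exists p : G -> A,
  [/\ forall g, is_projection (p g), \sum_(g <- unity_roots R k0) p g = 1 &
      forall g h, alpha h (p g) = p (g * h^-1)%g].
Proof.
move=> [rho [/(_ ord0) [[rD rZ rM rS] re]]].
rewrite big_ord1; set b := rho _ _ => -[c [bc cb]].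
pose r (f : G -> R[i]) := rho ord0 (tensor (@Defs.coord R) f).
have bE : b = r (fun=> 1) by [].
have rsD f1 f2 : r (fun g => f1 g + f2 g) = r f1 + r f2.
  rewrite -rD; try exact: tensor_C0.
  by congr rho; apply/funext => x; rewrite /tensor mulrDr.
have rs0 : r (fun=> 0) = 0.
  rewrite -[RHS](scale0r (r (fun=> 0))) -rZ; last exact: tensor_C0.
  by congr rho; apply/funext => x; rewrite /tensor mulr0 mul0r.
(* A product of two values of [r] is the image of t^2 (x) f1 f2, which is not of the form t (x) f;
   relations can thus only compare product with product. *)
have rsM f1 f2 f3 f4 : (forall g, f1 g * f2 g = f3 g * f4 g) -> r f1 * r f2 = r f3 * r f4.
  move=> e; rewrite -!rM; try exact: tensor_C0.
  by congr rho; apply/funext => x; rewrite /tensor mulrACA e mulrACA.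
have rsS f : r (fun g => (f g)^*) = star (r f).
  rewrite -rS; last exact: tensor_C0.
  congr rho; apply/funext => x; rewrite /tensor rmorphM /=; congr (_ * _).
  by rewrite conj_Creal// complex_real.
have rse f h : r (fun g => f (g * h)%g) = alpha h (r f).
  by rewrite -re; last exact: tensor_C0.
pose dl g : G -> R[i] := fun h => (h == g)%:R.
have starb g : star (r (dl g)) = r (dl g).
  by rewrite -rsS; congr r; apply/funext => h; rewrite conjC_nat.
have starb1 : star b = b.
  by rewrite bE -rsS; congr r; apply/funext => h; rewrite conjC1.
have comm g : b * r (dl g) = r (dl g) * b.
  by apply: rsM => h; rewrite mulrC.
have sq g : r (dl g) * r (dl g) = b * r (dl g).
  by apply: rsM => h; rewrite /dl; case: eqP; rewrite ?mulr0.
have sumb : \sum_(g <- unity_roots R k0) r (dl g) = b.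
  have -> : \sum_(g <- unity_roots R k0) r (dl g) =
      r (fun h => \sum_(g <- unity_roots R k0) dl g h).
    elim: (unity_roots R k0) => [|g l IH].
      by rewrite big_nil -rs0; congr r; apply/funext => h; rewrite big_nil.
    rewrite big_cons IH -rsD; congr r; apply/funext => h.
    by rewrite big_cons.
  rewrite bE; congr r; apply/funext => h.
  rewrite (bigD1_seq h) ?unity_roots_mem ?unity_roots_uniq//= /dl eqxx big1 ?addr0//.
  by move=> g gh; rewrite eq_sym (negPf gh).
have cc g : c * r (dl g) = r (dl g) * c.
  by rewrite -[LHS]mulr1 -bc !mulrA -(mulrA c) -comm mulrA cb mul1r.
have starc : star c = c.
  rewrite -[LHS]mulr1 -bc mulrA -[b in star c * b]starb1 -starM.
  by rewrite bc star1 mul1r.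
exists (fun g => c * r (dl g)); split.
- move=> g; split; last by rewrite starM starb starc cc.
  by rewrite -(mulrA c) (mulrA (r _) c) -cc -(mulrA c) sq (mulrA c b) cb mul1r.
- by rewrite -mulr_sumr sumb.
- move=> g h; have [aD aZ aM aS] := alpha_hom h.
  have ab : alpha h b = b by rewrite bE -rse.
  have ac : alpha h c = c.
    by rewrite -[LHS]mulr1 -bc mulrA -{1}ab -aM cb alpha1 mul1r.
  rewrite aM ac -rse; congr (_ * r _); apply/funext => x; rewrite /dl.
  by rewrite -{1}(mulgVK h g) (inj_eq (@mulIg _ h)).
Qed.

End ConeFunctions.

(** * Weak dimension zero forces divisibility *)

Section NoEquivariantProjection.
Variables (R : realType) (n k : nat) (A : cstarAlgType R).
Hypothesis k0 : (0 < k)%N.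
Variables (P S : 'I_n.+1 -> A).
Hypothesis hA : @is_graph_cstar R (cycle_graph n.+1) A P S.
Variable gamma : circle R -> A -> A.
Hypothesis hgamma : is_action gamma.

(* The gauge action is a path of automorphisms, so the rank of
   pi (gamma_z p) in M_n(C) does not depend on z; the k translates of p
   have equal rank and add up to the unit. *)
Lemma WLT0_dvdn : has_WLT (restrict_roots k gamma) 0 -> (k %| n.+1)%N.
Proof.
have [hF hG hU] := hA.
have sumP := cycle_sumP hF hG.
have [pi [piH piP piS]] := hU _ _ _ (rep_family R n).
have [piD piZ piM piSt] := piH.
have pi0 : pi 0 = 0 by rewrite -(scale0r (1 : A)) piZ scale0r.
have pi1 : pi 1 = 1.
  rewrite -sumP (big_morph _ piD pi0) -(rep_sum R n).
  by apply: eq_bigr => i _; exact: piP.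
move=> /(WLT0_projections k0) [g| | p [hp sump pe]].
- exact: (action_hom hgamma).
- by move=> g; exact: (action_unit hgamma).
pose tau (a : A) := \tr (pi a : 'M[R[i]]_n.+1).
have tauM x y : tau (x * y) = tau (y * x).
  by rewrite /tau !piM; exact: mxtrace_mulC.
have projg z : is_projection (gamma z (p 1%g)).
  have [h1 h2] := hp 1%g; have [_ _ gM gS] := action_hom hgamma z.
  by split; [rewrite -gM h1|rewrite -gS h2].
have const z : tau (gamma z (p 1%g)) = tau (p 1%g).
  (* The circle is parametrised by angles so that local constancy can be used on the real line; norm
     continuity of the gauge orbit brings nearby projections within 1/2. *)
  have key : forall a b : R, tau (gamma (circle_exp a) (p 1%g)) =
      tau (gamma (circle_exp b) (p 1%g)).
    apply: locally_constant_eq => t.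
    have /cvgrPdist_lt hc := action_continuous hgamma (p 1%g) (circle_exp t).
    have h2 : 0 < (1 / 2 : R) by lra.
    have /nbhs_circleP [r r0 hr] := hc _ h2.
    have /continuous_ncP /(_ _ r0) /nbhs_ballP [d /= d0 hd] := @continuous_cis R t.
    exists d => // s ts; apply: trace_close_projections => //.
    have := hr (circle_exp s) (hd s ts).
    by rewrite sub0r normrN ger0_norm ?cnorm_ge0.
  have [t [_ <-]] := circle_exp_surj z; have [t1 [_ e1]] := circle_exp_surj (1%g : circle R).
  by rewrite (key t t1) e1 (action1 hgamma).
have trp : tau (p 1%g) = (\rank (pi (p 1%g)))%:R.
  apply: mxtrace_idempotent; have [h1 _] := hp 1%g.
  by rewrite -[LHS]/(pi _ * pi _) -piM h1.
have : tau 1 = k%:R * (\rank (pi (p 1%g)))%:R.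
  rewrite -sump /tau (big_morph _ piD pi0) raddf_sum /=.
  transitivity (\sum_(g <- unity_roots R k0) tau (p 1%g)).
    (* [p g] is the translate of [p 1] by the inverse of g, so every summand has the same trace. *)
    apply: eq_bigr => g _; rewrite -(const (root_val g^-1%g)).
    by rewrite -[gamma _ _]/(restrict_roots k gamma _ _) pe invgK mul1g.
  by rewrite big_const_seq count_predT unity_roots_size iter_addr_0 trp mulr_natl.
rewrite /tau pi1 mxtrace1 -natrM => /eqP; rewrite eqr_nat => /eqP ->.
exact: dvdn_mulr.
Qed.

End NoEquivariantProjection.

Theorem corollary5p12 (R : realType) (n k : nat) (hn : (1 <= n)%N)
    (hk : (2 <= k)%N) (A : cstarAlgType R)
    (P : vertex (cycle_graph n) -> A) (S : edge (cycle_graph n) -> A)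
    (hA : is_graph_cstar P S)
    (gamma : circle R -> A -> A) (hgamma : is_gauge_action P S gamma) :
  ((k %| n)%N ->
    [/\ dimWLT (restrict_roots k gamma) = Some 0%N,
        dimLT (restrict_roots k gamma) = Some 0%N &
        dimSLT (restrict_roots k gamma) = Some 0%N]) /\
  (~~ (k %| n)%N ->
    [/\ dimWLT (restrict_roots k gamma) = Some 1%N,
        dimLT (restrict_roots k gamma) = Some 1%N &
        dimSLT (restrict_roots k gamma) = Some 1%N]).
Proof.
case: n hn P S hA hgamma => // n _ P S hA [hact hP hS].
have k0 : (0 < k)%N by exact: ltnW.
have [hF hG _] := hA.
have sumP := cycle_sumP hF hG.
pose alpha := restrict_roots k gamma.
have ah g : star_hom (alpha g) by exact: (action_hom hact).
have a1 g : alpha g 1 = 1 by exact: (action_unit hact).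
split=> hkn.
- have h0 : has_SLT alpha 0.
    apply: (has_SLT0_unitary k0 (u := block_unitary P S k)) => //.
    + exact: (block_unitary_starM hF sumP k0 hkn).
    + exact: (block_unitary_expk hF sumP k0 hkn).
    + move=> g; apply: (block_unitary_gauge (ah g)) => i.
        exact: hP.
      exact: hS.
  (* At level 0, strong implies plain implies weak, so one construction settles all three
     dimensions; the contrapositives serve below in the other case. *)
  have h1 := has_SLT0_LT0 h0.
  by split; apply: least0 => //; exact: has_LT_WLT.
- have nW : ~ has_WLT alpha 0.
    by move=> /(WLT0_dvdn k0 hA hact) h; rewrite h in hkn.
  have nL : ~ has_LT alpha 0 by move=> /has_LT_WLT.
  have nS : ~ has_SLT alpha 0 by move=> /has_SLT0_LT0.
  have UU := cycle_unitary_starM hF sumP.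
  have UV := cycle_unitary_Mstar hF sumP.
  have aU g : alpha g (cycle_unitary S) = root_c g *: cycle_unitary S.
    have a0 : alpha g 0 = 0 by rewrite -(scale0r (1 : A)) (star_homZ (ah g)) !scale0r.
    rewrite /cycle_unitary (big_morph _ (star_homD (ah g)) a0) scaler_sumr.
    by apply: eq_bigr => i _; exact: hS.
  have hL := has_LT1 k0 UU UV ah a1 aU.
  split; apply: least1 => //; first exact: has_LT_WLT.
  exact: (has_SLT1 k0 UU UV ah a1 aU).
Qed.
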